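(* Let $k$ be a power of $2$ and let $r\ge 1$ be a natural number. Then $$\Delta(\mathbf{R}^k,r) > (k+1)r+(k-1)(r-d(r))-1,$$ where $d(r)$ is the number of ones in the binary representation of $r$. In particular, if $r$ is also a power of $2$, then $\Delta(\mathbf{R}^k,r) > 2kr-k$.
   Context: Let $M$ be a smooth $k$-dimensional manifold and $r$ a natural number. A smooth embedding $M\to\mathbf{R}^N$ is called $r$-neighborly if for any $r$ (pairwise distinct) points in $M$ there is an affine hyperplane in $\mathbf{R}^N$ supporting (the image of) $M$ (i.e. $M$ lies in one of the two closed half-spaces it bounds) and touching it at exactly these $r$ points (i.e. the hyperplane meets $M$ in exactly these $r$ points). A smooth embedding $M\to\mathbf{R}^N$ is called stably $r$-neighborly if it is $r$-neighborly and any other embedding sufficiently close to it in the $C^2$-topology is also $r$-neighborly. $\Delta(M,r)$ denotes the minimal dimension $N$ such that there exists a stably $r$-neighborly embedding $M\to\mathbf{R}^N$. *)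

(* Defs.v *)
(* The manifold R^k is 'rV[R]_k over an arbitrary realType R. *)
From mathcomp Require Import all_boot all_order all_algebra.
From mathcomp Require Import all_classical all_reals all_analysis.
Set Implicit Arguments.
Unset Strict Implicit.
Unset Printing Implicit Defensive.
Import Order.TTheory GRing.Theory Num.Theory.
Import numFieldNormedType.Exports.
Local Open Scope classical_set_scope.
Local Open Scope ring_scope.

Definition partial (R : realType) (k N : nat) (f : 'rV[R]_k -> 'rV[R]_N)
    (s : seq 'I_k) : 'rV[R]_k -> 'rV[R]_N :=
  foldr (fun i g x => 'D_(delta_mx 0 i) g x) f s.

(* C^oo: differentiability at every order makes every iterated partial
   derivative exist and be continuous. *)
Definition smooth (R : realType) (k N : nat) (f : 'rV[R]_k -> 'rV[R]_N) : Prop :=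
  forall (s : seq 'I_k) (x : 'rV[R]_k), differentiable (partial f s) x.

Definition immersion (R : realType) (k N : nat)
    (f : 'rV[R]_k -> 'rV[R]_N) : Prop :=
  forall x : 'rV[R]_k, injective ('d f x).

Definition homeo_onto_image (R : realType) (k N : nat)
    (f : 'rV[R]_k -> 'rV[R]_N) : Prop :=
  continuous f /\
  exists2 g : 'rV[R]_N -> 'rV[R]_k,
    cancel f g & {within range f, continuous g}.

Definition smooth_embedding (R : realType) (k N : nat)
    (f : 'rV[R]_k -> 'rV[R]_N) : Prop :=
  [/\ smooth f, immersion f & homeo_onto_image f].

(* An affine hyperplane only when a != 0. *)
Definition hyperplane (R : realType) (N : nat) (a : 'cV[R]_N) (c : R) :
    set 'rV[R]_N :=
  [set y | (y *m a) 0 0 = c].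

Definition supporting (R : realType) (N : nat) (a : 'cV[R]_N) (c : R)
    (S : set 'rV[R]_N) : Prop :=
  S `<=` [set y | c <= (y *m a) 0 0] \/ S `<=` [set y | (y *m a) 0 0 <= c].

Definition neighborly (R : realType) (k N r : nat)
    (f : 'rV[R]_k -> 'rV[R]_N) : Prop :=
  forall p : 'I_r -> 'rV[R]_k, injective p ->
  exists (a : 'cV[R]_N) (c : R),
    [/\ a != 0, supporting a c (range f)
      & range f `&` hyperplane a c = f @` range p].

(* R^k is not compact: the sets [set g | C2_close eps f g], for eps continuous
   and positive, are the basic neighbourhoods of f in the strong (Whitney)
   C^2 topology. *)
Definition C2_close (R : realType) (k N : nat) (eps : 'rV[R]_k -> R)
    (f g : 'rV[R]_k -> 'rV[R]_N) : Prop :=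
  forall s : seq 'I_k, (size s <= 2)%N ->
  forall x : 'rV[R]_k, `|partial g s x - partial f s x| < eps x.

Definition stably_neighborly (R : realType) (k N r : nat)
    (f : 'rV[R]_k -> 'rV[R]_N) : Prop :=
  [/\ smooth_embedding f, neighborly r f &
    exists eps : 'rV[R]_k -> R,
      [/\ continuous eps, forall x, 0 < eps x &
        forall g : 'rV[R]_k -> 'rV[R]_N,
          smooth_embedding g -> C2_close eps f g -> neighborly r g]].

Definition has_stably_neighborly (R : realType) (k r N : nat) : Prop :=
  exists f : 'rV[R]_k -> 'rV[R]_N, stably_neighborly r f.

(* Delta(R^k, r), with the convention +oo if no dimension works. *)
Definition Delta (R : realType) (k r : nat) : \bar R :=
  if pselect (exists N, `[< has_stably_neighborly R k r N >]) is left ex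
  then (ex_minn ex)%:R%:E else +oo%E.

(* Since r < 2 ^ r, all the nonzero binary digits of r have index i < r. *)
Definition binary_ones (r : nat) : nat :=
  (\sum_(i < r) odd (r %/ 2 ^ i))%N.

(* Main.v *)
(* Let f : R^k -> R^N be stably r-neighborly. A neighborly embedding separates:
   a supporting hyperplane touching f at r points kills the first-order jets of f
   there and is nonzero at any other value f(q). Stability gives more: the jets
   (1, f(p_i)), (0, d_j f(p_i)) at r distinct points are linearly independent.
   Indeed a relation among them is the limit, as t -> 0+, of combinations
   sum A_i f(p_i + t u_i) - B_i f(p_i - t u_i) with B_i >= 0 not all zero and
   sum (A_i - B_i) = 0; a small perturbation f + phi w turns such a combination
   into an exact relation for an embedding still close to f, and a hyperplane
   supporting it exactly at the points p_i + t u_i forbids such a relation.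
   Altogether r first-order jets and one extra value are always independent.

   On the other hand, if n is at most the sum of (k+1) 2^a + (k-1)(2^a - 1) over
   the binary digits a of r, then for any k+1 continuous maps g_i : R^k -> R^n
   some r points x and a further point q make the vectors g_i(x) and g_0(q)
   dependent. The r points are grouped in clusters of 2^a points, each obtained
   by a times splitting a point in an antipodal pair. Coefficients and splitting
   directions form a space X with a free sign change, and the value of the
   combination is an odd map on X, invariant under the swaps of the splittings.
   It vanishes somewhere by a Borsuk-Ulam argument, done with explicit chains
   over F_2; this is where k being a power of 2 enters, through the parity of a
   binomial coefficient. Taking for g_i the jets of f, one gets
   N >= (k+1) r + (k-1)(r - d(r)). *)
Require Import Defs.
From mathcomp Require Import all_boot all_order all_algebra.
From mathcomp Require Import all_classical all_reals all_analysis.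
From mathcomp Require Import zify lra ring.
Set Implicit Arguments.
Unset Strict Implicit.
Unset Printing Implicit Defensive.
Import Order.TTheory GRing.Theory Num.Theory.
Import numFieldNormedType.Exports.
Local Open Scope ring_scope.

(** * Cells and towers over F_2 *)

(** Oddness alone would not give the bound: the vector of all coefficients is an odd map on X
    without zeros, into a space of dimension (k+1) r + 1. That map is not invariant under the swaps,
    and the gain (k-1)(r - d(r)) comes from this invariance. Hence chains are taken modulo the
    swaps: their identities are only tested against invariant cochains. The certificate is an
    inhomogeneous chain H with (bd + 1 + tau) H = T + B. Its parts h_i of degree i behave like the
    hemispheres of a sphere, bd h_(i+1) = h_i + tau h_i, up to the empty cells T and the top chain
    B. An odd invariant map without zeros into too small a space yields a cochain whose value is 0
    on the left side and 1 on the right. For stability the obstacle is that R^k is not compact, and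
    that a small perturbation must remain an embedding. The perturbations used are phi w with phi a
    bump composed with f, so that phi varies at most by a constant times the variation of f. *)

(* The configuration spaces: [Line i] carries a coefficient of g_i at the current
   base point; [Join o] adds two combinations, the second one based at a point
   translated by o; [Sq s] splits the base point in an antipodal pair, in a
   direction on the sphere S^(k-1), each half carrying a copy of [s]. *)
Inductive shape :=
| Nil
| Line of nat
| Join of nat & shape & shape
| Sq of shape.

(* On [Line], [None] is the origin and [Some e] the ray of sign e. On [Sq], the
   pair (c, e) is the hemisphere of dimension c and sign e of S^(k-1). *)
Fixpoint cell (s : shape) : Type :=
  match s with
  | Nil => unit
  | Line _ => option bool
  | Join _ s1 s2 => (cell s1 * cell s2)%type
  | Sq s => ((nat * bool) * (cell s * cell s))%type
  end.

Fixpoint deg (s : shape) : cell s -> nat :=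
  match s with
  | Nil => fun _ => 0
  | Line _ => fun c => isSome c
  | Join _ s1 s2 => fun c => deg c.1 + deg c.2
  | Sq s => fun c => c.1.1 + (deg c.2.1 + deg c.2.2)
  end%N.

(* The number of nonzero coefficients. Configurations have a nonzero coefficient
   vector, so the cells with [vdeg x = 0] are empty. *)
Fixpoint vdeg (s : shape) : cell s -> nat :=
  match s with
  | Nil => fun _ => 0
  | Line _ => fun c => isSome c
  | Join _ s1 s2 => fun c => vdeg c.1 + vdeg c.2
  | Sq s => fun c => vdeg c.2.1 + vdeg c.2.2
  end%N.

(* Here and below chains are lists counted modulo 2 and cochains are maps to bool,
   the field F_2, in which addition is xor. *)
Fixpoint bd (s : shape) : cell s -> seq (cell s) :=
  match s with
  | Nil => fun _ => [::]
  | Line _ => fun c => if c is Some _ then [:: None] else [::]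
  | Join _ s1 s2 => fun c =>
      [seq (x, c.2) | x <- bd c.1] ++ [seq (c.1, y) | y <- bd c.2]
  | Sq s => fun c =>
      (if c.1.1 is l.+1 then [:: ((l, true), c.2); ((l, false), c.2)]
       else [::])
      ++ [seq (c.1, (x, c.2.2)) | x <- bd c.2.1]
      ++ [seq (c.1, (c.2.1, y)) | y <- bd c.2.2]
  end.

(* The sign change of all the coefficients; [gen] and [gact] below are the swaps
   of the two halves of each splitting. *)
Fixpoint tau (s : shape) : cell s -> cell s :=
  match s with
  | Nil => id
  | Line _ => omap negb
  | Join _ s1 s2 => fun c => (tau c.1, tau c.2)
  | Sq s => fun c => (c.1, (tau c.2.1, tau c.2.2))
  end.

Fixpoint gen (s : shape) : Type :=
  match s with
  | Nil | Line _ => void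
  | Join _ s1 s2 => (gen s1 + gen s2)%type
  | Sq s => option (gen s)
  end.

Fixpoint gact (s : shape) : gen s -> cell s -> cell s :=
  match s with
  | Nil | Line _ => fun _ c => c
  | Join _ s1 s2 => fun g c =>
      match g with
      | inl g1 => (gact g1 c.1, c.2)
      | inr g2 => (c.1, gact g2 c.2)
      end
  | Sq s => fun g c =>
      match g with
      | None => ((c.1.1, ~~ c.1.2), (c.2.2, c.2.1))
      | Some g1 => (c.1, (gact g1 c.2.1, c.2.2))
      end
  end.

Ltac boolsums :=
  do ?[move: (\sum_(_ <- _) _) => ?];
  repeat match goal with b : ?T |- _ => unify T bool; clear -b; move: b end;
  by do ?case.

Lemma add2b (x : bool) : x + x = 0. Proof. exact: addbb. Qed.

Lemma eqb_add0 (x y : bool) : x + y = 0 -> x = y.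
Proof. by case: x y => [] []. Qed.

Definition invariant (s : shape) (f : cell s -> bool) :=
  forall g x, f (gact g x) = f x.

Lemma tauK s : involutive (@tau s).
Proof.
elim: s => [|i|o s1 IH1 s2 IH2|s IH] //=.
- by case=> [b|] //=; rewrite negbK.
- by case=> x y /=; rewrite IH1 IH2.
- by case=> [a [x y]] /=; rewrite !IH.
Qed.

Lemma tau_gact s g (x : cell s) : tau (gact g x) = gact g (tau x).
Proof.
elim: s g x => [|i|o s1 IH1 s2 IH2|s IH] //=.
- by move=> [g|g] [x y] /=; rewrite ?IH1 ?IH2.
- by move=> [g|] [a [x y]] /=; rewrite ?IH.
Qed.

Lemma deg_tau s (x : cell s) : deg (tau x) = deg x.
Proof.
elim: s x => [|i|o s1 IH1 s2 IH2|s IH] //=.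
- by case.
- by move=> [x y] /=; rewrite ?IH1 ?IH2.
- by move=> [a [x y]] /=; rewrite ?IH.
Qed.

Lemma vdeg_tau s (x : cell s) : vdeg (tau x) = vdeg x.
Proof.
elim: s x => [|i|o s1 IH1 s2 IH2|s IH] //=.
- by case.
- by move=> [x y] /=; rewrite ?IH1 ?IH2.
- by move=> [a [x y]] /=; rewrite ?IH.
Qed.

Lemma deg_gact s g (x : cell s) : deg (gact g x) = deg x.
Proof.
elim: s g x => [|i|o s1 IH1 s2 IH2|s IH] //=.
- by move=> [g|g] [x y] /=; rewrite ?IH1 ?IH2.
- by move=> [g|] [a [x y]] /=; rewrite ?IH // [(deg y + _)%N]addnC.
Qed.

Lemma vdeg_gact s g (x : cell s) : vdeg (gact g x) = vdeg x.
Proof.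
elim: s g x => [|i|o s1 IH1 s2 IH2|s IH] //=.
- by move=> [g|g] [x y] /=; rewrite ?IH1 ?IH2.
- by move=> [g|] [a [x y]] /=; rewrite ?IH // [(vdeg y + _)%N]addnC.
Qed.

Lemma leq_vdeg s (x : cell s) : (vdeg x <= deg x)%N.
Proof.
elim: s x => [|i|o s1 IH1 s2 IH2|s IH] //=.
- by move=> [x y] /=; apply: leq_add.
- move=> [a [x y]] /=; apply: leq_trans (leq_addl _ _); exact: leq_add.
Qed.

Lemma tau_vdeg0 s (x : cell s) : vdeg x = 0%N -> tau x = x.
Proof.
elim: s x => [|i|o s1 IH1 s2 IH2|s IH] //=.
- by case.
- by move=> [x y] /= /eqP; rewrite addn_eq0 => /andP[/eqP/IH1-> /eqP/IH2->].
- by move=> [a [x y]] /= /eqP; rewrite addn_eq0 => /andP[/eqP/IH-> /eqP/IH->].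
Qed.

Lemma bd_deg s (x : cell s) : all (fun y => (deg y).+1 == deg x) (bd x).
Proof.
elim: s x => [|i|o s1 IH1 s2 IH2|s IH] //=.
- by case.
- move=> [x y] /=; rewrite all_cat !all_map; apply/andP; split.
    by apply: sub_all (IH1 x) => z /eqP <- /=; rewrite addSn.
  by apply: sub_all (IH2 y) => z /eqP <- /=; rewrite addnS.
- move=> [[l e] [x y]] /=; rewrite !all_cat !all_map; apply/and3P; split.
  + by case: l => //= l; rewrite addSn eqxx.
  + by apply: sub_all (IH x) => z /eqP <- /=; rewrite addSn addnS.
  + by apply: sub_all (IH y) => z /eqP <- /=; rewrite !addnS.
Qed.

Lemma bd_vdeg s (x : cell s) : all (fun y => (vdeg y <= vdeg x)%N) (bd x).
Proof.
elim: s x => [|i|o s1 IH1 s2 IH2|s IH] //=.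
- by case.
- move=> [x y] /=; rewrite all_cat !all_map; apply/andP; split.
    by apply: sub_all (IH1 x) => z /= h; rewrite leq_add2r.
  by apply: sub_all (IH2 y) => z /= h; rewrite leq_add2l.
- move=> [[l e] [x y]] /=; rewrite !all_cat !all_map; apply/and3P; split.
  + by case: l => //= l; rewrite !leqnn.
  + by apply: sub_all (IH x) => z /= h; rewrite leq_add2r.
  + by apply: sub_all (IH y) => z /= h; rewrite leq_add2l.
Qed.

Lemma bd_tau s (f : cell s -> bool) x :
  \sum_(y <- bd (tau x)) f y = \sum_(y <- bd x) f (tau y).
Proof.
elim: s f x => [|i|o s1 IH1 s2 IH2|s IH] f /=.
- by move=> ?; rewrite !big_nil.
- by case=> [b|]; rewrite ?big_nil ?big_cons /= ?big_nil.
- move=> [x y] /=; rewrite !big_cat !big_map /=.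
  by rewrite (IH1 (fun z => f (z, _))) (IH2 (fun z => f (_, z))).
- move=> [[l e] [x y]] /=; rewrite !big_cat !big_map /=.
  rewrite (IH (fun z => f (_, (z, _)))) (IH (fun z => f (_, (_, z)))).
  by congr (_ + _); case: l => [|l]; rewrite ?big_cons !big_nil.
Qed.

Lemma bd_gact s (f : cell s -> bool) g x :
  \sum_(y <- bd (gact g x)) f y = \sum_(y <- bd x) f (gact g y).
Proof.
elim: s f g x => [|i|o s1 IH1 s2 IH2|s IH] f //=.
- move=> [g|g] [x y] /=; rewrite !big_cat !big_map /=.
    by rewrite (IH1 (fun z => f (z, _))).
  by rewrite (IH2 (fun z => f (_, z))).
- move=> [g|] [[l e] [x y]] /=; rewrite !big_cat !big_map /=.
    rewrite (IH (fun z => f (_, (z, _)))).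
    by congr (_ + _); case: l => [|l]; rewrite ?big_cons !big_nil.
  rewrite [X in _ + X]addrC; congr (_ + _).
  case: l => [|l]; rewrite ?big_cons !big_nil //=.
  by rewrite !addr0 addrC.
Qed.

Lemma bd_bd s (f : cell s -> bool) x :
  \sum_(y <- bd x) \sum_(z <- bd y) f z = 0.
Proof.
have prodP (T1 T2 : Type) (b1 : T1 -> seq T1) (b2 : T2 -> seq T2)
    (F : T1 -> T2 -> bool) a b :
    (forall G a, \sum_(y <- b1 a) \sum_(z <- b1 y) G z = 0 :> bool) ->
    (forall G a, \sum_(y <- b2 a) \sum_(z <- b2 y) G z = 0 :> bool) ->
    \sum_(y <- b1 a) (\sum_(z <- b1 y) F z b + \sum_(z <- b2 b) F y z) +
    \sum_(y <- b2 b) (\sum_(z <- b1 a) F z y + \sum_(z <- b2 y) F a z) = 0.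
  move=> h1 h2; rewrite !big_split /= (h1 (fun z => F z b)) h2 addr0 add0r.
  by rewrite exchange_big /= add2b.
elim: s f x => [|i|o s1 IH1 s2 IH2|s IH] f /=.
- by move=> ?; rewrite !big_nil.
- by case=> [b|]; rewrite ?big_cons ?big_nil.
- move=> [x y] /=; rewrite !big_cat !big_map /=.
  rewrite -[RHS](prodP _ _ (@bd s1) (@bd s2) (fun u v => f (u, v)) x y IH1 IH2).
  by congr (_ + _); apply: eq_bigr => z _; rewrite big_cat !big_map.
- move=> [[l e] [x y]] /=; rewrite !big_cat !big_map /=.
  under [X in _ + (X + _)]eq_bigr => z _ do rewrite !big_cat !big_map /=.
  under [X in _ + (_ + X)]eq_bigr => z _ do rewrite !big_cat !big_map /=.
  rewrite [X in _ + (X + _)]big_split [X in _ + (_ + X)]big_split /=.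
  have := prodP _ _ (@bd s) (@bd s) (fun u v => f ((l, e), (u, v))) x y IH IH.
  set A := \sum_(i <- bd x) (_ + _); set B := \sum_(i <- bd y) (_ + _).
  move=> AB; have -> : forall u v w, u + (v + A + (w + B)) = u + v + w + (A + B).
    move=> u v w; rewrite !addrA -!(addrAC _ A) -!(addrAC _ B).
    by rewrite addrAC !(addrAC _ _ A).
  rewrite AB addr0; case: l {A B AB} => [|l].
    by rewrite !big_nil !big1 ?addr0 // => *; rewrite big_nil.
  rewrite !big_cons !big_nil !big_cat !big_map /=.
  under [X in _ + X + _]eq_bigr => z _ do rewrite !big_cons big_nil addr0.
  under [X in _ + _ + X]eq_bigr => z _ do rewrite !big_cons big_nil addr0.
  rewrite !big_split /=; boolsums.
Qed.

(** The type [cell] does not know k; this bounds the hemispheres to those of S^(k-1). *)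
Fixpoint valid (k : nat) (s : shape) : cell s -> bool :=
  match s with
  | Nil | Line _ => fun _ => true
  | Join _ s1 s2 => fun c => valid k c.1 && valid k c.2
  | Sq s => fun c => (c.1.1 < k)%N && (valid k c.2.1 && valid k c.2.2)
  end.

Lemma valid_tau k s (x : cell s) : valid k (tau x) = valid k x.
Proof.
elim: s x => [|i|o s1 IH1 s2 IH2|s IH] //=.
- by move=> [x y] /=; rewrite ?IH1 ?IH2.
- by move=> [a [x y]] /=; rewrite ?IH.
Qed.

Lemma bd_valid k s (x : cell s) : valid k x -> all (valid k (s := s)) (bd x).
Proof.
elim: s x => [|i|o s1 IH1 s2 IH2|s IH] //=.
- by case.
- move=> [x y] /= /andP[hx hy]; rewrite all_cat !all_map; apply/andP; split.
    by apply: sub_all (IH1 x hx) => z /= ->.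
  by apply: sub_all (IH2 y hy) => z /= ->; rewrite hx.
- move=> [[l e] [x y]] /= /and3P[hl hx hy].
  rewrite !all_cat !all_map; apply/and3P; split.
  + by case: l hl => //= l hl; rewrite (ltnW hl) hx hy.
  + by apply: sub_all (IH x hx) => z /= ->; rewrite hl.
  + by apply: sub_all (IH y hy) => z /= ->; rewrite hl hx.
Qed.

(** The transpose of D = bd + 1 + tau, on inhomogeneous cochains. Over F_2 both bd and 1 + tau
    square to zero, and they commute. *)
Definition dmap (s : shape) (f : cell s -> bool) (x : cell s) : bool :=
  \sum_(y <- bd x) f y + f x + f (tau x).

(** * Triples: the identity D H = T + B modulo the swaps *)

Section Triples.
Variables (k : nat) (s : shape).
Implicit Types (f : cell s -> bool) (H T B : seq (cell s)).

Definition tau_null B :=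
  forall f, invariant f -> \sum_(x <- B) (f x + f (tau x)) = 0.

Definition bd_null B :=
  forall f, invariant f -> \sum_(x <- B) \sum_(y <- bd x) f y = 0.

(** In degree i this reads bd h_(i+1) + (1 + tau) h_i = T_i + B_i. *)
Definition cobounds H T B :=
  forall f, invariant f ->
    \sum_(x <- H) dmap f x = \sum_(x <- T) f x + \sum_(x <- B) f x.

Definition full (x : cell s) := (0 < vdeg x)%N && valid k x.
(** When all coefficients vanish the splitting directions survive, so empty cells exist in positive
    degrees too. Those of degree 0 act as the augmentation. *)
Definition void_ (x : cell s) := (vdeg x == 0%N) && valid k x.

Record triple H T B : Prop := Triple {
  trC : cobounds H T B;
  trH : all full H;
  trT : all void_ T;
  trV : all (@valid k s) B;
  trtau : tau_null B;
  trbd : bd_null B }.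

Lemma invariant_bd f : invariant f -> invariant (fun x => \sum_(y <- bd x) f y).
Proof.
move=> fi g x; rewrite bd_gact; apply: eq_bigr => y _; exact: fi.
Qed.

Lemma invariant_tau f : invariant f -> invariant (fun x => f (tau x)).
Proof. by move=> fi g x; rewrite tau_gact fi. Qed.

Lemma invariant_add f1 f2 : invariant f1 -> invariant f2 ->
  invariant (fun x => f1 x + f2 x).
Proof. by move=> h1 h2 g x; rewrite h1 h2. Qed.

Lemma invariant_deg (P : pred nat) f :
  invariant f -> invariant (fun x => P (deg x) && f x).
Proof. by move=> fi g x; rewrite deg_gact fi. Qed.

Lemma sum_void T (h : cell s -> bool) : all void_ T ->
  \sum_(x <- T) h (tau x) = \sum_(x <- T) h x.
Proof.
elim: T => [|x T IH] /=; rewrite ?big_nil // => /andP[/andP[/eqP v _] aT].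
by rewrite !big_cons (tau_vdeg0 v) IH.
Qed.

Lemma sum_split_tau B f : tau_null B -> invariant f ->
  \sum_(x <- B) f (tau x) = \sum_(x <- B) f x.
Proof. by move=> tB fi; apply/esym/eqb_add0; rewrite -big_split /= tB. Qed.

(** Since bd and 1 + tau square to zero, bd D = bd (1 + tau) = (1 + tau) D. Applied to H this gives
    bd (T + B) = (1 + tau)(T + B), where all terms but bd T are known to vanish. *)
Lemma triple_bd_null H T B : triple H T B -> bd_null T.
Proof.
case=> cHT aH aT _ tB bB f fi.
have g1 := invariant_bd fi.
have g2 := invariant_add fi (invariant_tau fi).
have := cHT _ g1; rewrite (bB _ fi) addr0 => <-.
have := cHT _ g2; rewrite (tB _ fi) [X in _ = X + _]big_split /= (sum_void f aT) add2b addr0.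
move=> eqH; rewrite -[RHS]eqH {eqH}; apply: eq_bigr => x _.
rewrite /dmap bd_bd add0r tauK [X in _ = _ + X]addrC -addrA add2b addr0.
by rewrite big_split /= bd_tau.
Qed.
End Triples.

(** * Products of triples, with the diagonal sign change *)

Section Tensor.
Variables (k : nat) (s1 s2 : shape).
Variables (H1 T1 B1 : seq (cell s1)) (H2 T2 B2 : seq (cell s2)).
Hypothesis (t1 : triple k H1 T1 B1) (t2 : triple k H2 T2 B2).
Variable G : cell s1 -> cell s2 -> bool.
Hypothesis (Gl : forall y, invariant (G^~ y)) (Gr : forall x, invariant (G x)).

Definition dmap2 x y :=
  \sum_(x' <- bd x) G x' y + \sum_(y' <- bd y) G x y'
  + (G x y + G (tau x) (tau y)).

(** T2 is fixed by tau and is a cycle modulo the swaps, so D acts on H1 x T2 through the first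
    factor. *)
Lemma tensor_HT : \sum_(x <- H1) \sum_(y <- T2) dmap2 x y =
  \sum_(x <- T1) \sum_(y <- T2) G x y + \sum_(x <- B1) \sum_(y <- T2) G x y.
Proof.
transitivity (\sum_(y <- T2) \sum_(x <- H1) dmap (G^~ y) x); last first.
  rewrite [X in _ = X + _]exchange_big [X in _ = _ + X]exchange_big -big_split.
  by apply: eq_bigr => y _; rewrite (trC t1).
rewrite [RHS]exchange_big; apply: eq_bigr => x _.
rewrite !big_split /= (triple_bd_null t2) // addr0 -!addrA; congr (_ + (_ + _)).
exact: (sum_void (G (tau x)) (trT t2)).
Qed.

(** B1 is a tau-invariant cycle modulo the swaps, so D acts on B1 x H2 through the second factor. *)
Lemma tensor_BH : \sum_(x <- B1) \sum_(y <- H2) dmap2 x y =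
  \sum_(x <- B1) \sum_(y <- T2) G x y + \sum_(x <- B1) \sum_(y <- B2) G x y.
Proof.
rewrite -big_split /=.
transitivity (\sum_(x <- B1) \sum_(y <- H2) dmap (G x) y); last first.
  by apply: eq_bigr => x _; rewrite (trC t2).
rewrite exchange_big [RHS]exchange_big /=; apply: eq_bigr => y _.
rewrite !big_split /= (trbd t1) // add0r -!addrA; congr (_ + (_ + _)).
exact: (sum_split_tau (trtau t1) (Gl (tau y))).
Qed.

(** Over F_2, 1 + tau1 tau2 = (1 + tau1) + (1 + tau2) + (1 + tau1)(1 + tau2). The last summand is
    the defect from D acting as a sum over the factors. *)
Lemma tensor_HH : \sum_(x <- H1) \sum_(y <- H2) dmap2 x y =
  \sum_(x <- T1) \sum_(y <- H2) G x y + \sum_(x <- B1) \sum_(y <- H2) G x y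
  + (\sum_(x <- H1) \sum_(y <- T2) G x y + \sum_(x <- H1) \sum_(y <- B2) G x y)
  + \sum_(x <- H1) \sum_(y <- H2)
      (G x y + G (tau x) y + (G x (tau y) + G (tau x) (tau y))).
Proof.
have -> : \sum_(x <- T1) \sum_(y <- H2) G x y
    + \sum_(x <- B1) \sum_(y <- H2) G x y =
    \sum_(x <- H1) \sum_(y <- H2) dmap (G^~ y) x.
  rewrite [X in X + _]exchange_big [X in _ + X]exchange_big [RHS]exchange_big.
  by rewrite -big_split; apply: eq_bigr => y _; rewrite (trC t1).
have -> : \sum_(x <- H1) \sum_(y <- T2) G x y
    + \sum_(x <- H1) \sum_(y <- B2) G x y =
    \sum_(x <- H1) \sum_(y <- H2) dmap (G x) y.
  by rewrite -big_split; apply: eq_bigr => x _; rewrite (trC t2).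
rewrite -!big_split /=; apply: eq_bigr => x _.
rewrite -!big_split /=; apply: eq_bigr => y _.
rewrite /dmap2 /dmap.
move: (\sum_(_ <- bd x) _) (\sum_(_ <- bd y) _) (G x y) (G (tau x) y)
  (G x (tau y)) (G (tau x) (tau y)).
by do 6!case.
Qed.

Lemma tensor_BB_tau :
  \sum_(x <- B1) \sum_(y <- B2) (G x y + G (tau x) (tau y)) = 0.
Proof.
under eq_bigr do rewrite big_split /=; rewrite big_split /=.
rewrite [X in _ + X](_ : _ = \sum_(x <- B1) \sum_(y <- B2) G x y) ?add2b //.
transitivity (\sum_(x <- B1) \sum_(y <- B2) G (tau x) y).
  by apply: eq_bigr => x _; apply: (sum_split_tau (trtau t2) (Gr (tau x))).
rewrite exchange_big [RHS]exchange_big /=; apply: eq_bigr => y _.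
exact: (sum_split_tau (trtau t1) (Gl y)).
Qed.

Lemma tensor_BB_bd : \sum_(x <- B1) \sum_(y <- B2)
  (\sum_(x' <- bd x) G x' y + \sum_(y' <- bd y) G x y') = 0.
Proof.
under eq_bigr do rewrite big_split /=.
rewrite big_split /= exchange_big /=.
rewrite big1 => [|y _]; last by rewrite (trbd t1).
by rewrite big1 ?addr0 // => x _; rewrite (trbd t2).
Qed.

Lemma tensor_BB : \sum_(x <- B1) \sum_(y <- B2) dmap2 x y = 0.
Proof.
under eq_bigr do rewrite big_split /=.
by rewrite big_split tensor_BB_bd tensor_BB_tau /= addr0.
Qed.
End Tensor.

(* A chain-level certificate that no odd invariant map to R^m without zeros exists
   for m < M: the number of empty cells of degree 0 is odd on one side of [trC]. *)
Definition tower (k : nat) (s : shape) (M : nat) : Prop :=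
  exists H T B : seq (cell s),
    [/\ triple k H T B, all (fun x => deg x == M) B
      & \sum_(x <- T) (deg x == 0%N) = 1 :> bool].

Lemma tower_Nil k : tower k Nil 0.
Proof.
exists [::], [:: tt], [:: tt]; split => //; last by rewrite big_seq1.
split => // f fi; rewrite ?big_seq1 ?big_nil //=; first by rewrite add2b.
by rewrite add2b.
Qed.

Lemma tower_Line k i : tower k (Line i) 1.
Proof.
exists [:: Some true], [:: None], [:: Some true; Some false]; split => //.
  split=> // f fi; rewrite ?big_cons ?big_nil /= ?big_nil ?big_cons ?big_nil //.
  - by rewrite /dmap /= big_seq1 !addr0 addrA.
  - by case: (f _) => //; case: (f _).
  - by case: (f _).
by rewrite big_seq1.
Qed.

(** Take H = H1 x T2 + B1 x H2: its image is T1 x T2 + B1 x B2, since B1 x T2 occurs twice. *)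
Lemma tower_Join k o s1 s2 M1 M2 :
  tower k s1 M1 -> tower k s2 M2 -> tower k (Join o s1 s2) (M1 + M2)%N.
Proof.
move=> [H1 [T1 [B1 [t1 d1 n1]]]] [H2 [T2 [B2 [t2 d2 n2]]]].
pose P := fun (X : seq (cell s1)) (Y : seq (cell s2)) =>
  [seq ((x, y) : cell (Join o s1 s2)) | x <- X, y <- Y].
have allP (p : pred _) X Y (p1 : pred _) (p2 : pred _) :
    (forall x y, p1 x -> p2 y -> p (x, y)) -> all p1 X -> all p2 Y ->
    all p (P X Y).
  move=> h; elim: X => //= x X IH /andP[hx hX] hY; rewrite all_cat IH // andbT.
  by elim: Y hY {IH} => //= y Y IH /andP[hy hY]; rewrite h // IH.
have dE f x y : dmap (f : cell (Join o s1 s2) -> bool) (x, y) =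
    dmap2 (fun x y => f (x, y)) x y.
  by rewrite /dmap /dmap2 /= big_cat !big_map /= !addrA.
have Gl (f : cell (Join o s1 s2) -> bool) :
    invariant f -> forall y, invariant (fun x => f (x, y)).
  by move=> fi y g x; apply: (fi (inl g) (x, y)).
have Gr (f : cell (Join o s1 s2) -> bool) :
    invariant f -> forall x, invariant (fun y => f (x, y)).
  by move=> fi x g y; apply: (fi (inr g) (x, y)).
exists (P H1 T2 ++ P B1 H2), (P T1 T2), (P B1 B2); split.
- split.
  + move=> f fi; rewrite big_cat !big_allpairs_dep /=.
    under [X in X + _]eq_bigr do under eq_bigr do rewrite dE.
    under [X in _ + X]eq_bigr do under eq_bigr do rewrite dE.
    rewrite (tensor_HT t1 t2) /=; [|exact: Gl|exact: Gr].
    rewrite (tensor_BH t1 t2) /=; [|exact: Gl|exact: Gr].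
    by rewrite -addrA; congr (_ + _); rewrite addrA add2b add0r.
  + rewrite all_cat; apply/andP; split.
      apply: allP (trH t1) (trT t2) => x y /= /andP[h1 h2] /andP[h3 h4].
      by rewrite /full /= h2 h4 (leq_trans h1 (leq_addr _ _)).
    apply: allP (trV t1) (trH t2) => x y /= h2 /andP[h3 h4].
    by rewrite /full /= h2 h4 (leq_trans h3 (leq_addl _ _)).
  + apply: allP (trT t1) (trT t2) => x y /= /andP[h1 h2] /andP[h3 h4].
    by rewrite /void_ /= h2 h4 (eqP h1) (eqP h3).
  + by apply: allP (trV t1) (trV t2) => x y /= -> ->.
  + move=> f fi.
    by rewrite big_allpairs_dep /= (tensor_BB_tau t1 t2 (Gl f fi) (Gr f fi)).
  + move=> f fi.
    rewrite big_allpairs_dep /= -[RHS](tensor_BB_bd t1 t2 (Gl f fi) (Gr f fi)).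
    apply: eq_bigr => x _; apply: eq_bigr => y _; rewrite big_cat !big_map //.
- by apply: allP d1 d2 => x y /= /eqP-> /eqP->.
- rewrite big_allpairs_dep /= -[RHS]mulr1 -{1}n1 -{1}n2 big_distrl /=.
  apply: eq_bigr => x _; rewrite big_distrr /=; apply: eq_bigr => y _.
  by rewrite addn_eq0.
Qed.

Lemma eq_sum_all (T : Type) (p : pred T) (X : seq T) (f g : T -> bool) :
  all p X -> (forall x, p x -> f x = g x) ->
  \sum_(x <- X) f x = \sum_(x <- X) g x.
Proof.
move=> + h; elim: X => [|x X IH] /=; rewrite ?big_nil // => /andP[px pX].
by rewrite !big_cons h // IH.
Qed.

Lemma sum_bd_deg s (P : pred nat) (f : cell s -> bool) x :
  \sum_(y <- bd x) (P (deg y) && f y) = P (deg x).-1 && \sum_(y <- bd x) f y.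
Proof.
rewrite (eq_sum_all (g := fun y => P (deg x).-1 && f y) (bd_deg x)).
  by case: (P _) => //; rewrite big1.
by move=> y /eqP <-.
Qed.

Lemma sum_filter (T : Type) (p : pred T) (X : seq T) (f : T -> bool) :
  \sum_(x <- [seq x <- X | p x]) f x = \sum_(x <- X) (p x && f x).
Proof.
by rewrite big_filter big_mkcond; apply: eq_bigr => x _; case: (p x).
Qed.

(* Cutting a triple at degree i gives a triple with top chain [Beq i]; the chains of
   [Sq s] are products of these for all i <= M. *)
Section Truncation.
Variables (k : nat) (s : shape) (M : nat).
Variables H T B : seq (cell s).
Hypotheses (tr : triple k H T B) (dB : all (fun x => deg x == M) B).

Definition Hle i := [seq x <- H | (deg x <= i)%N].
Definition Tlt i := [seq x <- T | (deg x < i)%N].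
Definition Heq i := [seq x <- H | deg x == i].
Definition Beq i := Heq i ++ map (@tau s) (Heq i).

Lemma sum_Beq i (f : cell s -> bool) :
  \sum_(x <- Beq i) f x = \sum_(x <- H) ((deg x == i) && (f x + f (tau x))).
Proof.
by rewrite /Beq big_cat big_map /= -big_split sum_filter.
Qed.

(** In degrees below i the identity involves only kept parts of H; in degree i only (1 + tau) h_i is
    left, because h_(i+1) is cut. This top chain is a cycle: bd (1 + tau) h_i = (1 + tau)(T_(i-1) +
    (1 + tau) h_(i-1)) = 0. Since i <= M, the chain B does not interfere. *)
Lemma truncate i : (i <= M)%N -> triple k (Hle i) (Tlt i) (Beq i).
Proof.
move=> iM; split.
- move=> f fi.
  have gi : invariant (fun x => (deg x < i)%N && f x).
    exact: (invariant_deg (fun n => n < i)%N).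
  have := trC tr gi.
  rewrite [X in _ = _ + X](eq_sum_all (g := fun=> 0) dB); last first.
    by move=> x /eqP ->; rewrite ltnNge iM.
  rewrite [X in _ = _ + X]big1 // addr0.
  rewrite (_ : \sum_(x <- T) _ = \sum_(x <- Tlt i) f x) => [<-|]; last first.
    by rewrite sum_filter.
  rewrite sum_filter sum_Beq -big_split /=.
  apply: eq_sum_all (trH tr) _ => x /andP[v _].
  rewrite /dmap (sum_bd_deg (fun n => (n < i)%N)) deg_tau.
  have dx := leq_trans v (leq_vdeg x).
  have -> : ((deg x).-1 < i)%N = (deg x <= i)%N by rewrite -{2}(prednK dx).
  by case: ltngtP => //= _; rewrite ?addr0 ?addrA.
- rewrite /Hle all_filter.
  by apply: sub_all (trH tr) => x fx; apply/implyP.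
- rewrite /Tlt all_filter.
  by apply: sub_all (trT tr) => x fx; apply/implyP.
- have v : all (@valid k s) (Heq i).
    rewrite /Heq all_filter; apply: sub_all (trH tr) => x /andP[_ fx].
    exact/implyP.
  rewrite all_cat v all_map; apply: sub_all v => x /=.
  by rewrite valid_tau.
- move=> f fi; rewrite sum_Beq big1 // => x _.
  by rewrite tauK [f (tau x) + _]addrC add2b andbF.
- move=> f fi; rewrite sum_Beq.
  pose h x := f x + f (tau x).
  have hi := invariant_add fi (invariant_tau fi).
  have gi : invariant (fun x => ((deg x).+1 == i) && h x).
    exact: (invariant_deg (fun n => n.+1 == i)).
  have := trC tr gi.
  rewrite [X in _ = X + _](eq_sum_all (g := fun=> 0) (trT tr)); last first.
    by move=> x /andP[/eqP /tau_vdeg0 tx _]; rewrite /h tx add2b andbF.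
  rewrite [X in _ = _ + X](eq_sum_all (g := fun=> 0) dB); last first.
    by move=> x /eqP ->; rewrite gtn_eqF // ltnS.
  rewrite [X in _ = X + _]big1 // [X in _ = _ + X]big1 // addr0 => eqH.
  rewrite -[RHS]eqH.
  apply: eq_sum_all (trH tr) _ => x /andP[v _].
  rewrite /dmap (sum_bd_deg (fun n => n.+1 == i)) deg_tau.
  rewrite (prednK (leq_trans v (leq_vdeg x))) /h tauK.
  rewrite [f (tau x) + f x]addrC -addrA add2b addr0.
  by rewrite big_split /= bd_tau.
Qed.

Lemma sum_nu_Hle i (f : cell s -> bool) :
  \sum_(x <- Hle i) (f x + f (tau x)) =
  \sum_(0 <= j < i.+1) \sum_(x <- Beq j) f x.
Proof.
rewrite sum_filter; under [RHS]eq_bigr do rewrite sum_Beq.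
rewrite exchange_big /=; apply: eq_bigr => x _.
move: (_ + _) => b; case: b => /=; last first.
  by rewrite andbF big1 // => j _; rewrite andbF.
under eq_bigr do rewrite andbT.
rewrite andbT; elim: i => [|i IH]; rewrite big_nat_recr //=.
  by rewrite big_geq // leqn0.
by rewrite -IH leq_eqVlt ltnS; case: eqP => [->|_]; rewrite ?ltnn ?addr0.
Qed.

Lemma Tlt_deg0 i : (0 < i)%N ->
  \sum_(x <- Tlt i) (deg x == 0%N) = \sum_(x <- T) (deg x == 0%N) :> bool.
Proof.
move=> i0; rewrite sum_filter; apply: eq_bigr => x _.
by case: eqP => [->|]; rewrite ?i0 ?andbF.
Qed.

Lemma Tlt0 : Tlt 0 = [::].
Proof. by rewrite /Tlt; elim: T => //= x X ->. Qed.
End Truncation.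

Lemma sum_triangle (n : nat) (K : nat -> nat -> bool) :
  \sum_(0 <= i < n) \sum_(0 <= j < n) K i j =
  \sum_(0 <= i < n) K i i +
  \sum_(0 <= i < n) \sum_(0 <= j < i) (K j i + K i j).
Proof.
elim: n => [|n IH]; first by rewrite !big_geq // addr0.
rewrite !big_nat_recr //=.
under eq_bigr do rewrite big_nat_recr //=.
rewrite big_split /= IH [\sum_(0 <= j < n) (_ + _)]big_split /=.
move: (K n n) => ?; boolsums.
Qed.

(** * The tower of a splitting *)

Section SqTower.
Variables (k : nat) (s : shape) (M : nat).
Variables H T B : seq (cell s).
Hypotheses (tr : triple k H T B) (dB : all (fun x => deg x == M) B).

(** Modulo the swap a cell over a negative hemisphere equals one over the positive hemisphere with
    the two factors exchanged, so positive ones suffice. *)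
Let cel c (X Y : seq (cell s)) : seq (cell (Sq s)) :=
  [seq (((c, true), (x, y)) : cell (Sq s)) | x <- X, y <- Y].
Let Bq := Beq H.
Let F (f : cell (Sq s) -> bool) c (x y : cell s) := f ((c, true), (x, y)).
Let Q (f : cell (Sq s) -> bool) c j := \sum_(x <- Bq j) \sum_(y <- Bq j) F f c x y.

Let Fl (f : cell (Sq s) -> bool) c : invariant f -> forall y, invariant ((F f c)^~ y).
Proof. by move=> fi y g x; apply: (fi (Some g) ((c, true), (x, y))). Qed.

Let Ff (f : cell (Sq s) -> bool) c (x y : cell s) : invariant f -> f ((c, false), (x, y)) = F f c y x.
Proof. by move=> fi; rewrite -[LHS](fi None). Qed.

(** The generators act inside the first half only; on the second half one conjugates by the outer
    swap. *)
Let Fr (f : cell (Sq s) -> bool) c : invariant f -> forall x, invariant (F f c x).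
Proof.
move=> fi x g y; rewrite -(Ff c (gact g y) x fi) -(Ff c y x fi).
exact: (fi (Some g) (((c, false), (y, x)) : cell (Sq s))). Qed.

(** The boundary of the hemisphere: e_(c-1) and its antipode, which the swap turns into a
    transposition of the factors. *)
Let sym (f : cell (Sq s) -> bool) c (x y : cell s) :=
  if c is c'.+1 then F f c' x y + F f c' y x else 0.

Let dmapE (f : cell (Sq s) -> bool) c (x y : cell s) : invariant f ->
  dmap f (((c, true), (x, y)) : cell (Sq s)) = sym f c x y + dmap2 (F f c) x y.
Proof.
move=> fi; rewrite /dmap /dmap2 /= !big_cat !big_map /= -!addrA.
congr (_ + _); case: c => [|c]; rewrite ?big_cons big_nil //.
by rewrite (Ff c x y fi) addr0.
Qed.

Let sum_cel c X Y (f : cell (Sq s) -> bool) :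
  \sum_(z <- cel c X Y) f z = \sum_(x <- X) \sum_(y <- Y) F f c x y.
Proof. by rewrite /cel big_allpairs_dep. Qed.

Let sum_dmap c X Y (f : cell (Sq s) -> bool) : invariant f ->
  \sum_(z <- cel c X Y) dmap f z =
  \sum_(x <- X) \sum_(y <- Y) sym f c x y +
  \sum_(x <- X) \sum_(y <- Y) dmap2 (F f c) x y.
Proof.
move=> fi; rewrite sum_cel -big_split /=; apply: eq_bigr => x _.
by rewrite -big_split /=; apply: eq_bigr => y _; rewrite /F dmapE.
Qed.

Let sum_sym c (X Y : seq (cell s)) (f : cell (Sq s) -> bool) :
  \sum_(x <- X) \sum_(y <- Y) sym f c.+1 x y =
  \sum_(x <- X) \sum_(y <- Y) F f c x y + \sum_(x <- Y) \sum_(y <- X) F f c x y.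
Proof.
rewrite [X in _ + X]exchange_big -big_split /=; apply: eq_bigr => x _.
by rewrite -big_split.
Qed.

Let sum_sym0 X Y f : \sum_(x <- X) \sum_(y <- Y) sym f 0%N x y = 0.
Proof. by rewrite big1 // => x _; rewrite big1. Qed.

Let all_cel (p : pred (cell (Sq s))) (p1 p2 : pred (cell s)) c X Y :
  (forall x y, p1 x -> p2 y -> p ((c, true), (x, y))) ->
  all p1 X -> all p2 Y -> all p (cel c X Y).
Proof.
move=> h; elim: X => //= x X IH /andP[hx hX] hY; rewrite all_cat IH // andbT.
by elim: Y hY {IH} => //= y Y IH /andP[hy hY]; rewrite h // IH.
Qed.

Let fullBq i : all (full k (s := s)) (Bq i).
Proof.
have v : all (full k (s := s)) (Heq H i).
  by rewrite /Heq all_filter; apply: sub_all (trH tr) => x fx; apply/implyP.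
rewrite /Bq all_cat v all_map; apply: sub_all v => x /=.
by rewrite /full /= valid_tau vdeg_tau.
Qed.

Let full_cel c X Y : (c < k)%N ->
  all (full k (s := s)) X -> all (@valid k s) Y ->
  all (full k (s := Sq s)) (cel c X Y).
Proof.
move=> ck; apply: all_cel => x y /andP[h1 h2] h3.
by rewrite /full /= ck h2 h3 (leq_trans h1 (leq_addr _ _)).
Qed.

Let full_cel' c X Y : (c < k)%N ->
  all (@valid k s) X -> all (full k (s := s)) Y ->
  all (full k (s := Sq s)) (cel c X Y).
Proof.
move=> ck; apply: all_cel => x y h3 /andP[h1 h2].
by rewrite /full /= ck h2 h3 (leq_trans h1 (leq_addl _ _)).
Qed.

(* With e_c the c-dimensional cell of the sphere, the chain [Z] is
   e_c (H T + B_i H + sum_(j < j') B_j' B_j) + e_(c-1) H H, truncated at i. *)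
Let step c i : (c < k)%N -> (i <= M)%N ->
  exists2 Z, all (full k (s := Sq s)) Z &
    forall f, invariant f ->
    \sum_(z <- Z) dmap f z =
      \sum_(z <- cel c (Tlt T i) (Tlt T i)) f z + Q f c i +
      (if c is c'.+1 then \sum_(0 <= j < i.+1) Q f c' j else 0).
Proof.
move=> ck iM; have ti := truncate tr dB iM.
set Hi := Hle H i in ti; set Ti := Tlt T i in ti *.
have vB j : all (@valid k s) (Bq j) by apply: sub_all (fullBq j) => x /andP[].
(* The boundary of e_c symmetrises these products over j < j', which then cancel the off-diagonal
   part of (1 + tau) H x (1 + tau) H. *)
pose W := flatten [seq flatten [seq cel c (Bq j') (Bq j) | j <- index_iota 0 j']
                  | j' <- index_iota 0 i.+1].
have WE f : invariant f -> \sum_(z <- W) dmap f z =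
    \sum_(0 <= j' < i.+1) \sum_(0 <= j < j')
      \sum_(x <- Bq j') \sum_(y <- Bq j) sym f c x y.
  move=> fi; rewrite big_flatten big_map big_seq [RHS]big_seq /=.
  apply: eq_bigr => j'; rewrite mem_index_iota /= ltnS => j'i.
  rewrite big_flatten big_map big_seq [RHS]big_seq /=; apply: eq_bigr => j.
  rewrite mem_index_iota /= => jj'; rewrite sum_dmap //.
  have j'M := leq_trans j'i iM.
  rewrite (tensor_BB (truncate tr dB j'M)
    (truncate tr dB (leq_trans (ltnW jj') j'M)) (Fl c fi) (Fr c fi)).
  by rewrite addr0.
have fW : all (full k (s := Sq s)) W.
  rewrite /W; elim: (index_iota 0 i.+1) => //= j' l IH; rewrite all_cat IH andbT.
  elim: (index_iota 0 j') => //= j l' IH'; rewrite all_cat IH' andbT.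
  exact: full_cel (fullBq j') (vB j).
have vH : all (@valid k s) Hi by apply: sub_all (trH ti) => x /andP[].
have vT : all (@valid k s) Ti by apply: sub_all (trT ti) => x /andP[].
exists (cel c Hi Ti ++ cel c (Bq i) Hi ++ W ++
  (if c is c'.+1 then cel c' Hi Hi else [::])).
  rewrite !all_cat fW full_cel //; last exact: trH ti.
  rewrite full_cel' //=; last exact: trH ti.
  by case: c ck {W WE fW} => // c ck; rewrite full_cel ?(ltnW ck) //; apply: trH ti.
move=> f fi; rewrite !big_cat /= WE // !sum_dmap // sum_cel.
rewrite (tensor_HT ti ti (Fl c fi) (Fr c fi)).
rewrite (tensor_BH ti ti (Fl c fi) (Fr c fi)) -/(Q f c i).
case: c ck {W WE fW} => [|c] ck.
  rewrite big_nil !sum_sym0.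
  rewrite [\sum_(0 <= j' < i.+1) _]big1; last first.
    by move=> j' _; rewrite big1 // => j _; rewrite sum_sym0.
  rewrite /Q /Bq; boolsums.
rewrite !sum_sym.
rewrite (_ : \sum_(0 <= j' < i.+1) _ = \sum_(0 <= j' < i.+1) \sum_(0 <= j < j')
   (\sum_(x <- Bq j) \sum_(y <- Bq j') F f c x y +
    \sum_(x <- Bq j') \sum_(y <- Bq j) F f c x y)); last first.
  by apply: eq_bigr => j' _; apply: eq_bigr => j _; rewrite sum_sym addrC.
rewrite sum_dmap //.
rewrite (tensor_HH ti ti (Fl c fi) (Fr c fi)).
have -> : \sum_(x <- Hi) \sum_(y <- Hi) sym f c x y = 0.
  by case: c {ck} => [|c]; rewrite ?sum_sym0 // sum_sym add2b.
(* The truncated (1 + tau) H is B_0 + ... + B_i, so the defect in [tensor_HH] is the full double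
   sum; its diagonal is what remains in the end. *)
have -> : \sum_(x <- Hi) \sum_(y <- Hi)
    (F f c x y + F f c (tau x) y + (F f c x (tau y) + F f c (tau x) (tau y))) =
   \sum_(0 <= j' < i.+1) \sum_(0 <= j < i.+1)
     \sum_(x <- Bq j') \sum_(y <- Bq j) F f c x y.
  transitivity (\sum_(0 <= j < i.+1) \sum_(y <- Bq j)
     \sum_(0 <= j' < i.+1) \sum_(x <- Bq j') F f c x y); last first.
    rewrite [RHS]exchange_big /=; apply: eq_bigr => j _.
    rewrite [LHS]exchange_big /=; apply: eq_bigr => j' _.
    by rewrite exchange_big.
  rewrite -(sum_nu_Hle H i (fun y => \sum_(0 <= j' < i.+1) \sum_(x <- Bq j') F f c x y)).
  rewrite exchange_big /=; apply: eq_bigr => y _.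
  by rewrite -!(sum_nu_Hle H i (fun x => F f c x _)) -big_split.
rewrite (sum_triangle i.+1 (fun j' j => \sum_(x <- Bq j') \sum_(y <- Bq j) F f c x y)).
rewrite big_nil /Q /Bq /=.
have cancel a b u v w p q d g : a + b + (v + w) + (p + q + (w + u) +
    (0 + g + (0 + (b + p + (a + q) + (d + g))))) = v + u + d :> bool.
  by move: a b u v w p q d g => [] [] [] [] [] [] [] [] [].
exact: cancel.
Qed.

(** Each step down in c takes partial sums over i, starting from the indicator of 0 < i; the
    iterated sums are binomial coefficients by Pascal's rule. *)
Let parity c i : bool := (0 < i)%N && odd 'C(i.-1 + c, c).

Let parity0 i : parity 0 i = (0 < i)%N.
Proof. by rewrite /parity addn0 bin0 andbT. Qed.

Let parityS c i : parity c.+1 i = \sum_(0 <= j < i.+1) parity c j.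
Proof.
rewrite big_nat_recl // /parity add0r; elim: i => [|i IH].
  by rewrite big_geq.
rewrite big_nat_recr //= -IH /= addnS binS oddD; case: i {IH} => [|i] /=.
  by rewrite bin_small // addFb.
by rewrite addSnnS.
Qed.

Let deg0_cel c i : \sum_(z <- cel c (Tlt T i) (Tlt T i)) (deg z == 0%N) =
  (c == 0%N) && (0 < i)%N && \sum_(x <- T) (deg x == 0%N) :> bool.
Proof.
rewrite sum_cel /F /=; case: (posnP i) => [->|i0].
  by rewrite Tlt0 big_nil andbF.
rewrite -[in RHS](Tlt_deg0 T i0) andbT; case: c => [|c] /=; last first.
  by rewrite big1 // => *; rewrite big1.
set a := RHS; transitivity (a * a); last by case: a.
rewrite /a big_distrl /=.
apply: eq_bigr => x _; rewrite big_distrr /=.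
by apply: eq_bigr => y _; rewrite !addn_eq0.
Qed.

Hypothesis n0 : \sum_(x <- T) (deg x == 0%N) = 1 :> bool.

(** By [step], e_c B_i B_i equals the sum of the e_(c-1) B_j B_j over j <= i up to D-images and
    empty cells. Descending to c = 0 leaves only empty cells, and those of degree 0 arise only in
    e_0 T T. *)
Let solve c i : (c < k)%N -> (i <= M)%N ->
  exists R V, [/\ all (full k (s := Sq s)) R, all (void_ k (s := Sq s)) V,
    forall f, invariant f ->
      \sum_(z <- R) dmap f z = \sum_(z <- V) f z + Q f c i
    & \sum_(z <- V) (deg z == 0%N) = parity c i].
Proof.
elim: c i => [|c IH] i ck iM; have [Z fZ eZ] := step ck iM.
- exists Z, (cel 0 (Tlt T i) (Tlt T i)); split=> //.
  + have vT := trT (truncate tr dB iM); apply: (all_cel _ vT vT) => x y.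
    rewrite /void_ /= ck => /andP[/eqP-> v1] /andP[/eqP-> v2].
    by rewrite v1 v2.
  + by move=> f fi; rewrite eZ // addr0.
  + by rewrite deg0_cel n0 parity0 /= andbT.
- have {}IH n : (n <= i.+1)%N -> exists R V,
      [/\ all (full k (s := Sq s)) R, all (void_ k (s := Sq s)) V,
      forall f, invariant f -> \sum_(z <- R) dmap f z =
        \sum_(z <- V) f z + \sum_(0 <= j < n) Q f c j
      & \sum_(z <- V) (deg z == 0%N) = \sum_(0 <= j < n) parity c j].
    elim: n => [|n IHn] ni.
      by exists [::], [::]; split=> // [f fi|]; rewrite !big_nil ?big_geq.
    have [R1 [V1 [fR1 fV1 e1 p1]]] := IHn (ltnW ni).
    have [R2 [V2 [fR2 fV2 e2 p2]]] := IH n (ltnW ck) (leq_trans (ni : (n <= i)%N) iM).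
    exists (R1 ++ R2), (V1 ++ V2); split.
    + by rewrite all_cat fR1.
    + by rewrite all_cat fV1.
    + move=> f fi; rewrite !big_cat big_nat_recr //= e1 // e2 //.
      by rewrite -!addrA; congr (_ + _); rewrite addrCA.
    + by rewrite big_cat big_nat_recr //= p1 p2.
  have [R [V [fR fV eR pV]]] := IH i.+1 (leqnn _).
  exists (Z ++ R), (cel c.+1 (Tlt T i) (Tlt T i) ++ V); split.
  + by rewrite all_cat fZ.
  + rewrite all_cat fV andbT.
    have vT := trT (truncate tr dB iM); apply: (all_cel _ vT vT) => x y.
    rewrite /void_ /= ck => /andP[/eqP-> v1] /andP[/eqP-> v2].
    by rewrite v1 v2.
  + move=> f fi; rewrite !big_cat /= eZ // eR // -!addrA; congr (_ + _).
    rewrite [RHS]addrC; congr (_ + _); rewrite addrCA.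
    by rewrite add2b addr0.
  + by rewrite big_cat deg0_cel /= pV parityS add0r.
Qed.

Lemma tower_Sq_aux : (0 < k)%N -> (0 < M)%N -> odd 'C(M.-1 + k.-1, k.-1) ->
  tower k (Sq s) (M + M + k.-1).
Proof.
move=> k0 M0 oC; have k1 : (k.-1 < k)%N by rewrite prednK.
have [R [V [fR fV eR pV]]] := solve k1 (leqnn M).
have tM := truncate tr dB (leqnn M).
exists R, V, (cel k.-1 (Bq M) (Bq M)); split.
- split=> //.
  + by move=> f fi; rewrite eR // sum_cel.
  + have v : all (full k (s := Sq s)) (cel k.-1 (Bq M) (Bq M)).
      by apply: full_cel => //; apply: trV tM.
    by apply: sub_all v => x /andP[].
  + by move=> f fi; rewrite sum_cel; apply: (tensor_BB_tau tM tM (Fl _ fi) (Fr _ fi)).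
  (* Both D and 1 + tau kill the top chain, hence so does bd, their sum. *)
  + move=> f fi; have := sum_dmap k.-1 (Bq M) (Bq M) fi.
    rewrite (tensor_BB tM tM (Fl k.-1 fi) (Fr k.-1 fi)).
    have -> : \sum_(x <- Bq M) \sum_(y <- Bq M) sym f k.-1 x y = 0.
      by case: (k.-1) => [|c]; rewrite ?sum_sym0 // sum_sym add2b.
    rewrite addr0 => eD; rewrite -[RHS]eD.
    have e : \sum_(z <- cel k.-1 (Bq M) (Bq M)) (f z + f (tau z)) = 0.
      rewrite sum_cel /F /=.
      exact: (tensor_BB_tau tM tM (Fl k.-1 fi) (Fr k.-1 fi)).
    transitivity (\sum_(z <- cel k.-1 (Bq M) (Bq M)) \sum_(y <- bd z) f y +
      \sum_(z <- cel k.-1 (Bq M) (Bq M)) (f z + f (tau z))).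
      by rewrite e addr0.
    rewrite -big_split.
    by apply: eq_bigr => z _; rewrite /dmap -addrA.
- have d : all (fun x => deg x == M) (Bq M).
    have d : all (fun x => deg x == M) (Heq H M) by exact: filter_all.
    by rewrite all_cat d all_map; apply: sub_all d => x /=; rewrite deg_tau.
  by apply: (all_cel _ d d) => x y /= /eqP-> /eqP->; rewrite addnC.
- by rewrite pV /parity M0.
Qed.
End SqTower.

Lemma tower_Sq k s M : (0 < k)%N -> (0 < M)%N ->
  odd 'C(M.-1 + k.-1, k.-1) -> tower k s M -> tower k (Sq s) (M + M + k.-1).
Proof.
by move=> k0 M0 oC [H [T [B [tr dB n0]]]]; apply: tower_Sq_aux tr dB n0 _ _ _.
Qed.

(** * Sign functions on tuples *)

Section Tuples.
Variables (R : numFieldType) (V : lmodType R).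
Implicit Types (t u : seq V) (g : seq V -> bool) (h : V -> V).

Fixpoint tbd t : seq (seq V) :=
  if t is x :: s then s :: map (cons x) (tbd s) else [::].

(* Simplices are the tuples of their vertices; [prism] is the usual homotopy
   between the maps induced by h and h'. *)
Fixpoint prism h h' t : seq (seq V) :=
  if t is x :: s then (h x :: map h' (x :: s)) :: map (cons (h x)) (prism h h' s)
  else [::].

Lemma tbd_map h t : tbd (map h t) = map (map h) (tbd t).
Proof. by elim: t => //= x t ->; rewrite -!map_comp. Qed.

Lemma prism_bd h h' g t :
  \sum_(u <- prism h h' t) \sum_(v <- tbd u) g v +
  \sum_(u <- tbd t) \sum_(v <- prism h h' u) g v = g (map h t) + g (map h' t).
Proof.
elim: t g => [|x t IH] g /=; first by rewrite !big_nil add2b.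
rewrite !(big_cons, big_map) /= ?(big_cons, big_map).
have -> : \sum_(j <- prism h h' t) \sum_(v <- tbd (h x :: j)) g v =
    \sum_(j <- prism h h' t) g j +
    \sum_(j <- prism h h' t) \sum_(v <- tbd j) g (h x :: v).
  by rewrite -big_split; apply: eq_bigr => j _; rewrite /= big_cons big_map.
have -> : \sum_(j <- tbd t) \sum_(v <- prism h h' (x :: j)) g v =
    \sum_(j <- tbd (map h' t)) g (h x :: h' x :: j) +
    \sum_(j <- tbd t) \sum_(v <- prism h h' j) g (h x :: v).
  rewrite tbd_map big_map -big_split; apply: eq_bigr => j _.
  by rewrite /= big_cons big_map.
have := IH (fun v => g (h x :: v)).
move: (\sum_(u <- prism h h' t) \sum_(v <- tbd u) g (h x :: v)) => a.
move: (\sum_(u <- tbd t) \sum_(v <- prism h h' u) g (h x :: v)) => b.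
move: (\sum_(j <- tbd (map h' t)) g _) (\sum_(i <- prism h h' t) g i) => c d.
move: (g (h' x :: _)) (g (h x :: map h t)) (g (h x :: map h' t)) => e f i.
by move: a b c d e f i => [] [] [] [] [] [] [].
Qed.

Definition lerp (l : R) (p x : V) : V := (1 - l) *: x + l *: p.

Lemma lerp0 p x : lerp 0 p x = x.
Proof. by rewrite /lerp subr0 scale1r scale0r addr0. Qed.

Lemma lerp1 p x : lerp 1 p x = p.
Proof. by rewrite /lerp subrr scale1r scale0r add0r. Qed.

(* The cone of [t] with vertex [p], cut in N thin layers. *)
Definition fill (N : nat) (p : V) t : seq (seq V) :=
  (p :: map (lerp 1 p) t) ::
  flatten [seq prism (lerp (j%:R / N%:R) p) (lerp (j.+1%:R / N%:R) p) t
          | j <- iota 0 N].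

(** The prisms telescope from the identity to the constant map p. The degenerate leading tuple
    cancels the collapsed copy of t, so [fill] is a contracting homotopy. *)
Lemma fill_bd N p g t : (0 < N)%N ->
  \sum_(u <- fill N p t) \sum_(v <- tbd u) g v +
  \sum_(u <- tbd t) \sum_(v <- fill N p u) g v = g t.
Proof.
move=> N0; rewrite big_cons.
under [X in _ + X]eq_bigr do rewrite big_cons big_flatten big_map.
rewrite big_split /= exchange_big /= big_cons big_map tbd_map big_map.
rewrite big_flatten big_map /=.
set A := \sum_(j <- tbd t) g (p :: _).
have -> a b c : a + A + b + (A + c) = a + (b + c).
  by move: A => A; case: A; case: a; case: b; case: c.
rewrite -big_split /=.
under eq_bigr do rewrite prism_bd.
pose G j := g (map (lerp (j%:R / N%:R) p) t).
have tele n : \sum_(j <- iota 0 n) (G j + G j.+1) = G 0%N + G n.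
  elim: n => [|n IH]; first by rewrite big_nil add2b.
  rewrite -[n.+1]addn1 iotaD big_cat big_seq1 /= add0n.
  by rewrite IH addn1 addrA -(addrA _ _ (G n)) add2b addr0.
rewrite tele.
rewrite /G mul0r divff ?pnatr_eq0 -?lt0n // addrCA add2b addr0.
by rewrite (eq_map (lerp0 p)) map_id.
Qed.
End Tuples.

Lemma all_flatten (T : Type) (P : pred T) (L : seq (seq T)) :
  all P (flatten L) = all (all P) L.
Proof. by elim: L => //= l L IH; rewrite all_cat IH. Qed.

(** * Simplicial realization of the cells *)

Section Realization.
Variables (R : numFieldType) (V : lmodType R) (s : shape) (pole : cell s -> V).
Variable N : nat.
Hypothesis N0 : (0 < N)%N.

(* The simplicial chain carried by a cell: the cone, towards an interior point, of
   the chains of its boundary. An empty cell of degree 0 gives the empty simplex. *)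
Fixpoint kap (n : nat) (x : cell s) : seq (seq V) :=
  if vdeg x == 0%N then (if deg x == 0%N then [:: [::]] else [::]) else
  if n is n'.+1 then
    flatten [seq flatten [seq fill N (pole x) t | t <- kap n' y] | y <- bd x]
  else [::].

Lemma kap_void n x : vdeg x = 0%N ->
  kap n x = if deg x == 0%N then [:: [::]] else [::].
Proof. by case: n => [|n] /= ->. Qed.

Lemma kap_full n x : (0 < vdeg x)%N -> kap n.+1 x =
  flatten [seq flatten [seq fill N (pole x) t | t <- kap n y] | y <- bd x].
Proof. by move=> v; rewrite /= gtn_eqF. Qed.

(** Faces of degree 0 of an empty cell come in pairs, the two ends of a hemisphere of dimension 1.
    So sending empty cells of degree 0 to the empty simplex is compatible with boundaries. *)
Lemma bd_void1 (x : cell s) : vdeg x = 0%N ->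
  \sum_(y <- bd x) (deg y == 0%N) = 0 :> bool.
Proof.
clear.
have h (a : bool) (T : Type) (L : seq T) (f f' : T -> bool) :
    (forall z, f' z = a && f z) -> \sum_(i <- L) f i = 0 ->
    \sum_(i <- L) f' i = 0.
  by move=> e; under [X in _ -> X = _]eq_bigr do rewrite e; case: a {e} => // _; rewrite big1.
elim: s x => [|i|o s1 IH1 s2 IH2|s' IH] /=.
- by move=> *; rewrite big_nil.
- by case=> // _; rewrite big_nil.
- move=> [x y] /= /eqP; rewrite addn_eq0 => /andP[/eqP vx /eqP vy].
  rewrite big_cat !big_map /=.
  rewrite (h (deg y == 0%N) _ _ _ _ _ (IH1 x vx)) => [|z]; last first.
    by rewrite addn_eq0 andbC.
  by rewrite (h (deg x == 0%N) _ _ _ _ _ (IH2 y vy)) // => z; rewrite addn_eq0.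
- move=> [[l e] [x y]] /= /eqP; rewrite addn_eq0 => /andP[/eqP vx /eqP vy].
  rewrite !big_cat !big_map /=.
  rewrite (h ((l == 0%N) && (deg y == 0%N)) _ _ _ _ _ (IH x vx)); last first.
    by move=> z; rewrite !addn_eq0 -andbA [(deg z == _) && _]andbC.
  rewrite (h ((l == 0%N) && (deg x == 0%N)) _ _ _ _ _ (IH y vy)); last first.
    by move=> z; rewrite !addn_eq0 -andbA.
  by case: l => [|l]; rewrite ?big_nil // !big_cons big_nil !addr0 add2b.
Qed.

(** A cone has its base as boundary when the base is a cycle; here the base realizes bd x, a cycle
    by induction and [bd_bd]. *)
Lemma kap_bd n x (g : seq V -> bool) : deg x = n ->
  \sum_(u <- kap n x) \sum_(v <- tbd u) g v =
  \sum_(y <- bd x) \sum_(u <- kap n.-1 y) g u.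
Proof.
elim: n x g => [|n IH] x g dx.
  have -> : bd x = [::].
    by have := bd_deg x; rewrite dx; case: (bd x).
  have vx : vdeg x = 0%N by apply/eqP; rewrite -leqn0 -dx leq_vdeg.
  by rewrite kap_void // dx eqxx big_seq1 /= !big_nil.
case: (posnP (vdeg x)) => vx.
  rewrite kap_void // dx big_nil /=; apply/esym.
  transitivity (\sum_(y <- bd x) ((deg y == 0%N) && g [::])).
    apply: eq_sum_all (bd_vdeg x) _ => y; rewrite vx leqn0 => /eqP vy.
    by rewrite kap_void //; case: (deg y == 0%N); rewrite ?big_seq1 ?big_nil.
  case: (g [::]); last by rewrite big1 // => y; rewrite andbF.
  by under eq_bigr do rewrite andbT; apply: bd_void1.
rewrite kap_full // big_flatten big_map /=.
pose G u := \sum_(v <- fill N (pole x) u) g v.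
transitivity (\sum_(y <- bd x) (\sum_(t <- kap n y) g t +
   \sum_(t <- kap n y) \sum_(u <- tbd t) G u)).
  apply: eq_bigr => y _; rewrite big_flatten big_map -big_split /=.
  apply: eq_bigr => t _; rewrite -[X in _ = X + _](fill_bd (pole x) g t N0).
  by rewrite -addrA add2b addr0.
rewrite big_split /= [X in _ + X](_ : _ = 0) ?addr0 //.
transitivity (\sum_(y <- bd x) \sum_(z <- bd y) \sum_(u <- kap n.-1 z) G u).
  by apply: eq_sum_all (bd_deg x) _ => y; rewrite dx eqSS => /eqP/IH ->.
exact: bd_bd.
Qed.

(** The degree of a cell counts vertices, one more than the dimension of its simplices. *)
Lemma kap_size n x : deg x = n -> all (fun t => size t == n) (kap n x).
Proof.
have fill_size p t : all (fun u => size u == (size t).+1) (fill N p t).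
  rewrite /fill /= size_map eqxx /= all_flatten all_map; apply/allP => j _ /=.
  elim: t {p} (lerp _ p) (lerp _ p) => //= y t IH h h'.
  rewrite size_map eqxx /= all_map; apply: sub_all (IH h h') => u /= /eqP->.
  exact: eqxx.
elim: n x => [|n IH] x dx.
  have vx : vdeg x = 0%N by apply/eqP; rewrite -leqn0 -dx leq_vdeg.
  by rewrite kap_void // dx.
case: (posnP (vdeg x)) => vx; first by rewrite kap_void // dx.
rewrite kap_full // all_flatten all_map.
apply: sub_all (bd_deg x) => y; rewrite dx eqSS /= => /eqP /IH hy.
rewrite all_flatten all_map; apply: sub_all hy => t /= /eqP <-.
exact: fill_size.
Qed.

(** The construction uses only poles, boundaries and interpolation, so every symmetry respecting
    these carries over. *)
Lemma kap_act (a : cell s -> cell s) (A : V -> V) :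
  (forall x, deg (a x) = deg x) -> (forall x, vdeg (a x) = vdeg x) ->
  (forall x, pole (a x) = A (pole x)) ->
  (forall l p x, A (lerp l p x) = lerp l (A p) (A x)) ->
  (forall (f : cell s -> bool) x,
     \sum_(y <- bd (a x)) f y = \sum_(y <- bd x) f (a y)) ->
  forall n x (g : seq V -> bool),
    \sum_(u <- kap n (a x)) g u = \sum_(u <- kap n x) g (map A u).
Proof.
move=> da va pa la ba.
have fa p t : fill N (A p) (map A t) = map (map A) (fill N p t).
  have mapl l q : map (lerp l (A p)) (map A q) = map A (map (lerp l p) q).
    by rewrite -!map_comp; apply: eq_map => z /=; rewrite la.
  rewrite /fill /= mapl; congr cons; rewrite map_flatten -map_comp; congr flatten.
  apply: eq_map => j /=; elim: t => //= y t IH.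
  by rewrite mapl -!la IH -!map_comp.
elim=> [|n IH] x g.
  case: (posnP (vdeg x)) => vx; last by rewrite /= va gtn_eqF // !big_nil.
  rewrite !kap_void ?va // da; case: eqP => _; rewrite ?big_seq1 ?big_nil //.
case: (posnP (vdeg x)) => vx.
  rewrite !kap_void ?va // da; case: eqP => _; rewrite ?big_seq1 ?big_nil //.
rewrite !kap_full ?va // !big_flatten !big_map ba; apply: eq_bigr => y _.
rewrite !big_flatten !big_map IH; apply: eq_bigr => t _.
by rewrite pa fa big_map.
Qed.
End Realization.

(** * Cup products of sign functions *)

Section SignCochains.
Variables (R : numFieldType) (V : lmodType R) (B : nat -> V -> bool).
Implicit Types (p : V) (t : seq V).

(* For sign functions B j, odd under an involution, [sprod] plus its image
   under the involution is [wprod], and [wprod] is the coboundary of [sprod]; and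
   [wprod] vanishes on simplices where some B j is constant. *)
Fixpoint wprod t : bool :=
  if t is p :: t' then
    if t' is q :: _ then (B (size t').-1 p + B (size t').-1 q) * wprod t' else 1
  else 1.

Definition sprod t : bool := if t is p :: t' then B (size t') p * wprod t else 1.

Lemma tbd_size t : all (fun u => (size u).+1 == size t) (tbd t).
Proof.
elim: t => //= p t IH; rewrite eqxx /= all_map; apply: sub_all IH => u /=.
by rewrite eqSS.
Qed.

(** On n + 1 points [wprod] is the cup product of the coboundaries of B (n-1), ..., B 0, hence a
    cocycle; the face without p stands on the right. [sprod] has B n in front, and its coboundary
    follows by the Leibniz rule. *)
Lemma wprod_bd p t : \sum_(u <- tbd t) wprod (p :: u) = (t != [::]) && wprod t.
Proof.
elim: t p => [|q t IH] p; first by rewrite big_nil.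
rewrite /= big_cons big_map /=; case: t IH => [|r t] IH.
  by rewrite /= big_nil.
have e : \sum_(j <- tbd (r :: t)) (B (size j) p + B (size j) q) * wprod (q :: j) =
    (B (size t) p + B (size t) q) * wprod (r :: t).
  rewrite -[wprod (r :: t)]/((r :: t != [::]) && wprod (r :: t)) -(IH q) big_distrr.
  apply: eq_sum_all (tbd_size _) _ => u.
  by rewrite /= eqSS => /eqP ->.
have cancel (a b c w : bool) : (c + b) * w + (c + a) * w + (a + b) * w = 0.
  by move: a b c w => [] [] [] [].
by rewrite e; apply/eqb_add0; apply: cancel.
Qed.

Lemma sprod_bd p t : \sum_(u <- tbd (p :: t)) sprod u = wprod (p :: t).
Proof.
rewrite /= big_cons big_map; case: t => [|q t]; first by rewrite /= big_nil.
have e : \sum_(j <- tbd (q :: t)) sprod (p :: j) = B (size t) p * wprod (q :: t).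
  rewrite -[wprod (q :: t)]/((q :: t != [::]) && wprod (q :: t)) -(wprod_bd p).
  rewrite big_distrr.
  by apply: eq_sum_all (tbd_size _) _ => u; rewrite /= eqSS => /eqP ->.
have distr (a b w : bool) : b * w + a * w = (a + b) * w.
  by move: a b w => [] [] [].
by rewrite e; apply: distr.
Qed.

Lemma wprod_cons p q t :
  wprod [:: p, q & t] = (B (size t) p + B (size t) q) * wprod (q :: t).
Proof. by []. Qed.

Lemma sprod_cons p t : sprod (p :: t) = B (size t) p * wprod (p :: t).
Proof. by []. Qed.

Lemma wprod_map (A : V -> V) (eps : bool) t :
  (forall j p, p \in t -> B j (A p) = B j p + eps) -> wprod (map A t) = wprod t.
Proof.
elim: t => [|p [|q t] IH] // h.
rewrite [map A _]/= !wprod_cons size_map !h ?inE ?eqxx ?orbT //.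
rewrite -[A q :: _]/(map A (q :: t)) IH => [|j u ut]; last first.
  by apply: h; rewrite inE ut orbT.
congr (_ * _); move: (B (size t) p) (B (size t) q) => [] []; by case: (eps).
Qed.

Lemma sprod_inv (A : V -> V) t :
  (forall j p, p \in t -> B j (A p) = B j p) -> sprod (map A t) = sprod t.
Proof.
case: t => // p t h; rewrite [map A _]/= !sprod_cons size_map h ?mem_head //.
rewrite -[A p :: _]/(map A (p :: t)).
by congr (_ * _); apply: (wprod_map (eps := 0)) => j u ut; rewrite h ?addr0.
Qed.

Lemma sprod_odd (A : V -> V) t : (0 < size t)%N ->
  (forall j p, p \in t -> B j (A p) = B j p + 1) ->
  sprod t + sprod (map A t) = wprod t.
Proof.
case: t => // p t _ h.
rewrite [map A _]/= !sprod_cons size_map h ?mem_head //.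
rewrite -[A p :: _]/(map A (p :: t)) (wprod_map h).
by move: (wprod _) (B _ p) => [] [].
Qed.
End SignCochains.

Local Open Scope classical_set_scope.
Local Open Scope ring_scope.

(** * Realization of cells by points *)

Section Points.
Variables (R : realType) (k : nat).

Fixpoint dim (s : shape) : nat :=
  match s with
  | Nil => 0
  | Line _ => 1
  | Join _ s1 s2 => dim s1 + dim s2
  | Sq s => k + (dim s + dim s)
  end%N.

Definition sg (e : bool) : R := if e then 1 else -1.

Fixpoint pole (s : shape) : cell s -> 'rV[R]_(dim s) :=
  match s with
  | Nil => fun _ => 0
  | Line _ => fun c => if c is Some e then const_mx (sg e) else 0
  | Join _ s1 s2 => fun c => row_mx (pole c.1) (pole c.2)
  | Sq s => fun c =>
      row_mx (\row_(j < k) (sg c.1.2 *+ (j == c.1.1 :> nat)))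
             (row_mx (pole c.2.1) (pole c.2.2))
  end.

(* Spheres are taken for the l1-norm, so that the cones of [fill] stay in them. *)
Definition hemi (c : nat * bool) (z : 'rV[R]_k) : bool :=
  [&& \sum_j `|z 0 j| == 1,
      [forall j : 'I_k, (c.1 < j)%N ==> (z 0 j == 0)]
    & [forall j : 'I_k, (j == c.1 :> nat) ==> (0 <= sg c.2 * z 0 j)]].

Fixpoint car (s : shape) : cell s -> 'rV[R]_(dim s) -> bool :=
  match s with
  | Nil => fun _ _ => true
  | Line _ => fun c p =>
      if c is Some e then 0 <= sg e * p 0 0 else p 0 0 == 0
  | Join _ s1 s2 => fun c p => car c.1 (lsubmx p) && car c.2 (rsubmx p)
  | Sq s => fun c p => [&& hemi c.1 (lsubmx p),
      car c.2.1 (lsubmx (rsubmx p)) & car c.2.2 (rsubmx (rsubmx p))]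
  end.

(** The l1-norm of the coefficients alone. *)
Fixpoint vn (s : shape) : 'rV[R]_(dim s) -> R :=
  match s with
  | Nil => fun _ => 0
  | Line _ => fun p => `|p 0 0|
  | Join _ s1 s2 => fun p => vn (lsubmx p) + vn (rsubmx p)
  | Sq s => fun p => vn (lsubmx (rsubmx p)) + vn (rsubmx (rsubmx p))
  end.

Fixpoint zok (s : shape) : 'rV[R]_(dim s) -> bool :=
  match s with
  | Nil | Line _ => fun _ => true
  | Join _ s1 s2 => fun p => zok (lsubmx p) && zok (rsubmx p)
  | Sq s => fun p => [&& \sum_j `|lsubmx p 0 j| == 1,
      zok (lsubmx (rsubmx p)) & zok (rsubmx (rsubmx p))]
  end.

Fixpoint taup (s : shape) : 'rV[R]_(dim s) -> 'rV[R]_(dim s) :=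
  match s with
  | Nil => id
  | Line _ => fun p => - p
  | Join _ s1 s2 => fun p => row_mx (taup (lsubmx p)) (taup (rsubmx p))
  | Sq s => fun p => row_mx (lsubmx p)
      (row_mx (taup (lsubmx (rsubmx p))) (taup (rsubmx (rsubmx p))))
  end.

Fixpoint gactp (s : shape) : gen s -> 'rV[R]_(dim s) -> 'rV[R]_(dim s) :=
  match s with
  | Nil | Line _ => fun _ p => p
  | Join _ s1 s2 => fun g p =>
      match g with
      | inl g1 => row_mx (gactp g1 (lsubmx p)) (rsubmx p)
      | inr g2 => row_mx (lsubmx p) (gactp g2 (rsubmx p))
      end
  | Sq s => fun g p =>
      match g with
      | None => row_mx (- lsubmx p)
                  (row_mx (rsubmx (rsubmx p)) (lsubmx (rsubmx p)))
      | Some g1 => row_mx (lsubmx p)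
          (row_mx (gactp g1 (lsubmx (rsubmx p))) (rsubmx (rsubmx p)))
      end
  end.

Lemma lsub_lerp m n1 n2 l (p x : 'M[R]_(m, n1 + n2)) :
  lsubmx (lerp l p x) = lerp l (lsubmx p) (lsubmx x).
Proof. by rewrite /lerp linearD !linearZ. Qed.

Lemma rsub_lerp m n1 n2 l (p x : 'M[R]_(m, n1 + n2)) :
  rsubmx (lerp l p x) = lerp l (rsubmx p) (rsubmx x).
Proof. by rewrite /lerp linearD !linearZ. Qed.

Lemma row_lerp m n1 n2 l (p x : 'M[R]_(m, n1)) (p' x' : 'M[R]_(m, n2)) :
  row_mx (lerp l p x) (lerp l p' x') = lerp l (row_mx p p') (row_mx x x').
Proof. by rewrite /lerp !scale_row_mx add_row_mx. Qed.

Lemma opp_lerp (V : lmodType R) l (p x : V) : - lerp l p x = lerp l (- p) (- x).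
Proof. by rewrite /lerp opprD !scalerN. Qed.

Lemma taup_lerp s l (p x : 'rV[R]_(dim s)) :
  taup (lerp l p x) = lerp l (taup p) (taup x).
Proof.
elim: s p x => [|i|o s1 IH1 s2 IH2|s IH] /= p x //.
- exact: opp_lerp.
- by rewrite lsub_lerp rsub_lerp IH1 IH2 row_lerp.
- by rewrite lsub_lerp !rsub_lerp lsub_lerp !IH !row_lerp.
Qed.

Lemma gactp_lerp s g l (p x : 'rV[R]_(dim s)) :
  gactp g (lerp l p x) = lerp l (gactp g p) (gactp g x).
Proof.
elim: s g p x => [|i|o s1 IH1 s2 IH2|s IH] //=.
- by move=> [g|g] p x; rewrite lsub_lerp rsub_lerp ?IH1 ?IH2 row_lerp.
- move=> [g|] p x; rewrite lsub_lerp !rsub_lerp lsub_lerp ?IH ?opp_lerp.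
    by rewrite !row_lerp.
  by rewrite !row_lerp.
Qed.

Lemma pole_tau s (x : cell s) : pole (tau x) = taup (pole x).
Proof.
elim: s x => [|i|o s1 IH1 s2 IH2|s IH] //=.
- case=> [[]|] /=; rewrite ?oppr0 //; apply/rowP => j; rewrite !mxE //.
  by rewrite opprK.
- by move=> [x y] /=; rewrite row_mxKl row_mxKr IH1 IH2.
- by move=> [c [x y]] /=; rewrite !(row_mxKl, row_mxKr) !IH.
Qed.

Lemma pole_gact s g (x : cell s) : pole (gact g x) = gactp g (pole x).
Proof.
elim: s g x => [|i|o s1 IH1 s2 IH2|s IH] //=.
- by move=> [g|g] [x y] /=; rewrite row_mxKl row_mxKr ?IH1 ?IH2.
- move=> [g|] [[l e] [x y]] /=; rewrite !(row_mxKl, row_mxKr) ?IH //.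
  congr row_mx; apply/rowP => j; rewrite !mxE -mulNrn.
  by case: e; rewrite /sg /= ?opprK.
Qed.

Lemma car_zok s (x : cell s) p : car x p -> zok p.
Proof.
elim: s x p => [|i|o s1 IH1 s2 IH2|s IH] //=.
- by move=> [x y] p /andP[/IH1-> /IH2->].
- by move=> [c [x y]] p /and3P[/and3P[-> _ _] /IH-> /IH->].
Qed.

Lemma sg_norm e (a : R) : 0 <= sg e * a -> `|a| = sg e * a.
Proof.
move=> h; rewrite -[RHS]ger0_norm // normrM.
by case: e {h}; rewrite /sg ?normrN normr1 mul1r.
Qed.

Lemma norm_lerp_sg e (l a : R) : 0 <= l <= 1 -> 0 <= sg e * a ->
  0 <= sg e * ((1 - l) * a + l * sg e) /\
  `|(1 - l) * a + l * sg e| = (1 - l) * `|a| + l.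
Proof.
move=> /andP[l0 l1] a0; have h : 0 <= sg e * ((1 - l) * a + l * sg e).
  have : 0 <= (1 - l) * (sg e * a) by rewrite mulr_ge0 // subr_ge0.
  by case: e a0; rewrite /sg; nra.
split=> //; rewrite (sg_norm h) (sg_norm a0); case: e {h a0}; rewrite /sg; ring.
Qed.

Lemma sum_pole c e : (c < k)%N ->
  \sum_(j < k) `|sg e *+ (j == c :> nat)| = 1.
Proof.
move=> ck; rewrite (bigD1 (Ordinal ck)) //= eqxx mulr1n big1 => [|j].
  by rewrite addr0; case: e; rewrite /sg ?normrN normr1.
by rewrite -val_eqE /= => /negPf->; rewrite mulr0n normr0.
Qed.

(** The pole has one nonzero coordinate, where z has weakly the same sign; so the l1-norm is affine
    on the segment joining them. *)
Lemma hemi_lerp c (z : 'rV[R]_k) l : (c.1 < k)%N -> 0 <= l <= 1 ->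
  hemi c z -> hemi c (lerp l (\row_(j < k) (sg c.2 *+ (j == c.1 :> nat))) z).
Proof.
case: c => c e /= ck l01 /and3P[/eqP z1 /forallP z0 /forallP zs].
have key (j : 'I_k) : (j == c :> nat) -> 0 <= sg e * z 0 j.
  by move=> jc; have := zs j; rewrite jc.
apply/and3P; split.
- apply/eqP; transitivity (\sum_(j < k)
     ((1 - l) * `|z 0 j| + l * `|sg e *+ (j == c :> nat)|)).
    apply: eq_bigr => j _; rewrite !mxE; case: eqP => [jc|_]; last first.
      rewrite mulr0n mulr0 normr0 mulr0 !addr0 normrM ger0_norm //.
      by case/andP: l01; rewrite subr_ge0.
    have [_ ->] := norm_lerp_sg l01 (key j (introT eqP jc)).
    by case: (e); rewrite /sg mulr1n ?normrN normr1 mulr1.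
  by rewrite big_split /= -!mulr_sumr z1 sum_pole //; lra.
- apply/forallP => j; apply/implyP => cj; rewrite !mxE (gtn_eqF cj).
  by have := z0 j; rewrite cj /= => /eqP ->; rewrite !mulr0 addr0.
- apply/forallP => j; apply/implyP => /= jc; rewrite !mxE jc mulr1n.
  by have [] := norm_lerp_sg l01 (key j jc).
Qed.

Lemma hemi_pole c : (c.1 < k)%N ->
  hemi c (\row_(j < k) (sg c.2 *+ (j == c.1 :> nat))).
Proof.
case: c => c e /= ck; apply/and3P; split.
- by apply/eqP; under eq_bigr do rewrite mxE; exact: sum_pole.
- by apply/forallP => j; apply/implyP => cj; rewrite mxE (gtn_eqF cj).
- apply/forallP => j; apply/implyP => /= jc; rewrite mxE jc mulr1n.
  by case: e; rewrite /sg ?mulrNN mulr1.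
Qed.

Lemma hemi_bd c e e' z : hemi (c, e') z -> hemi (c.+1, e) z.
Proof.
case/and3P=> h1 /forallP h2 _; apply/and3P; split=> //.
  apply/forallP => j; apply/implyP => cj.
  by have := h2 j; rewrite /= (ltnW cj).
apply/forallP => j; apply/implyP => /= /eqP jc.
by have := h2 j; rewrite /= jc ltnSn => /eqP ->; rewrite mulr0.
Qed.

Lemma car_lerp s (x : cell s) p l : valid k x -> 0 <= l <= 1 ->
  car x p -> car x (lerp l (pole x) p).
Proof.
move=> + l01; elim: s x p => [|i|o s1 IH1 s2 IH2|s IH] //=.
- case=> [e|] p _; rewrite !mxE => h.
    by have [] := norm_lerp_sg l01 h.
  by rewrite (eqP h) !mulr0 addr0.
- move=> [x y] p /= /andP[vx vy] /andP[/(IH1 _ _ vx) h1 /(IH2 _ _ vy) h2].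
  by rewrite lsub_lerp rsub_lerp row_mxKl row_mxKr h1.
- move=> [c [x y]] p /= /and3P[ck vx vy] /and3P[h /(IH _ _ vx) h1 /(IH _ _ vy) h2].
  rewrite lsub_lerp !rsub_lerp lsub_lerp !(row_mxKl, row_mxKr) h1 h2 !andbT.
  exact: hemi_lerp.
Qed.

Lemma car_pole s (x : cell s) : valid k x -> car x (pole x).
Proof.
elim: s x => [|i|o s1 IH1 s2 IH2|s IH] //=.
- case=> [e|] _; rewrite !mxE //.
  by case: e; rewrite /sg ?mulrNN mulr1.
- by move=> [x y] /= /andP[/IH1 h1 /IH2 h2]; rewrite row_mxKl row_mxKr h1.
- move=> [c [x y]] /= /and3P[ck /IH h1 /IH h2].
  by rewrite !(row_mxKl, row_mxKr) h1 h2 !andbT; exact: hemi_pole.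
Qed.

Lemma car_bd s (x : cell s) p : all (fun y => car y p ==> car x p) (bd x).
Proof.
elim: s x p => [|i|o s1 IH1 s2 IH2|s IH] //=.
- case=> //= e p; rewrite andbT; apply/implyP => /eqP ->.
  by rewrite mulr0.
- move=> [x y] p /=; rewrite all_cat !all_map; apply/andP; split.
    apply: sub_all (IH1 x (lsubmx p)) => z /= /implyP h.
    by apply/implyP => /andP[/h-> ->].
  apply: sub_all (IH2 y (rsubmx p)) => z /= /implyP h.
  by apply/implyP => /andP[-> /h->].
- move=> [[c e] [x y]] p /=; rewrite !all_cat !all_map; apply/and3P; split.
  + case: c => //= c; rewrite andbT; apply/andP; split; apply/implyP;
    by case/and3P=> /hemi_bd -> -> ->.
  + apply: sub_all (IH x (lsubmx (rsubmx p))) => z /= /implyP h.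
    by apply/implyP => /and3P[-> /h-> ->].
  + apply: sub_all (IH y (rsubmx (rsubmx p))) => z /= /implyP h.
    by apply/implyP => /and3P[-> -> /h->].
Qed.

Lemma vn_pole s (x : cell s) : vn (pole x) = (vdeg x)%:R.
Proof.
elim: s x => [|i|o s1 IH1 s2 IH2|s IH] //=.
- by case=> [[]|]; rewrite !mxE /sg ?normrN ?normr1 ?normr0.
- by move=> [x y] /=; rewrite row_mxKl row_mxKr IH1 IH2 natrD.
- by move=> [c [x y]] /=; rewrite !(row_mxKl, row_mxKr) !IH natrD.
Qed.

(** Inside a carrier the signs of the coefficients are fixed, so the norm is affine towards the
    pole. *)
Lemma vn_lerp s (x : cell s) p l : 0 <= l <= 1 -> car x p ->
  vn (lerp l (pole x) p) = (1 - l) * vn p + l * (vdeg x)%:R.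
Proof.
move=> l01; elim: s x p => [|i|o s1 IH1 s2 IH2|s IH] //=.
- by move=> _ p _; rewrite !mulr0 addr0.
- case=> [e|] p; rewrite !mxE => h.
    by have [_ ->] := norm_lerp_sg l01 h; rewrite mulr1.
  by rewrite (eqP h) !mulr0 addr0 normr0 mulr0 addr0.
- move=> [x y] p /= /andP[/IH1 h1 /IH2 h2].
  rewrite lsub_lerp rsub_lerp row_mxKl row_mxKr h1 h2 natrD; ring.
- move=> [c [x y]] p /= /and3P[h /IH h1 /IH h2].
  rewrite !rsub_lerp lsub_lerp !(row_mxKl, row_mxKr) h1 h2 natrD; ring.
Qed.

Definition box n (p : 'rV[R]_n) : Prop := forall j, `|p 0 j| <= 1.

Lemma box_row n1 n2 (a : 'rV[R]_n1) (b : 'rV[R]_n2) :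
  box a -> box b -> box (row_mx a b).
Proof. by move=> ha hb j; rewrite mxE; case: (fintype.split j) => i. Qed.

Lemma box_pole s (x : cell s) : box (pole x).
Proof.
elim: s x => [|i|o s1 IH1 s2 IH2|s IH] //=.
- by move=> _ [].
- by case=> [[]|] j; rewrite !mxE /sg ?normrN ?normr1 ?normr0.
- by move=> [x y] /=; exact: box_row.
- move=> [[c e] [x y]] /=; apply: box_row; last exact: box_row.
  move=> j; rewrite mxE; case: eqP => _; rewrite ?normr0 //.
  by case: e; rewrite /sg ?normrN normr1.
Qed.

Lemma box_lerp n (p x : 'rV[R]_n) l : 0 <= l <= 1 -> box p -> box x ->
  box (lerp l p x).
Proof.
move=> /andP[l0 l1] hp hx j; rewrite !mxE (le_trans (ler_normD _ _)) // !normrM.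
rewrite (ger0_norm l0) (_ : `|1 - l| = 1 - l); last first.
  by rewrite ger0_norm // subr_ge0.
by have := hp j; have := hx j; nra.
Qed.

(** An inequality rather than norm 1: a pole has norm [vdeg], a positive integer on nonempty cells,
    and interpolation preserves the lower bound. The box gives compactness. *)
Definition inX s (p : 'rV[R]_(dim s)) : Prop :=
  [/\ zok p, 1 <= vn p & box p].
End Points.

(** * Compactness of the configuration space *)

Section Compactness.
Variables (R : realType) (k : nat).

Lemma closed_preimage (T U : topologicalType) (f : T -> U) (D : set U) :
  continuous f -> closed D -> closed (f @^-1` D).
Proof. by move=> cf; apply: preimage_closed => x _; exact: cf. Qed.

Lemma continuous_vn s : continuous (@vn R k s).
Proof.
elim: s => [|i|o s1 IH1 s2 IH2|s IH] /= p.
- exact: cst_continuous.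
- apply: (@continuous_comp _ _ _ (fun p : 'rV[R]_1 => p 0 0) (fun a => `|a|)).
    exact: coord_continuous.
  exact: norm_continuous.
- apply: (@continuousD _ _ _ (@vn R k s1 \o lsubmx) (@vn R k s2 \o rsubmx)).
    by apply: continuous_comp; [exact: continuous_lsubmx|exact: IH1].
  by apply: continuous_comp; [exact: continuous_rsubmx|exact: IH2].
- apply: (@continuousD _ _ _ (@vn R k s \o (lsubmx \o rsubmx))
    (@vn R k s \o (rsubmx \o rsubmx))).
    apply: continuous_comp; last exact: IH.
    by apply: continuous_comp; [exact: continuous_rsubmx|exact: continuous_lsubmx].
  apply: continuous_comp; last exact: IH.
  by apply: continuous_comp; exact: continuous_rsubmx.
Qed.

Lemma closed_zok s : closed [set p | @zok R k s p].
Proof.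
elim: s => [|i|o s1 IH1 s2 IH2|s IH] /=.
- by rewrite (_ : mkset _ = setT); [exact: closedT|apply/seteqP; split].
- by rewrite (_ : mkset _ = setT); [exact: closedT|apply/seteqP; split].
- rewrite (_ : [set _ | _] = (lsubmx @^-1` [set p | zok p]) `&`
    (rsubmx @^-1` [set p | zok p])); last first.
    by apply/seteqP; split=> p /= => [/andP[]|[-> ->]].
  by apply: closedI; apply: closed_preimage => // p;
    [exact: continuous_lsubmx|exact: continuous_rsubmx].
- rewrite (_ : [set _ | _] =
    ((fun p : 'rV[R]_(k + (dim k s + dim k s)) => \sum_j `|lsubmx p 0 j|)
       @^-1` [set x | x = 1]) `&`
    (((lsubmx \o rsubmx) @^-1` [set p | zok p]) `&`
    ((rsubmx \o rsubmx) @^-1` [set p | zok p]))); last first.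
    by apply/seteqP; split=> p /= => [/and3P[/eqP]|[-> [-> ->]]] //; rewrite eqxx.
  apply: closedI; [|apply: closedI].
  + apply: closed_preimage; last exact: closed_eq.
    apply: continuous_big => [|j _]; first exact: add_continuous.
    move=> p; apply: continuous_comp; last exact: norm_continuous.
    apply: (@continuous_comp _ _ _ lsubmx (fun z : 'rV[R]_k => z 0 j)).
      exact: continuous_lsubmx.
    exact: coord_continuous.
  + apply: closed_preimage => // p.
    by apply: continuous_comp; [exact: continuous_rsubmx|exact: continuous_lsubmx].
  + by apply: closed_preimage => // p; apply: continuous_comp; exact: continuous_rsubmx.
Qed.

Lemma compact_inX s : compact [set p | @inX R k s p].
Proof.
rewrite (_ : [set _ | _] = [set v : 'rV[R]_(dim k s) | forall i, `[(-1 : R), 1]%classic (v ord0 i)]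
  `&` ([set p | zok p] `&` (@vn R k s @^-1` [set x | 1 <= x]))); last first.
  apply/seteqP; split=> p /=.
    by case=> z v b; split=> // i; rewrite in_itv /= -ler_norml; exact: b.
  by case=> b [z v]; split=> // i; have := b i; rewrite in_itv /= -ler_norml.
apply: compact_closedI.
  exact: (@rV_compact R (dim k s) (fun=> `[(-1 : R), 1]%classic)
    (fun=> @segment_compact R (-1) 1)).
apply: closedI; first exact: closed_zok.
by apply: closed_preimage; [exact: continuous_vn|exact: closed_ge].
Qed.

(** A Lebesgue number: a nonzero coordinate of F keeps its sign near each point, and compactness
    makes the radius uniform. *)
Lemma sign_cover n m (K : set 'rV[R]_n) (F : 'rV[R]_n -> 'rV[R]_m) :
  compact K -> continuous F -> (forall x, K x -> F x != 0) ->
  exists2 d, 0 < d & forall x, K x -> exists j, forall y z,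
    ball x d y -> ball x d z -> 0 < F y 0 j * F z 0 j.
Proof.
move=> cK cF F0.
pose P := fun (d : R) x => exists j, forall y z,
  ball x d y -> ball x d z -> 0 < F y 0 j * F z 0 j.
have := (compact_near_coveringP K).1 cK R (0 : R)^'+ P _.
case=> [x Kx|d /= d0 dP].
  have [j Fj] : exists j, F x 0 j != 0.
    apply: contrapT => /forallNP h; move: (F0 x Kx) => /eqP; apply.
    by apply/rowP => j; rewrite mxE; apply/eqP/negPn/negP/h.
  have cj : continuous (fun y => F y 0 j).
    move=> y; have c0 : continuous (fun v : 'rV[R]_m => v 0 j).
      exact: coord_continuous.
    exact: (continuous_comp (cF y) (c0 (F y))).
  have ch : continuous (fun y => F x 0 j * F y 0 j).
    move=> y; exact: (continuousM (@cst_continuous _ _ (F x 0 j) y) (cj y)).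
  have : nbhs x [set y | 0 < F x 0 j * F y 0 j].
    by apply: (cvgr_gt _ (ch x)); rewrite -expr2 exprn_even_gt0.
  move=> /nbhs_ballP[e /= e0 eP].
  exists (ball x (e / 2), [set d | 0 < d < e / 2]); first split => /=.
  - by apply: nbhsx_ballx; rewrite divr_gt0.
  - near=> d; apply/andP; split; near: d; first exact: nbhs_right_gt.
    by apply: nbhs_right_lt; rewrite divr_gt0.
  move=> [x' d] /= [bx /andP[d0 de]]; exists j => y z by_ bz.
  have near w : ball x' d w -> 0 < F x 0 j * F w 0 j.
    move=> bw; apply: eP; rewrite [e]splitr.
    by apply: ball_triangle bx _; apply: le_ball bw; exact: ltW de.
  have := mulr_gt0 (near y by_) (near z bz).
  by rewrite mulrACA -expr2 pmulr_rgt0 // exprn_even_gt0.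
exists (d / 2); first by rewrite divr_gt0.
move=> x Kx; apply: dP => //=; last by rewrite divr_gt0.
by rewrite sub0r normrN gtr0_norm ?divr_gt0 //; lra.
Unshelve. all: by end_near. Qed.
End Compactness.

(** * Diameter of the simplices *)

Section Fineness.
Variables (R : realType) (n : nat).
Implicit Types (p q : 'rV[R]_n) (t u : seq 'rV[R]_n).

Lemma prism_mem (h h' : 'rV[R]_n -> 'rV[R]_n) t u : u \in prism h h' t ->
  forall p, p \in u -> exists2 q, q \in t & p = h q \/ p = h' q.
Proof.
elim: t u => //= y t IH u; rewrite inE => /orP[/eqP->|/mapP[v vt ->]] p.
  rewrite !inE => /or3P[/eqP->|/eqP->|/mapP[q qt ->]].
  - by exists y; [exact: mem_head|left].
  - by exists y; [exact: mem_head|right].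
  - by exists q; [rewrite inE qt orbT|right].
rewrite inE => /orP[/eqP->|/(IH _ vt)[q qt e]].
  by exists y; [exact: mem_head|left].
by exists q => //; rewrite inE qt orbT.
Qed.

Lemma fill_mem N p0 t u : u \in fill N p0 t ->
  (forall p, p \in u -> p = p0) \/
  exists2 j, (j < N)%N & forall p, p \in u -> exists2 q, q \in t &
    p = lerp (j%:R / N%:R) p0 q \/ p = lerp (j.+1%:R / N%:R) p0 q.
Proof.
rewrite inE => /orP[/eqP->|/flatten_mapP[j]].
  left=> p; rewrite inE => /orP[/eqP //|/mapP[q _ ->]].
  exact: lerp1.
rewrite mem_iota /= add0n => jN uj; right; exists j => //.
exact: prism_mem uj.
Qed.

Definition close (e : R) p q := forall j, `|p 0 j - q 0 j| <= e.

(** The difference is (1 - a)(p - q) + (a - b)(p0 - q), and coordinates in the box differ by at most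
    2. *)
Lemma close_lerp e d a b p0 p q : 0 <= a <= 1 -> `|a - b| <= d -> 0 <= e ->
  box p0 -> box q -> close e p q ->
  close (e + 2 * d) (lerp a p0 p) (lerp b p0 q).
Proof.
move=> /andP[a0 a1] abd e0 bp bq cpq j; rewrite !mxE.
have -> : (1 - a) * p 0 j + a * p0 0 j - ((1 - b) * q 0 j + b * p0 0 j) =
  (1 - a) * (p 0 j - q 0 j) + (a - b) * (p0 0 j - q 0 j) by ring.
rewrite (le_trans (ler_normD _ _)) // !normrM; apply: lerD.
  rewrite ger0_norm ?subr_ge0 // (le_trans (ler_wpM2l _ (cpq j))) ?subr_ge0 //.
  by nra.
rewrite mulrC; apply: ler_pM => //.
by rewrite (le_trans (ler_normB _ _)) // -[2]/(1 + 1) lerD.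
Qed.
End Fineness.

Lemma all_forall (T P : Type) (Q : P -> pred T) (L : seq T) :
  (forall p, all (Q p) L) -> all (fun y => `[< forall p, Q p y >]) L.
Proof.
elim: L => //= y L IH h; apply/andP; split.
  by apply/asboolP => p; have /andP[] := h p.
by apply: IH => p; have /andP[] := h p.
Qed.

Lemma flatten_map_all (T : Type) (A : eqType) (f : T -> seq A) (P : pred T)
    (L : seq T) u : all P L -> u \in flatten (map f L) -> exists2 y, P y & u \in f y.
Proof.
elim: L => //= y L IH /andP[Py PL]; rewrite mem_cat => /orP[uf|]; last exact: IH.
by exists y.
Qed.

(** Carriers are star-shaped about their poles, so cones stay inside. Consecutive layers are 1/N
    apart in a box of width 2, so each coning adds at most 2/N to the diameter. *)
Lemma kap_support (R : realType) k s (x : cell s) N n : (0 < N)%N ->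
  deg x = n -> valid k x ->
  forall t, t \in kap (@pole R k s) N n x ->
  (forall p, p \in t -> [/\ car x p, box p & (0 < vdeg x)%N -> 1 <= vn p]) /\
  (forall p q, p \in t -> q \in t -> close (n%:R * (2 / N%:R)) p q).
Proof.
move=> N0; have N0' : (0 : R) < N%:R by rewrite ltr0n.
elim: n x => [|n IH] x dx vx t.
  have v0 : vdeg x = 0%N by apply/eqP; rewrite -leqn0 -dx leq_vdeg.
  by rewrite kap_void // dx eqxx inE => /eqP ->; split=> // p.
case: (posnP (vdeg x)) => v0; first by rewrite kap_void // dx inE.
rewrite kap_full // => h.
have ab : all (fun y => [&& (deg y).+1 == deg x, valid k y &
    `[< forall p, car (R := R) (k := k) y p ==> car x p >]]) (bd x).
  have := bd_deg x; have := bd_valid vx.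
  have := all_forall (car_bd (R := R) (k := k) x).
  by elim: (bd x) => //= y L IHL /andP[-> /IHL h1] /andP[-> /h1 h2] /andP[-> /h2].
have [y /and3P[/eqP dy vy /asboolP cy]] := flatten_map_all ab h.
move=> /flattenP[c /mapP[t0 t0y ->] tc].
have {}dy : deg y = n by apply/eqP; rewrite -eqSS dy dx.
have [sup cl] := IH y dy vy t0 t0y.
have {}sup q : q \in t0 -> [/\ car x q, box q & 1 <= vn q].
  move=> qt; have [h1 h2 h3] := sup q qt; split=> //.
    exact: (implyP (cy q)).
  (* An empty cell carries at most the empty tuple, which has no vertex q. *)
  apply: h3; rewrite lt0n; apply/eqP => y0; move: t0y qt.
  by rewrite kap_void //; case: ifP => // _; rewrite inE => /eqP ->.
have vp : 1 <= (vdeg x)%:R :> R by rewrite ler1n.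
case: (fill_mem tc) => [tE|[j jN tE]].
  split=> [p /tE ->|p q /tE -> /tE -> i]; last first.
    by rewrite subrr normr0 mulr_ge0 // divr_ge0 // ltW.
  by split=> [||_]; [exact: car_pole|exact: box_pole|rewrite vn_pole].
have in01 i : (i <= N)%N -> 0 <= (i%:R / N%:R : R) <= 1.
  by move=> iN; rewrite divr_ge0 ?(ltW N0') //= ler_pdivrMr // mul1r ler_nat.
have aj := in01 j (ltnW jN); have aj1 := in01 j.+1 jN.
have one : 0 <= N%:R^-1 :> R by rewrite invr_ge0 ltW.
have step : `|j%:R / N%:R - j.+1%:R / N%:R| <= N%:R^-1 :> R.
  rewrite (_ : _ - _ = - N%:R^-1); first by rewrite normrN ger0_norm.
  by rewrite -natr1; ring.
split.
- have one_step a q : 0 <= a <= 1 -> q \in t0 ->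
    [/\ car x (lerp a (pole R k x) q), box (lerp a (pole R k x) q)
      & 1 <= vn (lerp a (pole R k x) q)].
    move=> a01 /sup[cq bq vq]; split; first exact: car_lerp.
      by apply: box_lerp => //; exact: box_pole.
    by rewrite vn_lerp //; move: a01 => /andP[]; nra.
  move=> p /tE[q qt [->|->]].
    by have [] := one_step _ _ aj qt.
  by have [] := one_step _ _ aj1 qt.
- have -> : n.+1%:R * (2 / N%:R) = n%:R * (2 / N%:R) + 2 * N%:R^-1 :> R.
    by rewrite -natr1 mulrDl mul1r.
  have e0 : 0 <= n%:R * (2 / N%:R) :> R by rewrite mulr_ge0 // mulr_ge0.
  move=> p q /tE[p' pt pE] /tE[q' qt qE].
  have [_ bq _] := sup q' qt.
  case: pE qE => -> [] ->; apply: close_lerp => //; rewrite ?subrr ?normr0 //;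
    try exact: box_pole; try exact: cl.
  by rewrite distrC.
Qed.

(** * A Borsuk-Ulam theorem *)

Section SignOfVectors.
Variables (R : realType) (m : nat).
Implicit Types y z : 'rV[R]_m.

Definition lexs y : bool :=
  if [pick i | y 0 i != 0] is Some i then 0 < y 0 i else false.

(* Ties are broken lexicographically, so that [sgn j] is odd on nonzero vectors. *)
Definition sgn (j : nat) y : bool :=
  if insub j is Some i then (if y 0 i == 0 then lexs y else 0 < y 0 i)
  else lexs y.

Lemma lexsN y : y != 0 -> lexs (- y) = lexs y + 1.
Proof.
move=> y0; rewrite /lexs.
have -> : [pick i | (- y) 0 i != 0] = [pick i | y 0 i != 0].
  by apply: eq_pick => i; rewrite mxE oppr_eq0.
case: pickP => [i yi|h]; last first.
  case/eqP: y0; apply/rowP => i; rewrite mxE; apply/eqP/negPn/negP => yi.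
  by move: (h i); rewrite /= yi.
by rewrite mxE oppr_gt0; case: ltgtP yi.
Qed.

Lemma sgnN j y : y != 0 -> sgn j (- y) = sgn j y + 1.
Proof.
move=> y0; rewrite /sgn; case: insubP => [i _ _|_]; last exact: lexsN.
by rewrite mxE oppr_eq0 oppr_gt0; case: ltgtP => // _; exact: lexsN.
Qed.

Lemma sgn_same (j : 'I_m) y z : 0 < y 0 j * z 0 j -> sgn j y = sgn j z.
Proof.
rewrite /sgn valK; case: (ltgtP (y 0 j) 0) => [yj|yj|->]; last by rewrite mul0r ltxx.
  by rewrite nmulr_rgt0 // => zj; rewrite lt_eqF // ltNge ltW.
by rewrite pmulr_rgt0 // => zj; rewrite gt_eqF.
Qed.
End SignOfVectors.

Lemma wprod_eq0 (R : numFieldType) (V : lmodType R) (B : nat -> V -> bool) j t :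
  (j < (size t).-1)%N -> (forall p q, p \in t -> q \in t -> B j p = B j q) ->
  wprod B t = 0.
Proof.
elim: t => [|p [|q t] IH] // jt h; rewrite wprod_cons.
move: jt; rewrite /= ltnS leq_eqVlt => /orP[/eqP jt|jt].
  rewrite -jt (h p q) ?inE ?eqxx ?orbT // add2b; by case: (wprod _ _).
have e : wprod B (q :: t) = 0.
  by apply: IH => // u v ut vt; apply: h; rewrite inE ?ut ?vt orbT.
by rewrite [X in _ * X]e mulr0.
Qed.

(** Without zeros, the signs of F define a cochain [al]. Its coboundary and its 1 + tau image agree
    in degrees up to m, both being [wprod]; in degree m + 1 [wprod] vanishes on fine simplices;
    beyond, all is zero. So [al] pairs to 0 with D H, but to 1 with T and to 0 with B. *)
Theorem equivariant_zero (R : realType) k s M m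
    (F : 'rV[R]_(dim k s) -> 'rV[R]_m) :
  tower k s M -> (m < M)%N -> continuous F ->
  (forall p, F (taup p) = - F p) -> (forall g p, F (gactp g p) = F p) ->
  exists2 p, inX p & F p = 0.
Proof.
move=> [H [T [Bd [tr dB n0]]]] mM cF Fodd Finv; apply: contrapT => noz.
have F0 p : inX p -> F p != 0.
  by move=> Xp; apply/eqP => Fp; apply: noz; exists p.
have [d d0 cover] := sign_cover (@compact_inX R k s) cF F0.
have [N N0 fineN] : exists2 N : nat, (0 < N)%N & m.+1%:R * (2 / N%:R) < d.
  (* Makes the diameter of the simplices in cells of degree m + 1 smaller than the Lebesgue number
     d. *)
  pose N := (Num.truncn (m.+1%:R * 2 / d)).+1.
  exists N => //; rewrite mulrA ltr_pdivrMr ?ltr0n // -ltr_pdivrMl // mulrC.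
  by rewrite /N truncnS_gt.
pose B j (p : 'rV[R]_(dim k s)) := sgn j (F p).
pose ka x := kap (@pole R k s) N (deg x) x.
(* Cut at degree m: on m vertices [sprod] already uses all the m coordinate signs. *)
pose al (x : cell s) : bool :=
  (deg x <= m)%N && \sum_(t <- ka x) sprod B t.
have Xt x t : full k x -> t \in ka x -> forall p, p \in t -> inX p.
  move=> /andP[v0 vx] tx p pt; have [/(_ p pt)[cp bp vp] _] := kap_support N0 erefl vx tx.
  by split=> //; [exact: car_zok cp|exact: vp].
have tsize x t : t \in ka x -> size t = deg x.
  by move=> tx; have /allP /(_ t tx) /eqP := kap_size (@pole R k s) N (erefl (deg x)).
have al_inv : invariant al.
  move=> g x; rewrite /al deg_gact; congr (_ && _); rewrite /ka deg_gact.
  rewrite (kap_act N (deg_gact g) (vdeg_gact g) (pole_gact R k g) (gactp_lerp g)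
    (fun f x => bd_gact f g x)).
  by apply: eq_bigr => t _; apply: sprod_inv => j p _; rewrite /B Finv.
have al_tau x : full k x -> al x + al (tau x) =
    (deg x <= m)%N && \sum_(t <- ka x) wprod B t.
  move=> fx; rewrite /al /ka deg_tau.
  rewrite (kap_act N (@deg_tau s) (@vdeg_tau s) (@pole_tau R k s) (@taup_lerp R k s)
    (@bd_tau s)).
  case: (deg x <= m)%N => //=; rewrite -big_split; apply: eq_big_seq => t tx.
  apply: sprod_odd => [|j p pt].
    by rewrite (tsize x) // (leq_trans _ (leq_vdeg x)) //; case/andP: fx.
  by rewrite /B Fodd sgnN //; apply: F0; exact: Xt fx tx p pt.
have al_bd x : full k x -> \sum_(y <- bd x) al y =
    (deg x <= m.+1)%N && \sum_(t <- ka x) wprod B t.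
  move=> fx; have dx : (0 < deg x)%N.
    by case/andP: fx => v _; exact: leq_trans v (leq_vdeg x).
  have -> : (deg x <= m.+1)%N = ((deg x).-1 <= m)%N by rewrite -{1}(prednK dx).
  transitivity (\sum_(y <- bd x)
    ((deg x).-1 <= m)%N && \sum_(t <- kap (@pole R k s) N (deg x).-1 y) sprod B t).
    apply: eq_sum_all (bd_deg x) _ => y /eqP dy.
    by rewrite /al /ka -dy.
  case: ((deg x).-1 <= m)%N; last by rewrite big1.
  rewrite -(kap_bd (@pole R k s) N0 (sprod B) (erefl (deg x))) /=.
  apply: eq_big_seq => t tx; have := tsize x t tx.
  case: t {tx} => [e|p t _]; first by rewrite -e in dx.
  exact: sprod_bd.
have al_void : \sum_(x <- T) al x = 1.
  rewrite -n0; apply: eq_sum_all (trT tr) _ => x /andP[/eqP v0 _].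
  by rewrite /al /ka kap_void //; case: eqP => [->|_]; rewrite ?big_seq1 // big_nil andbF.
have al_top : \sum_(x <- Bd) al x = 0.
  rewrite (eq_sum_all (g := fun=> 0) dB) ?big1 // => x /eqP dx.
  by rewrite /al dx leqNgt mM.
have fine x t : full k x -> t \in ka x -> deg x = m.+1 -> wprod B t = 0.
  move=> fx tx dx; have st := tsize x t tx; rewrite dx in st.
  case: t st tx => // p0 t st tx.
  have [j cj] := cover p0 (Xt x _ fx tx p0 (mem_head _ _)).
  apply: (@wprod_eq0 _ _ _ j); first by rewrite st ltn_ord.
  have near p : p \in p0 :: t -> ball p0 d p.
    move=> pt; rewrite mx_norm_ball /ball_ /=.
    case/andP: fx => _ vx; have [_ cl] := kap_support N0 erefl vx tx.
    have {}cl := cl p0 p (mem_head _ _) pt; rewrite dx in cl.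
    rewrite /Num.norm /= mx_normrE; apply/bigmax_ltP; split => //= i _.
    by rewrite !mxE (le_lt_trans _ fineN) //; case: i => i l /=; rewrite (ord1 i); apply: cl.
  by move=> p q pt qt; apply: sgn_same; apply: cj; apply: near.
have : \sum_(x <- H) dmap al x = 0.
  rewrite (eq_sum_all (g := fun=> 0) (trH tr)) ?big1 // => x fx.
  rewrite /dmap -addrA al_tau // al_bd //.
  case: (ltngtP (deg x) m.+1) => [dx|dx|dx].
  - by rewrite -ltnS dx add2b.
  - by rewrite leqNgt (ltnW dx).
  - rewrite dx ltnn /= addr0 big_seq big1 // => t tx; exact: fine fx tx dx.
by rewrite (trC tr al_inv) al_void al_top.
Qed.

(** * Blocks of lines *)

(** The recursion behind Lucas' theorem. The second part is the parity of (2j+1) C(2n, 2j+1) = 2n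
    C(2n-1, 2j). *)
Lemma odd_bin_double n j :
  odd 'C(n.*2, j.*2) = odd 'C(n, j) /\ odd 'C(n.*2, j.*2.+1) = false.
Proof.
have even_odd n' j' : odd 'C(n'.*2, j'.*2.+1) = false.
  have := mul_bin_diag n'.*2 j'.*2.
  by move=> /(congr1 odd); rewrite !oddM /= !odd_double.
split; last exact: even_odd.
elim: n j => [|n IH] [|j]; rewrite ?bin0 //.
rewrite !doubleS !binS !oddD -[j.*2.+2]/(j.+1).*2 IH.
by rewrite -[(j.*2).+1]/(j.*2.+1) even_odd IH /= addbF addbC.
Qed.

Lemma odd_bin_doubleS n j : odd 'C(n.*2.+1, j.*2.+1) = odd 'C(n, j).
Proof.
by rewrite binS oddD (odd_bin_double n j).1 (odd_bin_double n j).2.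
Qed.

(** The m lowest binary digits of c 2^m - 1 are ones, and 2^m - 1 has no others. *)
Lemma odd_bin_pow2 m c : (0 < c)%N -> odd 'C((c * 2 ^ m).-1, (2 ^ m).-1).
Proof.
move=> c0; elim: m => [|m IH]; first by rewrite bin0.
have p0 : (0 < 2 ^ m)%N by rewrite expn_gt0.
have cp0 : (0 < c * 2 ^ m)%N by rewrite muln_gt0 c0.
have e x : (0 < x)%N -> (x * 2).-1 = (x.-1).*2.+1.
  by case: x => // x _; rewrite muln2.
by rewrite expnSr mulnA !e // odd_bin_doubleS.
Qed.

Fixpoint lines (i n : nat) : shape :=
  if n is n'.+1 then Join 0 (Line i) (lines i.+1 n') else Nil.

Definition block (k a : nat) : shape := iter a Sq (lines 0 k.+1).

Definition blocks (k : nat) (l : seq nat) : shape :=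
  foldr (fun a s => Join 1 (block k a) s) (Line 0) l.

(** The solution of M_0 = k + 1, M_(a+1) = 2 M_a + k - 1, the recursion of [tower_Sq]. *)
Definition bdim (k a : nat) : nat := (k.+1 * 2 ^ a + k.-1 * (2 ^ a).-1)%N.

Lemma tower_lines k i n : tower k (lines i n) n.
Proof.
elim: n i => [|n IH] i; first exact: tower_Nil.
by rewrite -add1n; apply: tower_Join; [exact: tower_Line|exact: IH].
Qed.

Lemma tower_block k a : (exists m, k = 2 ^ m)%N -> tower k (block k a) (bdim k a).
Proof.
move=> [m km]; have k0 : (0 < k)%N by rewrite km expn_gt0.
elim: a => [|a IH].
  by rewrite /bdim expn0 muln0 addn0 muln1; exact: tower_lines.
have a0 : (0 < 2 ^ a)%N by rewrite expn_gt0.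
have -> : bdim k a.+1 = (bdim k a + bdim k a + k.-1)%N.
  rewrite /bdim expnS; move: a0; case: (2 ^ a)%N => // x _.
  have -> : (2 * x.+1).-1 = (x + x.+1)%N by lia.
  by rewrite /=; lia.
apply: tower_Sq => //.
- by rewrite /bdim addn_gt0 muln_gt0 a0.
(* The upper index is 2^(a+1) k - 1 and the lower one k - 1, the case of [odd_bin_pow2]. *)
- have -> : ((bdim k a).-1 + k.-1)%N = ((2 ^ a).*2 * 2 ^ m).-1.
    rewrite /bdim -km; move: a0 k0; case: (2 ^ a)%N => // x _.
    case: (k) => // y _ /=; rewrite -!addnn; nia.
  by rewrite km; apply: odd_bin_pow2; rewrite double_gt0.
Qed.

Lemma tower_blocks k l : (exists m, k = 2 ^ m)%N ->
  tower k (blocks k l) (\sum_(a <- l) bdim k a).+1.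
Proof.
move=> hk; elim: l => [|a l IH]; first by rewrite big_nil; exact: tower_Line.
by rewrite big_cons -addnS; apply: tower_Join => //; exact: tower_block.
Qed.

(** * Configurations and dependent jets *)

Section ConfigurationMap.
Variables (R : realType) (k n : nat) (g : nat -> 'rV[R]_k -> 'rV[R]_n).
Implicit Types (c : 'rV[R]_k) (rho : R).

(** For k > 0 this shifts the sum of coordinates by at least 4, more than twice the cluster radius
    3/2. *)
Let w : 'rV[R]_k := const_mx 4.

(** With ratio 1/3 a cluster has radius at most rho (1 + 1/3 + ...) = 3/2 rho. Its two halves, of
    radius rho/2 about centres 2 rho apart, are disjoint. *)
Fixpoint cmap (s : shape) c rho : 'rV[R]_(dim k s) -> 'rV[R]_n :=
  match s with
  | Nil => fun _ => 0
  | Line i => fun p => p 0 0 *: g i c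
  | Join o s1 s2 => fun p =>
      cmap c rho (lsubmx p) + cmap (c + o%:R *: w) rho (rsubmx p)
  | Sq s => fun p =>
      cmap (c + rho *: lsubmx p) (rho / 3) (lsubmx (rsubmx p)) +
      cmap (c - rho *: lsubmx p) (rho / 3) (rsubmx (rsubmx p))
  end.

(** Base point, index and coefficient of each line, in order. *)
Fixpoint terms (s : shape) c rho : 'rV[R]_(dim k s) -> seq ('rV[R]_k * nat * R) :=
  match s with
  | Nil => fun _ => [::]
  | Line i => fun p => [:: (c, i, p 0 0)]
  | Join o s1 s2 => fun p =>
      terms c rho (lsubmx p) ++ terms (c + o%:R *: w) rho (rsubmx p)
  | Sq s => fun p =>
      terms (c + rho *: lsubmx p) (rho / 3) (lsubmx (rsubmx p)) ++
      terms (c - rho *: lsubmx p) (rho / 3) (rsubmx (rsubmx p))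
  end.

Lemma cmap_terms s c rho (p : 'rV[R]_(dim k s)) :
  cmap c rho p = \sum_(t <- terms c rho p) t.2 *: g t.1.2 t.1.1.
Proof.
elim: s c rho p => [|i|o s1 IH1 s2 IH2|s IH] c rho p /=.
- by rewrite big_nil.
- by rewrite big_seq1.
- by rewrite big_cat IH1 IH2.
- by rewrite big_cat !IH.
Qed.

Lemma vn_terms s c rho (p : 'rV[R]_(dim k s)) :
  vn p = \sum_(t <- terms c rho p) `|t.2|.
Proof.
elim: s c rho p => [|i|o s1 IH1 s2 IH2|s IH] c rho p /=.
- by rewrite big_nil.
- by rewrite big_seq1.
- by rewrite big_cat -IH1 -IH2.
- by rewrite big_cat -!IH.
Qed.

Lemma cmap_tau s c rho (p : 'rV[R]_(dim k s)) :
  cmap c rho (taup p) = - cmap c rho p.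
Proof.
elim: s c rho p => [|i|o s1 IH1 s2 IH2|s IH] c rho p /=.
- by rewrite oppr0.
- by rewrite mxE scaleNr.
- by rewrite row_mxKl row_mxKr IH1 IH2 opprD.
- by rewrite !(row_mxKl, row_mxKr) !IH opprD.
Qed.

Lemma cmap_gact s h c rho (p : 'rV[R]_(dim k s)) :
  cmap c rho (gactp h p) = cmap c rho p.
Proof.
elim: s h c rho p => [|i|o s1 IH1 s2 IH2|s IH] //=.
- by move=> [h|h] c rho p; rewrite row_mxKl row_mxKr ?IH1 ?IH2.
- move=> [h|] c rho p; rewrite !(row_mxKl, row_mxKr) ?IH //.
  by rewrite scalerN opprK addrC.
Qed.

Lemma cmap_continuous s rho (T : topologicalType) (cc : T -> 'rV[R]_k)
    (pp : T -> 'rV[R]_(dim k s)) : (forall i, continuous (g i)) ->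
  continuous cc -> continuous pp -> continuous (fun t => cmap (cc t) rho (pp t)).
Proof.
move=> cg; elim: s rho cc pp => [|i|o s1 IH1 s2 IH2|s IH] rho cc pp hc hp /=.
- exact: cst_continuous.
- move=> t; apply: (@continuousZ _ _ _ (fun t => pp t 0 0) (fun t => g i (cc t))).
    apply: (@continuous_comp _ _ _ pp (fun v : 'rV[R]_1 => v 0 0)); first exact: hp.
    exact: coord_continuous.
  by apply: continuous_comp; [exact: hc|exact: cg].
- have hl : continuous (lsubmx \o pp).
    by move=> t; apply: continuous_comp; [exact: hp|exact: continuous_lsubmx].
  have hr : continuous (rsubmx \o pp).
    by move=> t; apply: continuous_comp; [exact: hp|exact: continuous_rsubmx].
  have hs : continuous (fun t => cc t + o%:R *: w).
    move=> t; apply: (@continuousD _ _ _ cc (fun=> o%:R *: w)); first exact: hc.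
    exact: cst_continuous.
  move=> t.
  apply: (@continuousD _ _ _ (fun t => cmap (cc t) rho ((lsubmx \o pp) t))
    (fun t => cmap (cc t + o%:R *: w) rho ((rsubmx \o pp) t))).
    exact: IH1.
  exact: IH2.
- have hl : continuous (lsubmx \o pp).
    by move=> t; apply: continuous_comp; [exact: hp|exact: continuous_lsubmx].
  have hr : continuous (rsubmx \o pp).
    by move=> t; apply: continuous_comp; [exact: hp|exact: continuous_rsubmx].
  have hrl : continuous (lsubmx \o (rsubmx \o pp)).
    by move=> t; apply: continuous_comp; [exact: hr|exact: continuous_lsubmx].
  have hrr : continuous (rsubmx \o (rsubmx \o pp)).
    by move=> t; apply: continuous_comp; [exact: hr|exact: continuous_rsubmx].
  have hz : continuous (fun t => rho *: (lsubmx \o pp) t).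
    move=> t; apply: (@continuousZ _ _ _ (fun=> rho) (lsubmx \o pp)).
      exact: cst_continuous.
    exact: hl.
  have h1 : continuous (fun t => cc t + rho *: (lsubmx \o pp) t).
    by move=> t; exact: (continuousD (hc t) (hz t)).
  have h2 : continuous (fun t => cc t - rho *: (lsubmx \o pp) t).
    by move=> t; exact: (continuousB (hc t) (hz t)).
  move=> t.
  apply: (@continuousD _ _ _
    (fun t => cmap (cc t + rho *: (lsubmx \o pp) t) (rho / 3) ((lsubmx \o (rsubmx \o pp)) t))
    (fun t => cmap (cc t - rho *: (lsubmx \o pp) t) (rho / 3) ((rsubmx \o (rsubmx \o pp)) t))).
    exact: IH.
  exact: IH.
Qed.

Definition l1 (z : 'rV[R]_k) : R := \sum_j `|z 0 j|.

Lemma l1D x y : l1 (x + y) <= l1 x + l1 y.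
Proof.
by rewrite /l1 -big_split /=; apply: ler_sum => j _; rewrite mxE ler_normD.
Qed.

Lemma l1Z a x : l1 (a *: x) = `|a| * l1 x.
Proof. by rewrite /l1 mulr_sumr; apply: eq_bigr => j _; rewrite mxE normrM. Qed.

Lemma l1N x : l1 (- x) = l1 x.
Proof. by rewrite -scaleN1r l1Z normrN normr1 mul1r. Qed.

Lemma terms_lines i q c rho (p : 'rV[R]_(dim k (lines i q))) :
  unzip1 (terms c rho p) = [seq (c, j) | j <- iota i q].
Proof.
elim: q i c p => [|q IH] i c p //=.
by rewrite scale0r addr0 IH.
Qed.

Lemma terms_block a c rho (p : 'rV[R]_(dim k (block k a))) :
  0 < rho -> zok p ->
  exists xs, [/\ size xs = (2 ^ a)%N, uniq xs,
    forall x, x \in xs -> l1 (x - c) <= 3 / 2 * rho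
    & unzip1 (terms c rho p) = [seq (x, i) | x <- xs, i <- iota 0 k.+1]].
Proof.
elim: a c rho p => [|a IH] c rho p r0 zp.
  exists [:: c]; split=> //.
    move=> x; rewrite inE => /eqP ->; rewrite subrr -(scale0r 0) l1Z normr0 mul0r.
    by rewrite mulr_ge0 // ?divr_ge0 // ltW.
  have e := @terms_lines 0 k.+1 c rho p.
  by rewrite /= cats0.
move: zp => /and3P[/eqP z1 zp1 zp2].
set z := lsubmx p in z1.
have r3 : 0 < rho / 3 by rewrite divr_gt0.
have [xs1 [s1 u1 d1 e1]] := IH (c + rho *: z) _ _ r3 zp1.
have [xs2 [s2 u2 d2 e2]] := IH (c - rho *: z) _ _ r3 zp2.
have lz : l1 (rho *: z) = rho by rewrite l1Z -/(l1 z) /l1 z1 mulr1 gtr0_norm.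
exists (xs1 ++ xs2); split.
- by rewrite size_cat s1 s2 addnn -mul2n expnS.
- rewrite cat_uniq u1 u2 andbT; apply/hasPn => x x2; apply/negP => x1.
  have := d1 x x1; have := d2 x x2.
  have := l1D (x - (c - rho *: z)) (- (x - (c + rho *: z))).
  rewrite l1N (_ : _ + _ = 2 *: (rho *: z)); last first.
    by rewrite scaler_nat mulr2n; apply/rowP => j; rewrite !mxE; ring.
  by rewrite l1Z lz gtr0_norm //; lra.
- move=> x; rewrite mem_cat => /orP[/d1|/d2] h.
    rewrite (_ : x - c = x - (c + rho *: z) + rho *: z); last first.
      by rewrite opprD addrA subrK.
    by rewrite (le_trans (l1D _ _)) // lz; lra.
  rewrite (_ : x - c = x - (c - rho *: z) + - (rho *: z)); last first.
    by rewrite opprB addrA addrAC addrK.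
  by rewrite (le_trans (l1D _ _)) // l1N lz; lra.
- by rewrite [LHS]map_cat -/(unzip1 _) -/(unzip1 _) e1 e2 map_cat flatten_cat.
Qed.
End ConfigurationMap.

(** * Coefficients as functions of point and index *)

Section CollectTerms.
Variables (A : eqType) (R : pzRingType) (V : lmodType R).
Variables (T : seq (A * R)) (G : A -> V).
Hypothesis uT : uniq (unzip1 T).

Lemma unzip1_inj t t' : t \in T -> t' \in T -> t.1 = t'.1 -> t = t'.
Proof.
elim: (T) uT => //= u L IH /andP[uL uuL]; rewrite !inE.
move=> /orP[/eqP->|tL] /orP[/eqP->|t'L] //= e; last exact: IH.
  by move: uL; rewrite e map_f.
by move: uL; rewrite -e map_f.
Qed.

Definition coef (key : A) : R := \sum_(t <- T) (if t.1 == key then t.2 else 0).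

Lemma coef_mem t : t \in T -> coef t.1 = t.2.
Proof.
move=> tT; rewrite /coef (bigD1_seq t) //= ?eqxx; last exact: map_uniq uT.
rewrite big_seq_cond big1 ?addr0 // => t' /andP[t'T t't].
case: eqP => // e; case/eqP: t't; exact: unzip1_inj.
Qed.

Lemma sum_coef : \sum_(t <- T) t.2 *: G t.1 = \sum_(key <- unzip1 T) coef key *: G key.
Proof.
by rewrite big_map; apply: eq_big_seq => t tT; rewrite coef_mem.
Qed.
End CollectTerms.

(** * Dependence at r points and one more *)

Section DependentJets.
Variables (R : realType) (k n : nat) (g : nat -> 'rV[R]_k -> 'rV[R]_n).

(** A linear functional separating the successive clusters. *)
Let lam (z : 'rV[R]_k) : R := \sum_j z 0 j.

Let lam_l1 z : `|lam z| <= l1 z.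
Proof. exact: ler_norm_sum. Qed.

Let lamB x y : lam (x - y) = lam x - lam y.
Proof.
by rewrite /lam -sumrB; apply: eq_bigr => j _; rewrite !mxE.
Qed.

Lemma terms_blocks l c (p : 'rV[R]_(dim k (blocks k l))) : (0 < k)%N -> zok p ->
  exists xs ps, [/\ size xs = (\sum_(a <- l) 2 ^ a)%N, uniq (ps :: xs),
    forall x, x \in ps :: xs -> lam c - 3 / 2 <= lam x
    & unzip1 (terms c 1 p) =
        [seq (x, i) | x <- xs, i <- iota 0 k.+1] ++ [:: (ps, 0%N)]].
Proof.
move=> k0; elim: l c p => [|a l IH] c p zp.
  exists [::], c; split=> //; first by rewrite big_nil.
  by move=> x; rewrite inE => /eqP ->; lra.
move: zp => /andP[zp1 zp2].
have [xs1 [s1 u1 d1 e1]] := terms_block c ltr01 zp1.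
set c' := c + 1%:R *: const_mx 4.
have [xs2 [ps [s2 u2 d2 e2]]] := IH c' _ zp2.
have lc' : lam c' >= lam c + 4.
  have -> : lam c' = lam c + k%:R * 4.
    rewrite /lam /c'; under eq_bigr do rewrite !mxE mul1r.
    by rewrite big_split /= sumr_const card_ord mulr_natl.
  have : (1 : R) <= k%:R by rewrite ler1n.
  by lra.
have sep x : x \in xs1 -> x \notin ps :: xs2.
  move=> x1; apply/negP => /d2 h2; have := d1 x x1.
  have := lam_l1 (x - c); rewrite lamB ler_norml => /andP[_ h3]; lra.
exists (xs1 ++ xs2), ps; split.
- by rewrite size_cat big_cons s1 s2.
- move: u2 => /= /andP[ups u2]; rewrite mem_cat negb_or ups andbT.
  rewrite cat_uniq u1 u2 andbT /=; apply/andP; split.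
    by apply/negP => /sep; rewrite inE eqxx.
  by apply/hasPn => x x2; apply/negP => /sep; rewrite inE x2 orbT.
- have h2 x : x \in ps :: xs2 -> lam c - 3 / 2 <= lam x by move=> /d2; lra.
  move=> x; rewrite inE mem_cat => /or3P[xp|x1|x2].
  + by apply: h2; rewrite inE xp.
  + have := lam_l1 (x - c); have := d1 x x1; rewrite lamB ler_norml.
    by move=> ? /andP[]; lra.
  + by apply: h2; rewrite inE x2 orbT.
- by rewrite [LHS]map_cat -/(unzip1 _) -/(unzip1 _) e1 e2 map_cat flatten_cat catA.
Qed.

Theorem dependent_jets l : (exists m, k = 2 ^ m)%N ->
  (n <= \sum_(a <- l) bdim k a)%N -> (forall i, continuous (g i)) ->
  exists xs ps (co : 'rV[R]_k -> nat -> R) (b : R),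
    [/\ size xs = (\sum_(a <- l) 2 ^ a)%N, uniq (ps :: xs),
      \sum_(x <- xs) \sum_(i < k.+1) co x i *: g i x + b *: g 0%N ps = 0
      & (exists x i, [/\ x \in xs, (i < k.+1)%N & co x i != 0]) \/ b != 0].
Proof.
move=> hk nl cg; have k0 : (0 < k)%N by case: hk => m ->; rewrite expn_gt0.
pose F (p : 'rV[R]_(dim k (blocks k l))) := cmap g 0 1 p.
have cF : continuous F.
  apply: (@cmap_continuous R k n g _ 1 'rV[R]_(dim k (blocks k l)) (fun=> 0) id cg).
    by move=> p; exact: cst_continuous.
  by move=> p; exact: cvg_id.
(* The closing line adds 1 to the degree of the tower, so n may equal the sum of the [bdim]. *)
have [p [zp vp _] Fp] := equivariant_zero (tower_blocks l hk)
  (nl : (n < _.+1)%N) cF (cmap_tau g 0 1) (fun h p => cmap_gact g h 0 1 p).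
have [xs [ps [sx ux _ ke]]] := terms_blocks 0 k0 zp.
set T := terms 0 1 p in ke.
have uT : uniq (unzip1 T).
  move: ux => /= /andP[pxs ux]; rewrite ke cat_uniq; apply/and3P; split=> //.
    have h := @allpairs_uniq _ _ _ (fun x i => (x, i)) xs (iota 0 k.+1) ux (iota_uniq _ _).
    by apply: h; move=> [? ?] [? ?].
  apply/hasPn => z; rewrite inE => /eqP ->.
  by apply/negP => /allpairsP[[x i] /= [xx _ [xp _]]]; rewrite xp xx in pxs.
pose co x i := coef T (x, i).
exists xs, ps, co, (co ps 0%N); split=> //.
  move: Fp; rewrite /F (cmap_terms g) -/T.
  rewrite (@sum_coef _ _ _ T (fun key => g key.2 key.1)) // ke big_cat big_seq1.
  rewrite big_allpairs_dep => eF; rewrite -[RHS]eF; congr (_ + _).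
  apply: eq_bigr => x _.
  by rewrite -(big_mkord xpredT (fun i => co x i *: g i x)) /index_iota subn0.
move: vp; rewrite (vn_terms 0 1) -/T => vp.
have [t tT t0] : exists2 t, t \in T & t.2 != 0.
  apply: contrapT => h; move: vp; rewrite big_seq big1 ?ler10 // => t tT.
  apply/eqP; rewrite normr_eq0; apply/negPn/negP => t0; apply: h; by exists t.
have : t.1 \in unzip1 T by apply: map_f.
rewrite ke mem_cat => /orP[/allpairsP[[x i] [xx ii e]]|].
  left; exists x, i; split; [exact: xx|by move: ii; rewrite mem_iota|].
  by rewrite /co -e coef_mem.
by rewrite inE => /eqP e; right; rewrite /co -e coef_mem.
Qed.
End DependentJets.

(** * A flat bump function *)

Section FlatFunctions.
Variable R : realType.
Implicit Types (q : {poly R}) (u x y : R).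

(** Polynomial multiples in 1/u of e^(-1/u) form a family closed under differentiation, so
    smoothness needs only first derivatives. *)
Definition flat q u : R := if 0 < u then q.[u^-1] * expR (- u^-1) else 0.

Lemma expR_decay n y : 0 <= y -> y ^+ n * expR (- y) <= n`!%:R.
Proof.
move=> y0; rewrite expRN ler_pdivrMr ?expR_gt0 //; case: n => [|n].
  by rewrite expr0 fact0 mul1r -expR0 ler_expR.
have f0 : (0 : R) < n.+1`!%:R by rewrite ltr0n fact_gt0.
rewrite mulrC -ler_pdivrMr //; apply: le_trans (expR_ge1Dxn n y0).
by rewrite lerDr.
Qed.

Lemma poly_decay q n : exists2 C, 0 <= C &
  forall y, 0 <= y -> `|q.[y]| * y ^+ n * expR (- y) <= C.
Proof.
elim/poly_ind: q n => [|q c IH] n.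
  by exists 0 => // y _; rewrite horner0 normr0 !mul0r.
have [C C0 hC] := IH n.+1.
exists (C + `|c| * n`!%:R); first by rewrite addr_ge0 // mulr_ge0.
move=> y y0; rewrite hornerMXaddC.
have yn : 0 <= y ^+ n * expR (- y) by rewrite mulr_ge0 ?exprn_ge0 ?expR_ge0.
rewrite -mulrA (le_trans (ler_wpM2r yn (ler_normD _ _))) // mulrDl; apply: lerD.
  rewrite normrM (ger0_norm y0); have := hC y y0.
  by rewrite exprS !mulrA.
by apply: ler_wpM2l => //; exact: expR_decay.
Qed.

Lemma flat_le0 q u : u <= 0 -> flat q u = 0.
Proof. by rewrite /flat => u0; rewrite ltNge u0. Qed.

Lemma flat_quadratic q : exists2 C, 0 <= C & forall u, `|flat q u| <= C * u ^+ 2.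
Proof.
have [C C0 hC] := poly_decay q 2; exists C => // u; rewrite /flat.
case: ifP => [u0|_]; last by rewrite normr0 mulr_ge0 // sqr_ge0.
have u2 : 0 < u ^+ 2 by rewrite exprn_gt0.
rewrite normrM (ger0_norm (expR_ge0 _)) -ler_pdivrMr //.
have := hC u^-1; rewrite invr_ge0 (ltW u0) => /(_ isT).
by rewrite exprVn mulrAC.
Qed.

(* (q(1/u) e^(-1/u))' = u^-2 (q - q')(1/u) e^(-1/u). *)
Definition dflat q : {poly R} := 'X^2 * (q - q^`()).

Lemma is_derive_flat q u : is_derive u 1 (flat q) (flat (dflat q) u).
Proof.
case: (ltgtP u 0) => [u0|u0|->].
- rewrite (flat_le0 _ (ltW u0)); apply: (@near_eq_is_derive _ R R (cst 0)).
    by near=> z; rewrite /= flat_le0 // ltW //; near: z; exact: lt_nbhsl.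
- pose F x := q.[x^-1] * expR (- x^-1).
  apply: (@near_eq_is_derive _ R R F).
    by near=> z; rewrite /flat ifT //; near: z; exact: lt_nbhsr.
  have u0' : u != 0 by rewrite gt_eqF.
  have dI : is_derive u 1 (fun x : R => x^-1) (- u ^- 2).
    have := @is_deriveV _ id u 1 1 u0' (is_derive_id u 1).
    by rewrite [_ *: _]mulr1.
  have dq : is_derive u 1 (horner q \o (fun x : R => x^-1)) (q^`().[u^-1] * - u ^- 2).
    exact: is_derive1_comp.
  have dE : is_derive u 1 (expR \o (fun x : R => - x^-1)) (expR (- u^-1) * u ^- 2).
    apply: is_derive1_comp; apply: is_derive_eq; by rewrite opprK.
  have -> : flat (dflat q) u =
      q.[u^-1] *: (expR (- u^-1) * u ^- 2) + expR (- u^-1) *: (q^`().[u^-1] * - u ^- 2).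
    rewrite /flat u0 /dflat !hornerE exprVn /GRing.scale /=; ring.
  exact: is_deriveM.
(* At 0 the quadratic bound forces the difference quotient to 0. *)
- rewrite (flat_le0 _ (lexx 0)).
  have [C C0 hC] := flat_quadratic q.
  suff h : (fun h : R => h^-1 *: ((flat q \o shift 0) (h *: 1) - flat q 0)) @ 0^' --> (0 : R).
    by apply: DeriveDef; [apply/cvg_ex; exists 0|apply: cvg_lim].
  apply/cvgrPdist_lt => e e0; near=> z.
  have z0 : z != 0 by near: z; exact: nbhs_dnbhs_neq.
  rewrite /= addr0 [z%:A]mulr1 (flat_le0 _ (lexx 0)) subr0 sub0r normrN normrZ normfV.
  rewrite ltr_pdivrMl ?normr_gt0 //; apply: le_lt_trans (hC z) _.
  rewrite -[z ^+ 2]ger0_norm ?sqr_ge0 // normrX expr2 mulrC -mulrA ltr_pM2l ?normr_gt0 //.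
  have : `|z| < e / (C + 1).
    near: z; apply: dnbhs0_lt; by rewrite divr_gt0 // ltr_wpDl.
  rewrite ltr_pdivlMr; last by rewrite ltr_wpDl.
  by have := normr_ge0 z; nra.
Unshelve. all: by end_near. Qed.

Definition bump : R -> R := flat 1.

Lemma dflat1 : dflat 1 = 'X^2.
Proof. by rewrite /dflat -polyC1 derivC subr0 mulr1. Qed.

Lemma bump_ge0 u : 0 <= bump u.
Proof.
rewrite /bump /flat; case: ifP => // _.
by rewrite hornerE mul1r expR_ge0.
Qed.

Lemma bump_gt0 u : 0 < u -> 0 < bump u.
Proof. by rewrite /bump /flat => ->; rewrite hornerE mul1r expR_gt0. Qed.

Lemma dbump_gt0 u : 0 < u -> 0 < flat 'X^2 u.
Proof.
by rewrite /flat => u0; rewrite u0 hornerXn mulr_gt0 ?expR_gt0 ?exprn_gt0 ?invr_gt0.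
Qed.

Lemma dbump_le u : `|flat 'X^2 u| <= 2.
Proof.
rewrite /flat; case: ifP => [u0|_]; last by rewrite normr0.
have v0 : 0 <= u^-1 by rewrite invr_ge0 ltW.
rewrite hornerXn ger0_norm ?mulr_ge0 ?expR_ge0 ?exprn_ge0 //.
by have := expR_decay 2 v0.
Qed.

Lemma is_derive_bump u : is_derive u 1 bump (flat 'X^2 u).
Proof. by rewrite -dflat1; exact: is_derive_flat. Qed.

Lemma bump_lipschitz u v : `|bump u - bump v| <= 2 * `|u - v|.
Proof.
wlog vu : u v / v <= u.
  by move=> W; case/orP: (le_total u v) => /W //; rewrite distrC (distrC v).
have [|c _ ->] := @MVT_segment R bump (flat 'X^2) v u vu (fun x _ => is_derive_bump x).
  apply: continuous_subspaceT => x; apply: differentiable_continuous.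
  by apply/derivable1_diffP; case: (is_derive_bump x).
by rewrite normrM ler_wpM2r ?dbump_le.
Qed.
End FlatFunctions.

(** * Smooth functions *)

Section SmoothFunctions.
Variables (R : realType) (k : nat).
Implicit Types (phi psi : 'rV[R]_k -> R) (s : seq 'I_k).

(** Differentiability of all partial derivatives of order at most n, shaped for induction on n. *)
Fixpoint smn n phi : Prop := (forall x, differentiable phi x) /\
  if n is n'.+1 then forall i, smn n' (fun x => 'D_(delta_mx 0 i) phi x) else True.

Definition sm phi : Prop := forall n, smn n phi.

Lemma smn_diff n phi x : smn n phi -> differentiable phi x.
Proof. by case: n => [|n] []. Qed.

Lemma smnW n phi : smn n.+1 phi -> smn n phi.
Proof.
elim: n phi => [|n IH] phi [d h]; split => //.
by move=> i; apply: IH.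
Qed.

Lemma smn_cst n c : smn n (fun => c).
Proof.
elim: n c => [|n IH] c; split => // i.
by under [fun _ => _]eq_fun do rewrite derive_cst.
Qed.

Lemma smnD n phi psi : smn n phi -> smn n psi -> smn n (fun x => phi x + psi x).
Proof.
elim: n phi psi => [|n IH] phi psi; move=> [d h] [d' h'].
  by split=> // x; exact: differentiableD.
split=> [x|i]; first exact: differentiableD.
rewrite (_ : (fun _ => _) = (fun x => 'D_(delta_mx 0 i) phi x + 'D_(delta_mx 0 i) psi x)).
  exact: IH (h i) (h' i).
by apply/funext => x; rewrite deriveD //; exact: diff_derivable.
Qed.

Lemma smnM n phi psi : smn n phi -> smn n psi -> smn n (fun x => phi x * psi x).
Proof.
elim: n phi psi => [|n IH] phi psi; move=> h h'.
  by split=> // x; apply: differentiableM; apply: smn_diff; eassumption.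
split=> [x|i]; first by apply: differentiableM; apply: smn_diff; eassumption.
rewrite (_ : (fun _ => _) = (fun x => phi x * 'D_(delta_mx 0 i) psi x +
    psi x * 'D_(delta_mx 0 i) phi x)).
  have [[_ hi] [_ hi']] := (h, h').
  by apply: smnD; [apply: IH (smnW h) (hi' i)|apply: IH (smnW h') (hi i)].
apply/funext => x; rewrite deriveM //; apply: diff_derivable; apply: smn_diff; eassumption.
Qed.

Lemma derive_comp1 (F : R -> R) c phi x v :
  differentiable phi x -> is_derive (phi x) (1 : R) F c ->
  'D_v (fun x => F (phi x)) x = c * 'D_v phi x.
Proof.
move=> dx dF.
have dFx : differentiable F (phi x) by apply/derivable1_diffP; case: dF.
rewrite !deriveE //; last exact: differentiable_comp.
rewrite (diff_comp dx dFx) /=.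
set t := 'd phi x _.
have -> : t = t *: (1 : R) by rewrite /GRing.scale /= mulr1.
rewrite linearZ /= -deriveE // (@derive_val _ _ _ _ _ _ _ dF).
by rewrite /GRing.scale /= mulr1 mulrC.
Qed.

(** F m is the m-th derivative of F 0: quantifying over m keeps the chain rule inside the
    induction. *)
Lemma smn_comp n (F : nat -> R -> R) m phi :
    (forall m (u : R), is_derive u (1 : R) (F m) (F m.+1 u)) -> smn n phi ->
  smn n (fun x => F m (phi x)).
Proof.
move=> dF; elim: n m phi => [|n IH] m phi h.
  split=> // x; apply: differentiable_comp; first exact: smn_diff h.
  by apply/derivable1_diffP; case: (dF m (phi x)).
split=> [x|i].
  apply: differentiable_comp; first exact: smn_diff h.
  by apply/derivable1_diffP; case: (dF m (phi x)).
rewrite (_ : (fun _ => _) = (fun x => F m.+1 (phi x) * 'D_(delta_mx 0 i) phi x)).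
  case: (h) => _ hi; exact: smnM (IH _ _ (smnW h)) (hi i).
by apply/funext => x; apply: derive_comp1; first exact: smn_diff h.
Qed.

Lemma sm_diff phi x : sm phi -> differentiable phi x.
Proof. by move=> /(_ 0%N) /smn_diff. Qed.

Lemma sm_partial phi i : sm phi -> sm (fun x => 'D_(delta_mx 0 i) phi x).
Proof. by move=> h n; case: (h n.+1) => _; exact. Qed.

Lemma sm_sum m (F : 'I_m -> 'rV[R]_k -> R) :
  (forall j, sm (F j)) -> sm (fun x => \sum_(j < m) F j x).
Proof.
move=> h n; elim: m F h => [|m IH] F h.
  under [fun _ => _]eq_fun do rewrite big_ord0.
  exact: smn_cst.
under [fun _ => _]eq_fun do rewrite big_ord_recr /=.
apply: smnD; last exact: h.
exact: IH.
Qed.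

Lemma sm_bump phi : sm phi -> sm (fun x => bump (phi x)).
Proof.
move=> h n; apply: (@smn_comp n (fun m => flat (iter m (@dflat R) 1)) 0) => //.
by move=> m u /=; exact: is_derive_flat.
Qed.

Definition partialS phi s : 'rV[R]_k -> R :=
  foldr (fun i g x => 'D_(delta_mx 0 i) g x) phi s.

Lemma sm_partialS phi s : sm phi -> sm (partialS phi s).
Proof. by move=> h; elim: s => //= i s IH; exact: sm_partial. Qed.

Variable N : nat.
Implicit Type f : 'rV[R]_k -> 'rV[R]_N.

Lemma derive_coord f x v j : differentiable f x ->
  'D_v (fun y => f y 0 j) x = 'D_v f x 0 j.
Proof.
by move=> df; rewrite derive_mx ?mxE //; exact: diff_derivable.
Qed.

Lemma sm_coord f j : smooth f -> sm (fun x => f x 0 j).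
Proof.
move=> fs n; rewrite (_ : (fun _ => _) = (fun x => partial f [::] x 0 j)) //.
elim: n [::] => [|n IH] s.
  split=> // x; apply: (@differentiable_comp _ _ _ _ (partial f s) (fun y : 'rV_N => y 0 j)).
    exact: fs.
  exact: differentiable_coord.
split=> [x|i].
  apply: (@differentiable_comp _ _ _ _ (partial f s) (fun y : 'rV_N => y 0 j)).
    exact: fs.
  exact: differentiable_coord.
rewrite (_ : (fun _ => _) = (fun x => partial f (i :: s) x 0 j)) //.
by apply/funext => x; rewrite derive_coord.
Qed.

Lemma partial_perturb f phi w s : smooth f -> sm phi ->
  partial (fun x => f x + phi x *: w) s =
  (fun x => partial f s x + partialS phi s x *: w).
Proof.
move=> fs ps; elim: s => //= i s ->; apply/funext => x.
have d1 := sm_diff x (sm_partialS s ps).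
have d2 := differentiableZl w d1.
rewrite deriveD; [|exact: diff_derivable|exact: diff_derivable].
by congr (_ + _); rewrite !deriveE // (diffZl w d1).
Qed.

Lemma smooth_perturb f phi w : smooth f -> sm phi ->
  smooth (fun x => f x + phi x *: w).
Proof.
move=> fs ps s x; rewrite partial_perturb //; apply: differentiableD => //.
apply: differentiableZl.
exact/sm_diff/sm_partialS.
Qed.
End SmoothFunctions.

(** * Perturbations of embeddings *)

Section Embeddings.
Variables (R : realType) (k N : nat).
Implicit Types (f g : 'rV[R]_k -> 'rV[R]_N) (phi : 'rV[R]_k -> R).

Lemma coord_norm_le n (v : 'rV[R]_n) i : `|v 0 i| <= `|v|.
Proof.
rewrite [leRHS]/Num.norm /= mx_normrE.
by have := @le_bigmax _ _ _ (0 : R) (fun ij : 'I_1 * 'I_n => `|v ij.1 ij.2|) (0, i).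
Qed.

(** With its converse [homeo_of_local], this trades continuity of the inverse for a metric condition
    that survives a comparison of distances. *)
Lemma homeo_local f : homeo_onto_image f -> forall x e, 0 < e ->
  exists2 d, 0 < d & forall y, `|f x - f y| < d -> `|x - y| < e.
Proof.
move=> [cf [F fK]] /subspace_continuousP cF x e e0.
have Rx : range f (f x) by exists x.
have : F y @[y --> within (range f) (nbhs (f x))] --> x.
  by rewrite -[X in _ --> X]fK; exact: (cF _ Rx).
move=> /cvgrPdist_lt /(_ e e0).
rewrite /prop_near1 /within /= => /nbhs_ballP [d d0 h].
exists d => // y xy; have := h (f y).
by rewrite mx_norm_ball /ball_ /= fK; apply=> //; exists y.
Qed.

Lemma homeo_of_local g : continuous g ->
  (forall x e, 0 < e -> exists2 d, 0 < d & forall y, `|g x - g y| < d -> `|x - y| < e) ->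
  homeo_onto_image g.
Proof.
move=> cg h; split => //.
have gi : injective g.
  move=> x y xy; apply/eqP; rewrite -subr_eq0 -normr_le0 leNgt; apply/negP => xy0.
  have [d d0 /(_ y)] := h x _ xy0.
  by rewrite xy subrr normr0 ltxx => /(_ d0).
have [y|G hG] := @choice _ _ (fun y x => (exists x', g x' = y) -> g x = y).
  have [[x <-]|n] := pselect (exists x, g x = y); first by exists x.
  by exists 0 => e; case: n.
have gK : cancel g G by move=> x; apply/gi/hG; exists x.
exists G => //; apply/subspace_continuousP => _ [x _ <-].
suff : G y @[y --> within (range g) (nbhs (g x))] --> G (g x) by [].
rewrite gK; apply/cvgrPdist_lt => e e0; have [d d0 hd] := h x e e0.
rewrite /prop_near1 /within /=; apply/nbhs_ballP; exists d => //= y.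
rewrite mx_norm_ball /ball_ /= => xy [z _ zy]; move: xy; rewrite -zy gK.
exact: hd.
Qed.

Lemma homeo_inj f : homeo_onto_image f -> injective f.
Proof. by move=> [_ [F fK] _]; exact: can_inj fK. Qed.

Lemma smooth_diff f x : smooth f -> differentiable f x.
Proof. by move=> /(_ [::] x). Qed.

Lemma open_far (x0 : 'rV[R]_k) (e : R) : open [set x | e < `|x - x0|].
Proof.
have := @open_comp _ _ (fun x : 'rV[R]_k => `|x - x0|) [set y | e < y] _ (@open_gt R e).
apply=> y _; apply: (@cvg_norm _ _ _ (nbhs y)).
by apply: (@cvgB _ _ _ (nbhs y)); [exact: cvg_id|exact: cvg_cst].
Qed.

Lemma partialS_vanish phi s (P : set 'rV[R]_k) : open P ->
  (forall x, P x -> phi x = 0) -> forall x, P x -> partialS phi s x = 0.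
Proof.
move=> oP h; elim: s => [|i s IH] x Px /=; first exact: h.
rewrite -(derive_cst (0 : R) x (delta_mx 0 i)); apply: near_eq_derive.
have : nbhs x P by apply: open_nbhs_nbhs.
by apply: filterS => y /IH.
Qed.

Definition short_seqs : seq (seq 'I_k) :=
  [::] :: [seq [:: i] | i <- enum 'I_k] ++ [seq [:: i; j] | i <- enum 'I_k, j <- enum 'I_k].

Lemma short_seqsP s : (size s <= 2)%N -> s \in short_seqs.
Proof.
rewrite inE mem_cat; case: s => [|i [|j []]] // _; apply/orP; right; apply/orP.
  by left; apply/mapP; exists i; rewrite ?mem_enum.
by right; apply/allpairsP; exists (i, j); rewrite !mem_enum.
Qed.

(** If C |w| <= 1/2, the perturbed map g satisfies |f x - f y| <= 2 |g x - g y|, so the metric form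
    of the embedding property passes from f to g; the bound on differentials does the same for
    immersion. Bounded support handles closeness. *)
Lemma smooth_embedding_perturb f phi (eps : 'rV[R]_k -> R) (x0 : 'rV[R]_k) (r C : R) :
  smooth_embedding f -> continuous eps -> (forall x, 0 < eps x) -> sm phi ->
  (forall x, r < `|x - x0| -> phi x = 0) ->
  (forall x y, `|phi x - phi y| <= C * `|f x - f y|) ->
  (forall x v, `|'d phi x v| <= C * `|'d f x v|) ->
  exists2 d, 0 < d & forall w, `|w| < d ->
    smooth_embedding (fun x => f x + phi x *: w) /\
    C2_close eps f (fun x => f x + phi x *: w).
Proof.
move=> [fs fi fh] ce e0 ps supp lip dlip.
(* The partial derivatives of phi relative to [eps], bounded because they vanish outside a compact
   ball. *)
pose F x := (\sum_(s <- short_seqs) `|partialS phi s x|) / eps x.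
have F0 x : 0 <= F x by rewrite divr_ge0 ?sumr_ge0 // ltW.
have Fc : continuous F.
  move=> x; apply: (@cvgM _ _ (nbhs x)); last by apply: (@cvgV _ _ (nbhs x)); [rewrite gt_eqF|exact: ce].
  suff : continuous (fun x => \sum_(s <- short_seqs) `|partialS phi s x|). by apply.
  apply: continuous_big => [|s _ y]; first exact: add_continuous.
  apply: (@cvg_norm _ _ _ (nbhs y)); apply: differentiable_continuous.
  exact/sm_diff/sm_partialS.
have [M M0 hM] : exists2 M, 0 <= M & forall x, F x <= M.
  have z x : r < `|x - x0| -> F x = 0.
    move=> xr; rewrite /F big1 ?mul0r // => s _.
    rewrite (@partialS_vanish _ _ [set y | r < `|y - x0|]) ?normr0 //.
    exact: open_far.
  pose K := [set x : 'rV[R]_k | `|x - x0| <= r].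
  have [r0|r0] := ltP r 0.
    by exists 0 => // x; rewrite z // (lt_le_trans r0).
  have Kc : compact K.
    apply: bounded_closed_compact.
      exists (r + `|x0|); split; first exact: num_real.
      move=> t rt x /= xK; apply: le_trans (ltW rt).
      by rewrite -[x in `|x|](subrK x0) (le_trans (ler_normD _ _)) // lerD.
    rewrite (_ : K = ~` [set x | r < `|x - x0|]); first exact/open_closedC/open_far.
    by apply/seteqP; split=> x /=; rewrite /K /= leNgt => /negP.
  have [||c _ hc] := @EVT_max_rV _ _ F K _ Kc.
  - by exists x0; rewrite /K /= subrr normr0.
  - exact: continuous_subspaceT.
  exists (F c) => // x; have [xr|xr] := leP `|x - x0| r; last by rewrite z.
  by apply: hc; rewrite inE.
have C1 : 0 < `|C| + M + 1 by rewrite ltr_wpDl ?addr_ge0.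
(* Small enough for both C |w| <= 1/2 and M |w| < 1. *)
exists ((`|C| + M + 1) * 2)^-1; first by rewrite invr_gt0 mulr_gt0.
set D := _ + 1 in C1 *.
move=> w hw'; have {hw'}hw : D * `|w| < 2^-1.
  by rewrite -ltr_pdivlMl // -invfM.
have wC : C * `|w| <= 2^-1.
  apply: le_trans (ltW hw); apply: ler_wpM2r => //.
  by apply: le_trans (ler_norm C) _; rewrite /D -addrA lerDl addr_ge0.
have wM : M * `|w| < 1.
  apply: le_lt_trans (lt_trans hw _); last by rewrite invf_lt1 ?ltr1n.
  apply: ler_wpM2r => //; by rewrite /D addrAC addrC lerDl addr_ge0.
have gs := smooth_perturb w fs ps.
have lipg x y : `|f x - f y| <= 2 * `|f x + phi x *: w - (f y + phi y *: w)|.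
  have -> : f x + phi x *: w - (f y + phi y *: w) = f x - f y - (phi y - phi x) *: w.
    by apply/rowP => j; rewrite !mxE; ring.
  have := lerB_dist (f x - f y) ((phi y - phi x) *: w).
  rewrite normrZ (distrC (phi y)) => h1.
  have h2 : `|phi x - phi y| * `|w| <= C * `|f x - f y| * `|w| by apply: ler_wpM2r.
  have h3 := ler_wpM2r (normr_ge0 (f x - f y)) wC.
  rewrite mulrAC in h2; lra.
have gi : immersion (fun x => f x + phi x *: w).
  move=> x a b ab; apply/eqP; rewrite -subr_eq0; apply/eqP; set v := a - b.
  have d1 := smooth_diff x fs; have d2 := sm_diff x ps.
  have e : 'd f x v + 'd phi x v *: w = 0.
    have d3 := differentiableZl w d2.
    transitivity ('D_v (fun x => f x + phi x *: w) x).
      rewrite deriveD; [|exact: diff_derivable|exact: diff_derivable].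
      by congr (_ + _); rewrite !deriveE // (diffZl w d2).
    rewrite deriveE; last exact: smooth_diff gs.
    by rewrite /v; move: ab; set L := 'd _ x => ab; rewrite linearB ab subrr.
  have {}e : 'd f x v = - ('d phi x v *: w) by apply/eqP; rewrite -addr_eq0 e.
  have h : `|'d f x v| <= 2^-1 * `|'d f x v|.
    rewrite {1}e normrN normrZ; apply: le_trans (_ : C * `|'d f x v| * `|w| <= _).
      exact: ler_wpM2r.
    by rewrite mulrAC ler_wpM2r.
  apply: (fi x); rewrite raddf0; apply/eqP; rewrite -normr_le0.
  by move: h; lra.
split.
  split=> //; apply: homeo_of_local => [x|x e e0'].
    exact/differentiable_continuous/smooth_diff.
  have [d d0 hd] := homeo_local fh x e0'.
  exists (d / 2); first by rewrite divr_gt0.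
  move=> y xy; apply: hd; apply: le_lt_trans (lipg x y) _.
  by rewrite -ltr_pdivlMl // mulrC.
move=> s /short_seqsP ss x; rewrite partial_perturb // addrAC subrr add0r normrZ.
have h1 : `|partialS phi s x| <= F x * eps x.
  rewrite /F divfK ?gt_eqF // (perm_big _ (perm_to_rem ss)) big_cons lerDl.
  exact: sumr_ge0.
have h2 : F x * eps x <= M * eps x by rewrite ler_wpM2r // ltW.
apply: le_lt_trans (_ : M * eps x * `|w| < _).
  by apply: ler_wpM2r => //; exact: le_trans h2.
by rewrite mulrAC gtr_pMl.
Qed.
End Embeddings.

(** * Bumps composed with the embedding *)

Section BallBump.
Variables (R : realType) (k N : nat) (f : 'rV[R]_k -> 'rV[R]_N) (y : 'rV[R]_N) (rho : R).
Hypotheses (fs : smooth f) (rho0 : 0 < rho).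

(** The Euclidean square, since the norm of row vectors, a maximum, is not smooth. *)
Definition sqdist (z : 'rV[R]_N) : R := \sum_j (z 0 j - y 0 j) ^+ 2.

(** Depending on x through f(x) only, it is Lipschitz relative to f on all of R^k. *)
Definition ball_bump x : R := bump (rho ^+ 2 - sqdist (f x)).

Lemma sm_sqdist : sm (fun x => rho ^+ 2 - sqdist (f x)).
Proof.
rewrite /sqdist (_ : (fun _ => _) = (fun x => rho ^+ 2 + (-1) * \sum_j
  ((f x 0 j + - y 0 j) * (f x 0 j + - y 0 j)))); last first.
  by apply/funext => x; rewrite mulN1r.
move=> n; apply: smnD; first exact: smn_cst.
apply: smnM; first exact: smn_cst.
apply: sm_sum => j {}n; apply: smnM; (apply: smnD; [exact: sm_coord|exact: smn_cst]).
Qed.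

Lemma sm_ball_bump : sm ball_bump.
Proof. exact: sm_bump sm_sqdist. Qed.

Lemma sqdist_coord z j : sqdist z <= rho ^+ 2 -> `|z 0 j - y 0 j| <= rho.
Proof.
move=> h; rewrite -(ger0_norm (ltW rho0)) -ler_sqr ?nnegrE // !real_normK ?num_real //.
apply: le_trans h; rewrite /sqdist (bigD1 j) //= lerDl.
by apply: sumr_ge0 => i _; exact: sqr_ge0.
Qed.

Lemma ball_bump_supp x : rho < `|f x - y| -> ball_bump x = 0.
Proof.
move=> h; rewrite /ball_bump /bump flat_le0 // subr_le0 leNgt; apply/negP => /ltW s.
move: h; rewrite ltNge => /negP; apply.
rewrite /Num.norm /= mx_normrE; apply/bigmax_leP; split; first exact: ltW.
by move=> [i j] _ /=; rewrite !mxE (ord1 i); exact: sqdist_coord.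
Qed.

Lemma d_ball_bump x v : 'd ball_bump x v =
  flat 'X^2 (rho ^+ 2 - sqdist (f x)) *
  - (2 * \sum_j (f x 0 j - y 0 j) * 'd f x v 0 j).
Proof.
rewrite -deriveE; last exact/sm_diff/sm_ball_bump.
have dj j : is_derive x v (fun x => f x 0 j - y 0 j) ('d f x v 0 j).
  rewrite -[X in is_derive _ _ _ X]subr0.
  apply: is_deriveB; apply: DeriveDef; first exact/diff_derivable/sm_diff/sm_coord.
  by rewrite derive_coord ?deriveE //; exact: smooth_diff.
rewrite (derive_comp1 _ (sm_diff _ sm_sqdist) (is_derive_bump _)); congr (_ * _).
have -> : (fun x => rho ^+ 2 - sqdist (f x)) = cst (rho ^+ 2) -
  \sum_j ((fun x => f x 0 j - y 0 j) * (fun x => f x 0 j - y 0 j)).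
  by apply/funext => z; rewrite !fctE fct_sumE.
have ds := is_deriveB (is_derive_cst (rho ^+ 2) x v)
  (is_derive_sum (fun j => is_deriveM (dj j) (dj j))).
rewrite (@derive_val _ _ _ _ _ _ _ ds) sub0r mulr_sumr; congr (- _).
by apply: eq_bigr => j _; rewrite /GRing.scale /=; ring.
Qed.

Lemma bump_le (u : R) : bump u <= 2 * Num.max u 0.
Proof.
have [u0|u0] := leP u 0; first by rewrite /bump flat_le0 // mulr0.
have := bump_lipschitz u 0; rewrite {2}/bump (flat_le0 _ (lexx 0)) !subr0.
by rewrite !ger0_norm ?bump_ge0 // ltW.
Qed.

(** The first summand is for distances up to 1: Lipschitz constant 2, N coordinates, each factor at
    most 2 rho + 1. The second is for larger distances, as the bump is at most 2 rho^2. *)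
Let C := 2 * N%:R * (2 * rho + 1) + 2 * rho ^+ 2.

Lemma ball_bump_lipschitz x x' :
  `|ball_bump x - ball_bump x'| <= C * `|f x - f x'|.
Proof.
set dl := `|f x - f x'|.
have dl0 : 0 <= dl by exact: normr_ge0.
have N0 : 0 <= N%:R :> R by exact: ler0n.
have b z : 0 <= ball_bump z <= 2 * rho ^+ 2.
  rewrite bump_ge0 (le_trans (bump_le _)) // ler_wpM2l // ge_max sqr_ge0 andbT.
  by rewrite lerBlDr lerDl sumr_ge0 // => j _; exact: sqr_ge0.
have r2 := sqr_ge0 rho.
have [d1|d1] := leP dl 1; last first.
  have /andP[b0 b1] := b x; have /andP[b0' b1'] := b x'.
  have : `|ball_bump x - ball_bump x'| <= 2 * rho ^+ 2 by rewrite ler_norml; lra.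
  move/le_trans; apply.
  apply: le_trans (_ : 2 * rho ^+ 2 * dl <= _); first by rewrite ler_peMr ?mulr_ge0 // ltW.
  by apply: ler_wpM2r => //; rewrite /C lerDr !mulr_ge0 // addr_ge0 // mulr_ge0 // ltW.
suff W a a' : `|f a - f a'| = dl -> sqdist (f a) < rho ^+ 2 ->
    `|ball_bump a - ball_bump a'| <= C * dl.
  have [s|s] := ltP (sqdist (f x)) (rho ^+ 2); first exact: W.
  have [s'|s'] := ltP (sqdist (f x')) (rho ^+ 2).
    by rewrite distrC; apply: W; rewrite // distrC.
  have z a : rho ^+ 2 <= sqdist (f a) -> ball_bump a = 0.
    by move=> h; rewrite /ball_bump /bump flat_le0 // subr_le0.
  rewrite !z // subrr normr0 !mulr_ge0 // /C.
  by rewrite !(addr_ge0, mulr_ge0) // ltW.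
move=> ad as_; apply: le_trans (bump_lipschitz _ _) _.
have -> : rho ^+ 2 - sqdist (f a) - (rho ^+ 2 - sqdist (f a')) =
  \sum_j (f a' 0 j - f a 0 j) * ((f a' 0 j - f a 0 j) + 2 * (f a 0 j - y 0 j)).
  rewrite opprB addrC addrA subrK /sqdist -sumrB.
  by apply: eq_bigr => j _; ring.
rewrite (le_trans (ler_wpM2l _ (ler_norm_sum _ _ _))) //.
apply: le_trans (_ : 2 * (\sum_(j < N) dl * (2 * rho + 1)) <= _).
  rewrite ler_wpM2l //; apply: ler_sum => j _; rewrite normrM.
  have h1 : `|f a' 0 j - f a 0 j| <= dl.
    by have := coord_norm_le (f a' - f a) j; rewrite !mxE -normrN opprB -ad (distrC (f a)).
  apply: ler_pM => //; rewrite (le_trans (ler_normD _ _)) // addrC normrM ger0_norm //.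
  apply: lerD; last exact: le_trans h1 d1.
  by rewrite ler_wpM2l // sqdist_coord // ltW.
rewrite sumr_const card_ord -mulr_natl /C.
have : 0 <= rho ^+ 2 * dl by rewrite mulr_ge0.
by move=> *; lra.
Qed.

Lemma d_ball_bump_lipschitz x v : `|'d ball_bump x v| <= 4 * N%:R * rho * `|'d f x v|.
Proof.
have n0 := normr_ge0 ('d f x v).
have [s|s] := ltP (sqdist (f x)) (rho ^+ 2); last first.
  rewrite d_ball_bump flat_le0 ?subr_le0 // mul0r normr0.
  by rewrite !mulr_ge0 // ltW.
rewrite d_ball_bump normrM normrN normrM (ger0_norm (_ : 0 <= 2)) //.
apply: le_trans (_ : 2 * (2 * \sum_(j < N) (rho * `|'d f x v|)) <= _).
  apply: ler_pM; rewrite ?mulr_ge0 ?dbump_le //.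
  rewrite ler_wpM2l // (le_trans (ler_norm_sum _ _ _)) //; apply: ler_sum => j _.
  rewrite normrM; apply: ler_pM => //; last exact: coord_norm_le.
  by apply/sqdist_coord/ltW.
rewrite sumr_const card_ord -mulr_natl.
have : 0 <= N%:R * (rho * `|'d f x v|) by rewrite !mulr_ge0 // ltW.
lra.
Qed.
End BallBump.

(** * Independence of jets *)

Section SymmetricDifferences.
Variables (R : realType) (k r : nat) (p u : 'I_r -> 'rV[R]_k) (al ga be : 'I_r -> R).

(** The weights be / t produce derivatives in the limit, al and ga the values. *)
Definition symdiff (V : normedModType R) (psi : 'rV[R]_k -> V) (t : R) : V :=
  \sum_i ((al i + be i / t) *: psi (p i + t *: u i) -
          (ga i + be i / t) *: psi (p i - t *: u i)).

Lemma cvg_line x v (F := (0 : R)^'+) : x + t *: v @[t --> F] --> (x : 'rV[R]_k).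
Proof.
apply: cvg_at_right_filter.
suff : x + t *: v @[t --> (0 : R)] --> (x + 0 *: v : 'rV[R]_k) by rewrite scale0r addr0.
apply: (@cvgD _ _ _ (nbhs (0 : R))); first exact: cvg_cst.
by apply: (@cvgZ _ _ _ (nbhs (0 : R))); [exact: cvg_id|exact: cvg_cst].
Qed.

Lemma cvg_quotient (V : normedModType R) (psi : 'rV[R]_k -> V) x v :
  differentiable psi x ->
  t^-1 *: (psi (x + t *: v) - psi x) @[t --> (0 : R)^'+] --> 'd psi x v.
Proof.
move=> d; rewrite -deriveE //; have := diff_derivable (v := v) d.
move=> /cvg_dnbhs_at_right h.
have -> : (fun t : R => t^-1 *: (psi (x + t *: v) - psi x)) =
    (fun h : R => h^-1 *: ((psi \o shift x) (h *: v) - psi x)).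
  by apply/funext => t /=; rewrite (addrC x).
exact: h.
Qed.

Lemma cvg_symdiff (V : normedModType R) (psi : 'rV[R]_k -> V) :
  (forall i, differentiable psi (p i)) ->
  symdiff psi t @[t --> (0 : R)^'+] -->
  \sum_i ((al i - ga i) *: psi (p i) + (2 * be i) *: 'd psi (p i) (u i)).
Proof.
move=> d; apply: cvg_big => [|i _]; first exact: add_continuous.
pose q t v := t^-1 *: (psi (p i + t *: v) - psi (p i)).
have -> : (fun t : R => (al i + be i / t) *: psi (p i + t *: u i) -
          (ga i + be i / t) *: psi (p i - t *: u i)) =
  (fun t : R => al i *: psi (p i + t *: u i) - ga i *: psi (p i + t *: - u i) +
     be i *: (q t (u i) - q t (- u i))).
  apply/funext => t; rewrite /q scalerN -scalerBr.
  set P := psi (_ + _); set Q := psi (_ - _); set S := psi _.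
  have -> : P - S - (Q - S) = P - Q by rewrite opprB addrA subrK.
  by rewrite scalerA scalerBr !scalerDl opprD addrACA.
have c v : psi (p i + t *: v) @[t --> (0 : R)^'+] --> psi (p i).
  exact: (cvg_comp _ _ (@cvg_line (p i) v) (differentiable_continuous (d i))).
have -> : (al i - ga i) *: psi (p i) + (2 * be i) *: 'd psi (p i) (u i) =
  al i *: psi (p i) - ga i *: psi (p i) + be i *: ('d psi (p i) (u i) - 'd psi (p i) (- u i)).
  by rewrite scalerBl linearN opprK scalerDr -scalerDl mulr_natl mulr2n.
apply: cvgD; first by apply: cvgB; apply: cvgZr; exact: c.
by apply: cvgZr; apply: cvgB; exact: cvg_quotient.
Qed.
End SymmetricDifferences.

(** * Bumps that detect a jet *)

Section StableJets.
Variables (R : realType) (k N : nat).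
Implicit Type f : 'rV[R]_k -> 'rV[R]_N.

(** If a is nonzero, centre the bump at f(x0): positive value, zero derivative. If a = 0, move the
    centre along a coordinate where df(x0) v is nonzero; such a coordinate exists by immersion. *)
Lemma bump_at f (x0 v : 'rV[R]_k) (a e : R) : smooth_embedding f -> 0 < e ->
  a != 0 \/ v != 0 ->
  exists phi : 'rV[R]_k -> R, [/\ sm phi, forall x, e < `|x - x0| -> phi x = 0,
    exists C, (forall x y, `|phi x - phi y| <= C * `|f x - f y|) /\
              (forall x w, `|'d phi x w| <= C * `|'d f x w|)
    & a * phi x0 + 'd phi x0 v != 0].
Proof.
move=> [fs fi fh] e0 av; have [d d0 hd] := homeo_local fh x0 e0.
pose rho := d / 2; have rho0 : 0 < rho by rewrite divr_gt0.
suff [dl [dl1 dl2 h]] : exists dl : 'rV[R]_N, [/\ `|dl| < rho, \sum_j dl 0 j ^+ 2 < rho ^+ 2 &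
    a * bump (rho ^+ 2 - \sum_j dl 0 j ^+ 2) +
    flat 'X^2 (rho ^+ 2 - \sum_j dl 0 j ^+ 2) * (2 * \sum_j dl 0 j * 'd f x0 v 0 j) != 0].
  have ps := sm_ball_bump (f x0 + dl) rho fs.
  exists (ball_bump f (f x0 + dl) rho); split=> //.
  - move=> x xe; apply: ball_bump_supp => //; rewrite ltNge; apply/negP => h1.
    move: xe; rewrite ltNge => /negP; apply; rewrite distrC; apply/ltW/hd.
    rewrite distrC (_ : f x - f x0 = (f x - (f x0 + dl)) + dl); last by rewrite opprD addrA subrK.
    rewrite (le_lt_trans (ler_normD _ _)) // [ltRHS]splitr.
    by rewrite ler_ltD // .
  - pose C1 := 2 * N%:R * (2 * rho + 1) + 2 * rho ^+ 2; pose C2 := 4 * N%:R * rho.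
    exists (C1 + C2); have [p1 p2] : 0 <= C1 /\ 0 <= C2.
      by rewrite /C1 /C2 !(mulr_ge0, addr_ge0) ?sqr_ge0 // ltW.
    split=> [x y|x w].
      apply: le_trans (ball_bump_lipschitz f (f x0 + dl) rho0 x y) _.
      by rewrite ler_wpM2r // lerDl.
    by apply: le_trans (d_ball_bump_lipschitz _ fs rho0 x w) _; rewrite ler_wpM2r // lerDr.
  - rewrite d_ball_bump // /ball_bump.
    have -> : sqdist (f x0 + dl) (f x0) = \sum_j dl 0 j ^+ 2.
      by rewrite /sqdist; apply: eq_bigr => j _; rewrite !mxE opprD addNKr sqrrN.
    have -> : \sum_j (f x0 0 j - (f x0 + dl) 0 j) * 'd f x0 v 0 j =
        - \sum_j dl 0 j * 'd f x0 v 0 j.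
      by rewrite -sumrN; apply: eq_bigr => j _; rewrite !mxE opprD addNKr mulNr.
    by rewrite [2 * _]mulrN opprK.
have r2 : 0 < rho ^+ 2 by rewrite exprn_gt0.
have [a0|a0] := eqVneq a 0; last first.
  exists 0; rewrite normr0; split=> //.
    by rewrite big1 // => j _; rewrite mxE expr0n.
  rewrite !big1; [|by move=> j _; rewrite mxE ?mul0r ?expr0n..].
  by rewrite mulr0 mulr0 addr0 mulf_neq0 // subr0 gt_eqF // bump_gt0.
have v0 : v != 0 by case: av => //; rewrite a0 eqxx.
have m0 : 'd f x0 v != 0.
  by apply: contra v0 => /eqP m0; apply/eqP/(fi x0); rewrite m0 linear0.
have [j mj] : exists j, 'd f x0 v 0 j != 0.
  apply/existsP; rewrite -negb_forall; apply: contra m0 => /forallP h.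
  by apply/eqP/rowP => j; rewrite mxE; apply/eqP.
have r12 : 0 < rho / 2 by rewrite divr_gt0.
have s2 : \sum_i ((rho / 2) *: delta_mx 0 j : 'rV[R]_N) 0 i ^+ 2 = (rho / 2) ^+ 2.
  rewrite (bigD1 j) //= big1 ?addr0 => [|i ij]; first by rewrite !mxE !eqxx mulr1.
  by rewrite !mxE eqxx (negPf ij) mulr0 expr0n.
exists ((rho / 2) *: delta_mx 0 j); rewrite s2.
have s3 : (rho / 2) ^+ 2 < rho ^+ 2 by rewrite ltr_sqr ?nnegrE ?ltW //; lra.
split=> //.
- rewrite normrZ gtr0_norm //; apply: (@le_lt_trans _ _ (rho / 2 * 1)); last by lra.
  apply: ler_wpM2l; first exact: ltW.
  rewrite /Num.norm /= mx_normrE; apply/bigmax_leP; split=> // i _.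
  by rewrite mxE; case: (_ && _); rewrite ?normr1 ?normr0.
- rewrite a0 mul0r add0r mulf_neq0 //; first by rewrite gt_eqF // dbump_gt0 // subr_gt0.
  rewrite mulf_neq0 ?pnatr_eq0 // (bigD1 j) //= big1 ?addr0 => [|i ij].
    by rewrite !mxE !eqxx mulr1 mulf_neq0 // gt_eqF.
  by rewrite !mxE eqxx (negPf ij) mulr0 mul0r.
Qed.
End StableJets.

(** * Independence of r jets *)

Section StableIndependence.
Variables (R : realType) (k N r : nat).
Variable f : 'rV[R]_k -> 'rV[R]_N.

Lemma near_coef_gt0 (ga be : R) : 0 < be -> \forall t \near (0 : R)^'+, 0 < ga + be / t.
Proof.
move=> be0; near=> t.
have t0 : 0 < t by near: t; exact: nbhs_right_gt.
have g1 : 0 < `|ga| + 1 by rewrite ltr_wpDl.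
have : t < be / (`|ga| + 1) by near: t; apply: nbhs_right_lt; rewrite divr_gt0.
rewrite ltr_pdivlMr // => h.
rewrite -(pmulr_lgt0 _ t0) mulrDl divfK ?gt_eqF //.
have := ler_norm (- ga); rewrite normrN; nra.
Unshelve. all: by end_near. Qed.

Lemma near_neq (x y v w : 'rV[R]_k) : x != y ->
  \forall t \near (0 : R)^'+, x + t *: v != y + t *: w.
Proof.
move=> xy; have FF : Filter ((0 : R)^'+) by exact: _.
have h := cvgB (@cvg_line _ _ x v) (@cvg_line _ _ y w).
rewrite -subr_eq0 in xy; have h' := cvgr_neq0 _ (h FF) xy.
by near=> t; rewrite -subr_eq0; near: t; exact: h'.
Unshelve. all: by end_near. Qed.

Lemma stable_independence (p : 'I_r -> 'rV[R]_k) (a : 'I_r -> R) (v : 'I_r -> 'rV[R]_k) :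
  (0 < k)%N -> stably_neighborly r f -> injective p -> \sum_i a i = 0 ->
  \sum_i (a i *: f (p i) + 'd f (p i) (v i)) = 0 ->
  forall i, a i = 0 /\ v i = 0.
Proof.
move=> k0 [fe fn [eps [ce e0 H]]] pI sa sf.
apply: contrapT => /existsNP [i0 i0P].
have av0 : a i0 != 0 \/ v i0 != 0.
  have [az|] := eqVneq (a i0) 0; last by left.
  by right; apply/eqP => vz; apply: i0P.
(* Separates p i0 from the other points, so that the bump contributes to the limit at i0 only. *)
have [e ee pe] : exists2 e : R, 0 < e & forall j, j != i0 -> e < `|p j - p i0|.
  near ((0 : R)^'+) => e; exists e; first by near: e; exact: nbhs_right_gt.
  near: e; apply: filter_forall => j; have [->|ji] := eqVneq j i0; first by near=> e.
  near=> e => _; near: e; apply: nbhs_right_lt; rewrite normr_gt0 subr_eq0.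
  by apply: contra ji => /eqP /pI ->.
have [phi [ps supp [C [lip dlip]] nz]] := bump_at (p i0) fe ee av0.
have [fs fi fh] := fe.
have [d d0 hd] := smooth_embedding_perturb fe ce e0 ps supp lip dlip.
(* Where v i = 0 any nonzero direction serves, with bounded coefficients. *)
pose u i : 'rV[R]_k := if v i == 0 then const_mx 1 else v i.
pose be i : R := if v i == 0 then 0 else 2^-1.
pose al i : R := if v i == 0 then Num.max (a i) 0 else a i / 2.
pose ga i : R := if v i == 0 then Num.max (- a i) 0 else - a i / 2.
have alga i : al i - ga i = a i.
  rewrite /al /ga; case: ifP => _; last by lra.
  by have [?|?] := leP (a i) 0; have [?|?] := leP (- a i) 0; lra.
have bu (V : normedModType R) (psi : 'rV[R]_k -> V) i :
    (2 * be i) *: 'd psi (p i) (u i) = 'd psi (p i) (v i).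
  rewrite /be /u; case: eqP => [->|_]; first by rewrite mulr0 scale0r linear0.
  by rewrite divff ?scale1r.
have u0 i : u i != 0.
  rewrite /u; case: ifP => [_|->//]; apply/eqP => /rowP /(_ (Ordinal k0)).
  by rewrite !mxE => /eqP; rewrite oner_eq0.
have lim (V : normedModType R) (psi : 'rV[R]_k -> V) :
    (forall i, differentiable psi (p i)) ->
    symdiff p u al ga be psi t @[t --> (0 : R)^'+] -->
    \sum_i (a i *: psi (p i) + 'd psi (p i) (v i)).
  move=> dd; have := @cvg_symdiff R k r p u al ga be V psi dd.
  by under eq_bigr do rewrite alga bu.
have := lim _ f (fun i => smooth_diff (p i) fs); rewrite sf => limf.
have := lim _ phi (fun i => sm_diff (p i) ps).
rewrite (bigD1 i0) //= big1 ?addr0 => [limp|j ji]; last first.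
  rewrite supp ?pe // scaler0 add0r -deriveE; last exact: sm_diff.
  rewrite -(derive_cst (0 : R) (p j) (v j)); apply: near_eq_derive.
  near=> x; rewrite supp //; near: x.
  by apply: open_nbhs_nbhs; split; [exact: open_far|exact: pe].
pose Df := symdiff p u al ga be f; pose Dp := symdiff p u al ga be phi.
(* Solves Df + Dp w = 0; it is small because Df tends to 0 while Dp has a nonzero limit. *)
pose w t := - (Dp t)^-1 *: Df t.
have limw : w t @[t --> (0 : R)^'+] --> (0 : 'rV[R]_N).
  rewrite -[X in _ --> X](scaler0 _ (- (a i0 * phi (p i0) + 'd phi (p i0) (v i0))^-1)).
  by apply: cvgZ => //; apply: cvgN; apply: cvgV.
(* Some coefficient B_i is positive: otherwise every v i is 0 and every a i is nonnegative, and they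
   sum to 0. *)
have [i1 i1P] : exists i, 0 < be i \/ be i = 0 /\ 0 < ga i.
  apply: contrapT => /forallNP hn.
  have vz i : v i = 0.
    have [//|/negPf vi] := eqVneq (v i) 0; case: (hn i); left.
    by rewrite /be vi invr_gt0.
  have ai i : 0 <= a i.
    rewrite leNgt; apply/negP => ai; apply: (hn i); right.
    by rewrite /be /ga vz eqxx lt_max oppr_gt0 ai.
  apply: i0P; split => //.
  exact: (psumr_eq0P (fun i _ => ai i) sa (i := i0) isT).
near ((0 : R)^'+) => t.
have t0 : 0 < t by near: t; exact: nbhs_right_gt.
have Dp0 : Dp t != 0 by near: t; exact: cvgr_neq0 limp nz.
have wd : `|w t| < d by near: t; exact: cvgr0_norm_lt limw _ d0.
have ypos i : 0 <= ga i + be i / t.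
  move: i; near: t; apply: filter_forall => i.
  rewrite /ga /be; case: ifP => _; last first.
    by near=> s; apply: ltW; near: s; apply: near_coef_gt0; rewrite invr_gt0.
  by near=> s; rewrite mul0r addr0 le_max lexx orbT.
have ypos1 : 0 < ga i1 + be i1 / t.
  near: t; case: i1P => [|[-> g0]]; first exact: near_coef_gt0.
  by near=> s; rewrite mul0r addr0.
have yI : injective (fun i => p i + t *: u i).
  move=> i j; have [//|ij] := eqVneq i j; move/eqP; apply: contraTeq => _.
  move: ij; move: i j.
  near: t; apply: filter_forall => i; apply: filter_forall => j.
  have [<-|ij] := eqVneq i j; first by near=> s.
  have ijp : p i != p j by apply: contra ij => /eqP /pI ->.
  by near=> s => _; near: s; exact: near_neq.
(* The reflected point avoids the prescribed contact points; for j = i1 this rests on u i1 being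
   nonzero. *)
have zy j : p i1 - t *: u i1 != p j + t *: u j.
  move: j; near: t; apply: filter_forall => j.
  have [<-|ij] := eqVneq i1 j; last first.
    have ijp : p i1 != p j by apply: contra ij => /eqP /pI ->.
    by near=> s; rewrite -scalerN; near: s; exact: near_neq.
  near=> s; have s0 : 0 < s by near: s; exact: nbhs_right_gt.
  rewrite (inj_eq (addrI _)) eq_sym -addr_eq0 -scalerDl scaler_eq0.
  by rewrite negb_or u0 andbT gt_eqF // addr_gt0.
have [ge gC] := hd _ wd.
set g := fun x => _ in ge gC.
have gn := H g ge gC.
have [n [c [n0 sup eqH]]] := gn _ yI.
have [_ _ /homeo_inj gI] := ge.
pose l x := (g x *m n) 0 0 - c.
have ly i : l (p i + t *: u i) = 0.
  have : (g @` range (fun i => p i + t *: u i)) (g (p i + t *: u i)).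
    by exists (p i + t *: u i) => //; exists i.
  by rewrite -eqH => -[_ hy]; apply/eqP; rewrite subr_eq0; exact/eqP.
have lz0 : l (p i1 - t *: u i1) != 0.
  apply/eqP => /eqP; rewrite subr_eq0 => /eqP lz.
  have : (range g `&` hyperplane n c) (g (p i1 - t *: u i1)) by split; [exists (p i1 - t *: u i1)|].
  by rewrite eqH => -[_ [j _ <-]] /gI /eqP; rewrite eq_sym (negPf (zy j)).
have sg : \sum_i ((al i + be i / t) *: g (p i + t *: u i) -
    (ga i + be i / t) *: g (p i - t *: u i)) = 0.
  transitivity (Df t + Dp t *: w t).
    rewrite /Df /Dp /symdiff scaler_suml -big_split /=; apply: eq_bigr => i _.
    by apply/rowP => j; rewrite /g !mxE /GRing.scale /=; ring.
  by rewrite /w scalerA mulrN divff // scaleN1r subrr.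
(* The constant c drops out because the a i sum to 0, and the terms at the contact points vanish. *)
have sum0 : \sum_i (ga i + be i / t) * l (p i - t *: u i) = 0.
  have h : \sum_i ((al i + be i / t) * (g (p i + t *: u i) *m n) 0 0 -
      (ga i + be i / t) * (g (p i - t *: u i) *m n) 0 0) = 0.
    transitivity (((0 : 'rV[R]_N) *m n) 0 0); last by rewrite mul0mx mxE.
    rewrite -sg mulmx_suml summxE; apply: eq_bigr => i _.
    by rewrite mulmxBl -!scalemxAl !mxE.
  have sac : \sum_i a i * - c = 0 by rewrite -mulr_suml sa mul0r.
  rewrite -[LHS]addr0 -[X in _ + X]sac -[RHS]oppr0 -[X in _ = - X]h -sumrN -big_split /=.
  apply: eq_bigr => i _.
  have := ly i; rewrite /l -(alga i) => /eqP; rewrite subr_eq0 => /eqP ->.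
  ring.
have bl0 (l' : 'rV[R]_k -> R) : (forall x, 0 <= l' x) ->
    \sum_i (ga i + be i / t) * l' (p i - t *: u i) = 0 -> l' (p i1 - t *: u i1) = 0.
  move=> l'0 s0.
  have /eqP := psumr_eq0P (fun i _ => mulr_ge0 (ypos i) (l'0 _)) s0 (i := i1) isT.
  by rewrite mulf_eq0 gt_eqF //= => /eqP.
move/eqP: lz0; case: sup => hs; apply; first by apply: bl0 sum0 => x; rewrite subr_ge0; apply: hs; exists x.
apply: oppr_inj; rewrite oppr0; apply: (bl0 (fun x => - l x)).
  by move=> x; rewrite oppr_ge0 subr_le0; apply: hs; exists x.
rewrite -[RHS]oppr0 -[X in _ = - X]sum0 -sumrN; apply: eq_bigr => i _; exact: mulrN.
Unshelve. all: by end_near. Qed.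
End StableIndependence.

(** * One further value *)

Section Neighborly.
Variables (R : realType) (k N r : nat).
Variable f : 'rV[R]_k -> 'rV[R]_N.

Lemma continuous_functional (n : 'cV[R]_N) : continuous (fun z : 'rV[R]_N => (z *m n) 0 0).
Proof.
have -> : (fun z : 'rV[R]_N => (z *m n) 0 0) = (fun z => \sum_j z 0 j * n j 0).
  by apply/funext => z; rewrite mxE.
apply: continuous_big => [|j _ z]; first exact: add_continuous.
by apply: (@cvgM _ _ (nbhs z)); [exact: coord_continuous|exact: cvg_cst].
Qed.

Lemma derive_ge0 (n : 'cV[R]_N) x v : differentiable f x ->
  (forall y, (f x *m n) 0 0 <= (f y *m n) 0 0) -> 0 <= ('d f x v *m n) 0 0.
Proof.
move=> df mn.
have h : (t^-1 *: (f (x + t *: v) - f x) *m n) 0 0 @[t --> (0 : R)^'+] --> ('d f x v *m n) 0 0.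
  exact: (cvg_comp _ _ (@cvg_quotient _ _ _ f x v df) (@continuous_functional n _)).
rewrite -(cvg_lim _ h) //; apply: limr_ge; first by apply/cvg_ex; eexists; exact: h.
near=> t; have t0 : 0 < t by near: t; exact: nbhs_right_gt.
rewrite -scalemxAl mxE mulr_ge0 ?invr_ge0 ?(ltW t0) //.
suff -> : ((f (x + t *: v) - f x) *m n) 0 0 = (f (x + t *: v) *m n) 0 0 - (f x *m n) 0 0.
  by rewrite subr_ge0.
by rewrite mulmxBl !mxE.
Unshelve. all: by end_near. Qed.

Lemma derive_min (n : 'cV[R]_N) x v : differentiable f x ->
  (forall y, (f x *m n) 0 0 <= (f y *m n) 0 0) -> ('d f x v *m n) 0 0 = 0.
Proof.
move=> df mn; apply/eqP; rewrite eq_le derive_ge0 // andbT.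
by have := derive_ge0 (- v) df mn; rewrite linearN mulNmx mxE oppr_ge0.
Qed.

Lemma neighborly_independence (p : 'I_r -> 'rV[R]_k) q (a : 'I_r -> R)
    (v : 'I_r -> 'rV[R]_k) (s : R) :
  (forall x, differentiable f x) -> injective f -> neighborly r f -> injective p ->
  (forall i, p i != q) -> \sum_i a i + s = 0 ->
  \sum_i (a i *: f (p i) + 'd f (p i) (v i)) + s *: f q = 0 -> s = 0.
Proof.
move=> df fI fn pI pq sa sf; have [n [c [_ sup eqH]]] := fn _ pI.
have lp i : (f (p i) *m n) 0 0 = c.
  have : (f @` range p) (f (p i)) by exists (p i) => //; exists i.
  by rewrite -eqH => -[].
have lq : (f q *m n) 0 0 != c.
  apply/eqP => e; have : (range f `&` hyperplane n c) (f q) by split; [exists q|].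
  by rewrite eqH => -[_ [i _ <-]] /fI /eqP; rewrite (negPf (pq i)).
have dl i : ('d f (p i) (v i) *m n) 0 0 = 0.
  case: sup => sup.
    by apply: derive_min => // y; rewrite lp; apply: sup; exists y.
  apply: oppr_inj; rewrite oppr0.
  have oppE (z : 'rV[R]_N) : (z *m - n) 0 0 = - (z *m n) 0 0 by rewrite mulmxN mxE.
  rewrite -oppE; apply: derive_min => // y; rewrite !oppE lerN2 lp.
  by apply: sup; exists y.
have : ((\sum_i (a i *: f (p i) + 'd f (p i) (v i)) + s *: f q) *m n) 0 0 = 0.
  by rewrite sf mul0mx mxE.
rewrite mulmxDl mulmx_suml mxE summxE (eq_bigr (fun i => a i * c)); last first.
  by move=> i _; rewrite mulmxDl -scalemxAl 2!mxE dl addr0 lp.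
rewrite -mulr_suml -scalemxAl mxE.
have -> : \sum_i a i = - s by apply/eqP; rewrite -addr_eq0 sa.
rewrite mulNr addrC -mulrBr => /eqP; rewrite mulf_eq0 subr_eq0 (negPf lq) orbF.
by move/eqP.
Qed.
End Neighborly.

(** * The lower bound *)

Section BinaryDigits.

Lemma binary_expansion n r : (r < 2 ^ n)%N -> (\sum_(i < n) odd (r %/ 2 ^ i) * 2 ^ i)%N = r.
Proof.
elim: n r => [|n IH] r rn; first by rewrite big_ord0; case: r rn.
rewrite big_ord_recl /= divn1 muln1.
have rn' : (r./2 < 2 ^ n)%N by rewrite expnS in rn; lia.
rewrite -[in RHS](odd_double_half r) -muln2 -[in RHS](IH _ rn') big_distrl /=.
congr (_ + _)%N; apply: eq_bigr => i _.
by rewrite /= ?/bump ?add1n expnS divnMA divn2 (mulnC 2%N) mulnA.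
Qed.

Definition digits r : seq nat := [seq i <- iota 0 r | odd (r %/ 2 ^ i)].

Lemma sum_digits r (F : nat -> nat) :
  (\sum_(a <- digits r) F a)%N = (\sum_(i < r) odd (r %/ 2 ^ i) * F i)%N.
Proof.
have -> : digits r = [seq i <- index_iota 0 r | odd (r %/ 2 ^ i)].
  by rewrite /index_iota subn0.
rewrite big_filter big_mkord big_mkcond /=.
by apply: eq_bigr => i _; case: odd; rewrite ?mul1n ?mul0n.
Qed.

Lemma sum_digits_exp r : (\sum_(a <- digits r) 2 ^ a)%N = r.
Proof. by rewrite sum_digits binary_expansion // ltn_expl. Qed.

Lemma size_digits r : size (digits r) = binary_ones r.
Proof.
rewrite -sum1_size sum_digits /binary_ones.
by apply: eq_bigr => i _; rewrite muln1.
Qed.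

Lemma sum_bdim k r :
  (\sum_(a <- digits r) bdim k a)%N = (k.+1 * r + k.-1 * (r - binary_ones r))%N.
Proof.
(* The sum of 2^a - 1 over the digits a is r - d(r). *)
have h : (\sum_(a <- digits r) (2 ^ a).-1 + binary_ones r)%N = r.
  rewrite -size_digits -sum1_size -big_split -[RHS]sum_digits_exp.
  by apply: eq_bigr => a _; rewrite /= addn1 prednK ?expn_gt0.
rewrite /bdim big_split /= -!big_distrr /= sum_digits_exp; congr (_ + _ * _)%N.
by rewrite -[X in (X - _)%N]h addnK.
Qed.

Lemma binary_ones_le r : (binary_ones r <= r)%N.
Proof.
by rewrite -size_digits size_filter (leq_trans (count_size _ _)) // size_iota.
Qed.

Lemma binary_ones_exp m : binary_ones (2 ^ m) = 1%N.
Proof.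
have mr : (m < 2 ^ m)%N by rewrite ltn_expl.
rewrite /binary_ones (bigD1 (Ordinal mr)) //= divnn expn_gt0 /= big1 // => i im.
have [im'|mi] := ltnP i m; last first.
  rewrite divn_small // ltn_exp2l // ltn_neqAle mi andbT.
  by apply: contra im => /eqP e; apply/eqP/val_inj.
by rewrite -expnB // ?(ltnW im') // oddX subn_eq0 leqNgt im'.
Qed.
End BinaryDigits.

(** * The dimension bound from jets of (1, f) *)

Section LowerBound.
Variables (R : realType) (k N : nat) (f : 'rV[R]_k -> 'rV[R]_N).

(* The jets of (1, f): the map itself for i = 0, then its partial derivatives. *)
Definition jet (i : nat) (x : 'rV[R]_k) : 'rV[R]_(1 + N) :=
  if i is j.+1 then
    row_mx 0 (if insub j is Some i' then 'D_(delta_mx 0 (i' : 'I_k)) f x else 0)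
  else row_mx (const_mx 1) (f x).

Lemma jetS (j : 'I_k) x : jet j.+1 x = row_mx 0 ('D_(delta_mx 0 j) f x).
Proof. by rewrite /jet valK. Qed.

Lemma continuous_row_mx (T : topologicalType) m (g : T -> 'rV[R]_1) (h : T -> 'rV[R]_m) :
  continuous g -> continuous h -> continuous (fun x => row_mx (g x) (h x) : 'rV[R]_(1 + m)).
Proof.
move=> cg ch x; apply/cvgrPdist_lt => e e0; near=> y.
rewrite opp_row_mx add_row_mx {1}/Num.norm /= mx_normrE; apply/bigmax_ltP; split=> // -[i j] _ /=.
rewrite (ord1 i) mxE; case: splitP => l _.
  apply: le_lt_trans (coord_norm_le _ _) _.
  by near: y; move/cvgrPdist_lt: (cg x); exact.
apply: le_lt_trans (coord_norm_le _ _) _.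
by near: y; move/cvgrPdist_lt: (ch x); exact.
Unshelve. all: by end_near. Qed.

Lemma continuous_jet : smooth f -> forall i, continuous (jet i).
Proof.
move=> fs [|i]; apply: continuous_row_mx; try exact: cst_continuous.
  by move=> x; exact/differentiable_continuous/smooth_diff.
case: insubP => [j _ _|_] x; last exact: cst_continuous.
exact: differentiable_continuous (fs [:: j] x).
Qed.

Lemma dE x v : smooth f -> 'd f x v = \sum_j v 0 j *: 'D_(delta_mx 0 j) f x.
Proof.
move=> fs; rewrite {1}(row_sum_delta v) linear_sum; apply: eq_bigr => j _.
by rewrite linearZ /= deriveE //; exact: smooth_diff.
Qed.

Lemma sum_row_mx (I : Type) (s : seq I) m1 m2 (A : I -> 'rV[R]_m1) (B : I -> 'rV[R]_m2) :
  \sum_(i <- s) row_mx (A i) (B i) = row_mx (\sum_(i <- s) A i) (\sum_(i <- s) B i).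
Proof.
elim: s => [|x s IH]; first by rewrite !big_nil row_mx0.
by rewrite !big_cons IH add_row_mx.
Qed.

Lemma sum_jet (c : nat -> R) x : smooth f ->
  \sum_(i < k.+1) c i *: jet i x =
  row_mx (const_mx (c 0%N)) (c 0%N *: f x + 'd f x (\row_(j < k) c j.+1)).
Proof.
move=> fs; rewrite big_ord_recl (eq_bigr (fun j : 'I_k =>
    row_mx 0 (c j.+1 *: 'D_(delta_mx 0 j) f x))); last first.
  by move=> j _; rewrite lift0 jetS scale_row_mx scaler0.
rewrite sum_row_mx big1 // scale_row_mx add_row_mx addr0 dE //.
congr (row_mx _ (_ + _)); first by apply/rowP => i; rewrite !mxE mulr1.
by apply: eq_bigr => j _; rewrite mxE.
Qed.

(** The constant coordinate 1 makes the relation affine: its point coefficients sum to 0, as both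
    independence lemmas require. It raises the target dimension to 1 + N, still within reach of
    [dependent_jets] when N is below the bound. *)
Lemma stably_neighborly_dim r : (exists m, k = (2 ^ m)%N) -> stably_neighborly r f ->
  (k.+1 * r + k.-1 * (r - binary_ones r) <= N)%N.
Proof.
move=> hk hf; rewrite leqNgt; apply/negP => hN.
have k0 : (0 < k)%N by case: hk => m ->; rewrite expn_gt0.
have [[fs _ fh] fn _] := hf.
have [||xs [q [co [b [sx ux rel nz]]]]] := @dependent_jets R k (1 + N) jet (digits r) hk.
- by rewrite sum_bdim.
- exact: continuous_jet.
rewrite sum_digits_exp in sx.
have [qx ux'] : q \notin xs /\ uniq xs by apply/andP.
pose p (i : 'I_r) := nth 0 xs i.
have pI : injective p.
  by move=> i j /eqP; rewrite nth_uniq ?sx // => /eqP/val_inj.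
have pq i : p i != q by apply: contraNneq qx => <-; rewrite mem_nth // sx.
pose a i := co (p i) 0%N; pose v i : 'rV[R]_k := \row_j co (p i) j.+1.
have {}rel : row_mx (\sum_i const_mx (a i) + b *: const_mx 1)
    (\sum_i (a i *: f (p i) + 'd f (p i) (v i)) + b *: f q) = 0 :> 'rV[R]_(1 + N).
  rewrite -[RHS]rel (big_nth 0) sx big_mkord -add_row_mx -sum_row_mx -scale_row_mx.
  by congr (_ + _); apply: eq_bigr => i _; rewrite sum_jet.
rewrite -row_mx0 in rel; have [sa sf] := eq_row_mx rel.
have {}sa : \sum_i a i + b = 0.
  move/rowP: sa => /(_ 0); rewrite !mxE summxE mulr1 => {2}<-.
  by congr (_ + _); apply: eq_bigr => i _; rewrite mxE.
have b0 : b = 0.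
  apply: neighborly_independence fn pI pq sa sf; last exact: homeo_inj fh.
  by move=> x; exact: smooth_diff.
rewrite b0 scale0r !addr0 in sa sf.
have h := stable_independence k0 hf pI sa sf.
case: nz => [[x [i [xx ik]]]|]; last by rewrite b0 eqxx.
have jr : (index x xs < r)%N by rewrite -sx index_mem.
have [] := h (Ordinal jr); rewrite /a /v /p /= nth_index //.
case: i ik => [|i] ik az vz; first by rewrite az eqxx.
by move/rowP: vz => /(_ (Ordinal (ik : (i < k)%N))); rewrite !mxE => ->; rewrite eqxx.
Qed.
End LowerBound.

Lemma Delta_ge (R : realType) (k r : nat) (c : R) : (exists m : nat, k = (2 ^ m)%N) ->
  c < (k.+1 * r + k.-1 * (r - binary_ones r))%:R -> (c%:E < Delta R k r)%E.
Proof.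
move=> hk hc; rewrite /Delta; case: pselect => [ex|_]; last exact: ltry.
rewrite lte_fin; case: ex_minnP => N /asboolP [f hf] _.
apply: lt_le_trans hc _; rewrite ler_nat; exact: stably_neighborly_dim hk hf.
Qed.

Theorem theorem1 (R : realType) (k r : nat)
    (hk : exists m : nat, k = (2 ^ m)%N) (hr : (1 <= r)%N) :
  (((k%:R + 1) * r%:R + (k%:R - 1) * (r%:R - (binary_ones r)%:R) - 1)%:E
     < Delta R k r)%E
  /\ ((exists m : nat, r = (2 ^ m)%N) ->
      ((2 * k%:R * r%:R - k%:R)%:E < Delta R k r)%E).
Proof.
have k0 : (0 < k)%N by case: hk => m ->; rewrite expn_gt0.
have e : (k.+1 * r + k.-1 * (r - binary_ones r))%:R =
    (k%:R + 1) * r%:R + (k%:R - 1) * (r%:R - (binary_ones r)%:R) :> R.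
  by rewrite -subn1 natrD !natrM !natrB ?binary_ones_le // -natr1.
split; first by apply: Delta_ge => //; rewrite e ltrBlDr ltrDl ltr01.
(* For d(r) = 1 the bound equals 2kr - k + 1. *)
case=> m rm; apply: Delta_ge => //; rewrite e rm binary_ones_exp.
lra.
Qed.
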